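(* Let $\Omega\subset\mathbb{R}^d$ ($d\ge 2$) be an open, bounded, connected set with sufficiently regular boundary, $Y=(0,1)^d$, and $0<\sigma^-<\sigma^+$. Consider the class of symmetric real $d\times d$ matrix functions $(t,y)\mapsto A(t,y)=\{a_{ij}(t,y)\}_{1\le i,j\le d}$, $t\in[\sigma^-,\sigma^+]$, with each $a_{ij}$ $Y$-periodic in $y$. Assume that there exist $E_1,\alpha,\beta>0$ such that (i) $A\in W^{1,\infty}([\sigma^-,\sigma^+]\times Y,\mathrm{Sym}_d)$ and $\|A\|_{W^{1,\infty}([\sigma^-,\sigma^+];W^{1,\infty}(Y))}\le E_1$; (ii) $\partial_tA\in W^{1,\infty}([\sigma^-,\sigma^+]\times Y,\mathrm{Sym}_d)$ and $\|\partial_tA\|_{W^{1,\infty}([\sigma^-,\sigma^+];W^{1,\infty}(Y))}\le E_1$; (iii) $\alpha|\xi|^2\le A(t,y)\xi\cdot\xi$ and $|A(t,y)\xi|\le\beta|\xi|$ for a.e. $y\in Y$, all $t\in[\sigma^-,\sigma^+]$, all $\xi\in\mathbb{R}^d$; (iv) $\partial_tA(t,y)\xi\cdot\xi\ge E_1^{-1}|\xi|^2$ for a.e. $y\in Y$, all $t\in[\sigma^-,\sigma^+]$, all $\xi\in\mathbb{R}^d$. Let $U=\{\sigma\in L^\infty(\Omega):\sigma^-\le\sigma(x)\le\sigma^+\}$, let $X=C^0(\overline\Omega)$ with the sup norm, and let $\mu_{pr}$ be a Gaussian probability measure on $X$. Let $P:\theta\in X\mapsto\sigma\in U$ be defined as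 one of the following two maps: (a) $P=P_1$, with $P_1(\theta)=\exp(\theta)$; (b) $P=P_2$, with $P_2(\theta)=\sum_{i=1}^nf_i\mathbb 1_{\Omega_i}$, where $n\in\mathbb{N}$, $-\infty=c_0<\dots<c_n=\infty$ are fixed constants, $\Omega_i=\{x\in\Omega:c_{i-1}\le\theta(x)<c_i\}$ for $i=1,\dots,n$, and $f_1,\dots,f_n\in C^0(\overline\Omega)$ are given strictly positive functions. Let $G^0=F^0\circ P:X\to\mathbb{R}^{JL}$, with $F^0:U\to\mathbb{R}^{JL}$ the homogenized observation operator defined in the context, and let $\Phi^0:X\times\mathbb{R}^{JL}\to\mathbb{R}$ be $$\Phi^0(\theta,z)=\tfrac12\|z-G^0(\theta)\|_{C_e}^2,\qquad\|v\|_{C_e}^2=v^\top C_e^{-1}v,$$ where $C_e$ is a given (invertible) $JL\times JL$ covariance matrix. Then: 1. For every $r>0$ there is $K=K(r)$ such that for all $\theta\in X$ and all $z\in\mathbb{R}^{JL}$ with $\max\{\|\theta\|_X,\|z\|_{C_e}\}<r$, $$0\le\Phi^0(\theta,z)\le K.$$ 2. For any fixed $z\in\mathbb{R}^{JL}$ the function $\Phi^0(\cdot,z):X\to\mathbb{R}$ is continuous $\mu_{pr}$-almost surely on the probability space $(X,\Sigma,\mu_{pr})$, $\Sigma$ being the $\sigma$-algebra on which $\mu_{pr}$ is defined. 3. For $z_1,z_2\in\mathbb{R}^{JL}$ with $\max\{\|z_1\|_{C_e},\|z_2\|_{C_e}\}<r$ and for every $\theta\in X$, there exists $C=C(r,\|\theta\|_X)$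 such that $$|\Phi^0(\theta,z_1)-\Phi^0(\theta,z_2)|\le C\|z_1-z_2\|_{C_e}.$$
   Context: $\mathrm{Sym}_d$ is the space of symmetric real $d\times d$ matrices. Homogenized tensor: for $t\in[\sigma^-,\sigma^+]$, $A^0(t)=\{a^0_{ij}(t)\}$ is given by $$a^0_{ij}(t)=\frac1{|Y|}\int_Y a_{ij}(t,y)\,dy-\frac1{|Y|}\sum_{k=1}^d\int_Y a_{ik}(t,y)\frac{\partial\chi_j}{\partial y_k}\,dy,$$ where $\chi_j=\chi_j(t,\cdot)\in W^1_{per}(Y)$ is the unique solution of $\int_YA(t,y)\nabla_y\chi_j\cdot\nabla_yv\,dy=\int_YA(t,y)\mathbf e_j\cdot\nabla_yv\,dy$ for all $v\in W^1_{per}(Y)$. Here $\mathbf e_1,\dots,\mathbf e_d$ is the canonical basis of $\mathbb{R}^d$, $W^1_{per}(Y)=\{v\in H^1_{per}(Y):\int_Yv\,dy=0\}$, and $H^1_{per}(Y)$ is the $H^1$-closure of the smooth $Y$-periodic functions. For $\sigma\in U$, $A^0_\sigma(x)=A^0(\sigma(x))$. Dirichlet-to-Neumann map: for a bounded, uniformly elliptic symmetric tensor $B$ on $\Omega$, $\Lambda_B:H^{1/2}(\partial\Omega)\to H^{-1/2}(\partial\Omega)$ sends $g$ to $B\nabla u\cdot\nu|_{\partial\Omega}$, where $\nu$ is the exterior unit normal and $u\in H^1(\Omega)$ is the weak solution of $-\nabla\cdot(B\nabla u)=0$ in $\Omega$, $u=g$ on $\partial\Omega$. Observation operator: fix $J,L\in\mathbb{N}$,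 pairwise disjoint boundary portions $\Gamma_1,\dots,\Gamma_J\subset\partial\Omega$, functions $\phi_j\in H^{1/2}(\partial\Omega)$ with $\mathrm{supp}(\phi_j)\subseteq\Gamma_j$ ($j=1,\dots,J$), and Dirichlet data $g_l\in H^{1/2}(\partial\Omega)$ ($l=1,\dots,L$). Then $F^0(\sigma)\in\mathbb{R}^{JL}$ is the vector with entries $f^0_{jl}(\sigma)=\int_{\Gamma_j}\Lambda_{A^0_\sigma}g_l\cdot\phi_j\,ds$, understood as the duality pairing between $H^{-1/2}(\partial\Omega)$ and $H^{1/2}(\partial\Omega)$.
   Formalization: As exp(θ) need not lie in [σ⁻,σ⁺], the claims are for θ with P(θ) in U, with continuity relative to that set; claim 2 in case (b), false e.g. for a Dirac mass at the constant c₁, assumes θ(x) has positive variance for a.e. x in Ω. *)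

(* Defs.v *)
From HB Require Import structures.
From mathcomp Require Import all_boot all_order all_algebra.
From mathcomp Require Import all_classical all_reals all_analysis.

Set Implicit Arguments.
Unset Strict Implicit.
Unset Printing Implicit Defensive.

Import Order.TTheory GRing.Theory Num.Theory.
Import numFieldNormedType.Exports.

Local Open Scope classical_set_scope.
Local Open Scope ring_scope.

Section measurable_rV.
Context {R : realType} (n : nat).

Let coord (i : 'I_n) (x : 'rV[R]_n) : R := x ord0 i.

Let rV_set0 : g_sigma_preimage coord set0.
Proof. exact: sigma_algebra0. Qed.

Let rV_setC A : g_sigma_preimage coord A -> g_sigma_preimage coord (~` A).
Proof. exact: sigma_algebraC. Qed.

Let rV_bigcup (F : (set 'rV[R]_n)^nat) :
  (forall i, g_sigma_preimage coord (F i)) ->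
  g_sigma_preimage coord (\bigcup_i (F i)).
Proof. exact: sigma_algebra_bigcup. Qed.

(* The sigma-algebra generated by the coordinates, i.e. the Borel sets of R^n. *)
HB.instance Definition _ := @isMeasurable.Build default_measure_display
  'rV[R]_n (g_sigma_preimage coord) rV_set0 rV_setC rV_bigcup.

Lemma measurable_coord (i : 'I_n) :
  measurable_fun [set: 'rV[R]_n] (fun x : 'rV[R]_n => x ord0 i).
Proof.
move=> _ Y mY; rewrite setTI; apply: sub_sigma_algebra => /=.
rewrite -bigcup_seq/=; exists i => /=; first by rewrite mem_index_enum.
by exists Y => //; rewrite setTI.
Qed.

Lemma measurable_to_rV d (T : measurableType d) (f : T -> 'rV[R]_n) :
  (forall i, measurable_fun [set: T] (fun t => f t ord0 i)) ->
  measurable_fun [set: T] f.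
Proof.
move=> mf _ A mA; rewrite setTI.
suff : measurable `<=` [set B | measurable (f @^-1` B)] by apply.
apply: smallest_sub.
  split => /=.
  - by rewrite preimage_set0.
  - by move=> B mB; rewrite setTD preimage_setC; exact: measurableC.
  - by move=> F mF; rewrite preimage_bigcup; exact: bigcup_measurable.
move=> B; rewrite -bigcup_seq/= => -[i _ [C mC <-]].
by rewrite setTI /= -[X in measurable X]setTI; exact: mf.
Qed.

End measurable_rV.

Section lebesgue_rV.
Context {R : realType}.

Section step.
Variables (n : nat) (m : {sigma_finite_measure set 'rV[R]_n -> \bar R}).

Definition cons_rV (p : measurableTypeR R * 'rV[R]_n) : 'rV[R]_n.+1 :=
  \row_j oapp (fun k => p.2 ord0 k) p.1 (unlift ord0 j).

Definition uncons_rV (v : 'rV[R]_n.+1) : measurableTypeR R * 'rV[R]_n :=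
  (v ord0 ord0, \row_j v ord0 (lift ord0 j)).

Lemma cons_rVK : cancel cons_rV uncons_rV.
Proof.
move=> [a v]; rewrite /cons_rV /uncons_rV /=; congr pair.
  by rewrite mxE unlift_none.
by apply/rowP => j; rewrite !mxE liftK.
Qed.

Lemma measurable_cons_rV : measurable_fun setT cons_rV.
Proof.
apply: measurable_to_rV => i; rewrite /cons_rV.
under eq_fun do rewrite mxE.
case: unliftP => [j _|_] /=; last exact: measurable_fst.
exact: (measurableT_comp (measurable_coord j) measurable_snd).
Qed.

Lemma measurable_uncons_rV : measurable_fun setT uncons_rV.
Proof.
apply/measurable_fun_pairP; split => /=; first exact: measurable_coord.
apply: measurable_to_rV => i /=.
by under eq_fun do rewrite mxE; exact: measurable_coord.
Qed.

Let mu1 : {sigma_finite_measure set (measurableTypeR R) -> \bar R} :=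
  @lebesgue_measure R.

Definition lebesgue_cons : set 'rV[R]_n.+1 -> \bar R :=
  pushforward (mu1 \x m)%E cons_rV.

Let lebesgue_cons0 : lebesgue_cons set0 = 0%E.
Proof. by rewrite /lebesgue_cons /pushforward preimage_set0 measure0. Qed.

Let lebesgue_cons_ge0 A : (0 <= lebesgue_cons A)%E.
Proof. by rewrite /lebesgue_cons /pushforward; exact: measure_ge0. Qed.

Let lebesgue_cons_sigma_additive : semi_sigma_additive lebesgue_cons.
Proof.
move=> F mF tF mUF; rewrite /lebesgue_cons /pushforward preimage_bigcup.
have mc A : measurable A -> measurable (cons_rV @^-1` A).
  by move=> mA; rewrite -[X in measurable X]setTI; exact: measurable_cons_rV.
apply: measure_semi_sigma_additive.
- by move=> k; exact: mc.
- apply/trivIsetP => /= i j _ _ ij; rewrite -preimage_setI.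
  by move/trivIsetP : tF => /(_ _ _ _ _ ij) ->//; rewrite preimage_set0.
- by rewrite -preimage_bigcup; exact: mc.
Qed.

HB.instance Definition _ := isMeasure.Build _ _ _ lebesgue_cons
  lebesgue_cons0 lebesgue_cons_ge0 lebesgue_cons_sigma_additive.

Let lebesgue_cons_sigma_finite : sigma_finite setT lebesgue_cons.
Proof.
have [F FT Foo] : sigma_finite setT (mu1 \x m)%E.
  have /sigma_finiteP[F [TF ndF Foo]] := sigma_finiteT mu1.
  have /sigma_finiteP[G [TG ndG Goo]] := sigma_finiteT m.
  exists (fun n => F n `*` G n).
    rewrite -setXTT TF TG predeqE => -[x y]; split.
      move=> [/= [i _ Fnx] [k _ Gky]]; exists (maxn i k) => //; split.
      - by move: x Fnx; exact/subsetPset/ndF/leq_maxl.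
      - by move: y Gky; exact/subsetPset/ndG/leq_maxr.
    by move=> [i _ []/= ? ?]; split; exists i.
  move=> k; have [? ?] := Foo k; have [? ?] := Goo k.
  split; first exact: measurableX.
  by rewrite product_measure1E// lte_mul_pinfty// ge0_fin_numE.
exists (fun k => uncons_rV @^-1` F k).
  by rewrite -preimage_bigcup -FT preimage_setT.
move=> k; have [mF Fk] := Foo k; split.
  by rewrite -[X in measurable X]setTI; exact: measurable_uncons_rV.
rewrite /lebesgue_cons /pushforward -comp_preimage.
rewrite (_ : uncons_rV \o cons_rV = id) ?preimage_id//.
by apply/funext => p /=; rewrite cons_rVK.
Qed.

HB.instance Definition _ := Measure_isSigmaFinite.Build _ _ _ lebesgue_cons
  lebesgue_cons_sigma_finite.

End step.

Fixpoint lebesgue_rV (n : nat) : {sigma_finite_measure set 'rV[R]_n -> \bar R} :=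
  match n with
  | 0 => dirac (0 : 'rV[R]_0)
  | n'.+1 => lebesgue_cons (lebesgue_rV n')
  end.

End lebesgue_rV.

Section euclidean.
Context {R : realType} {n : nat}.
Implicit Types x y : 'rV[R]_n.

Definition dotp x y : R := \sum_i x ord0 i * y ord0 i.

(* The canonical norm of 'rV[R]_n is the sup norm, hence this definition. *)
Definition enorm x : R := Num.sqrt (dotp x x).

End euclidean.

Section hausdorff.
Context {R : realType} (n s : nat).
Local Open Scope ereal_scope.
Implicit Types (A : set 'rV[R]_n) (delta : R).

(* r k stands for the Euclidean diameter of the k-th set of the covering. *)
Definition hausdorff_cover delta A (C : (set 'rV[R]_n)^nat) (r : R^nat) : Prop :=
  [/\ A `<=` \bigcup_k C k, (forall k, 0 <= r k <= delta)%R &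
      forall k x y, C k x -> C k y -> (enorm (x - y) <= r k)%R].

Definition hausdorff_pre delta A : \bar R :=
  ereal_inf [set z | exists C r, hausdorff_cover delta A C r /\
                                 z = \sum_(0 <= k <oo) (r k ^+ s.+1)%:E].

(* The (s+1)-dimensional Hausdorff measure on R^n, up to the constant factor
   that makes it agree with the Lebesgue measure when n = s+1. *)
Definition hausdorff A : \bar R :=
  ereal_sup [set hausdorff_pre delta A | delta in [set delta | (0 < delta)%R]].

Let pre_ge0 delta A : 0 <= hausdorff_pre delta A.
Proof.
apply: le_ereal_inf_tmp => z [C [r [[_ r0 _] ->]]].
apply: nneseries_ge0 => k _ _; rewrite lee_fin exprn_ge0//.
by have /andP[] := r0 k.
Qed.

Let pre_le delta A B : A `<=` B -> hausdorff_pre delta A <= hausdorff_pre delta B.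
Proof.
move=> AB; apply: ereal_inf_le_tmp => z [C [r [[BC r0 rC] ->]]].
by exists C, r; split => //; split => //; exact: subset_trans BC.
Qed.

Let pre0 delta : (0 < delta)%R -> hausdorff_pre delta set0 = 0.
Proof.
move=> d0; apply/eqP; rewrite eq_le pre_ge0 andbT.
apply: ereal_inf_lbound; exists (fun=> set0), (fun=> 0%R); split.
  by split => // k; rewrite lexx ltW.
by rewrite eseries0// => k _ _; rewrite expr0n.
Qed.

Let pre_subadditive delta : sigma_subadditive (hausdorff_pre delta).
Proof.
move=> A; have [[i ioo]|] := pselect (exists i, hausdorff_pre delta (A i) = +oo).
  by rewrite (eseries_pinfty _ _ ioo) ?leey// => k _; rewrite -ltNye (lt_le_trans _ (pre_ge0 _ _)).
rewrite -forallNE => Aoo.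
suff add2e (e : {posnum R}) : hausdorff_pre delta (\bigcup_n A n) <=
    \sum_(i <oo) hausdorff_pre delta (A i) + e%:num%:E.
  by apply/lee_addgt0Pr => _/posnumP[].
rewrite (le_trans _ (epsilon_trick _ _ _))//.
pose P k (Cr : (set 'rV[R]_n)^nat * R^nat) := hausdorff_cover delta (A k) Cr.1 Cr.2 /\
  \sum_(0 <= j <oo) (Cr.2 j ^+ s.+1)%:E <=
    hausdorff_pre delta (A k) + (e%:num / (2 ^ k.+1)%:R)%:E.
have [G PG] : {G : nat -> (set 'rV[R]_n)^nat * R^nat & forall k, P k (G k)}.
  apply: (@choice _ _ P) => k; rewrite /P.
  have fAk : hausdorff_pre delta (A k) \is a fin_num.
    by rewrite ge0_fin_numE// ltey; apply/eqP.
  have en1 : (0 < e%:num / (2 ^ k.+1)%:R :> R)%R by [].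
  have [_ [C [r [Cr ->]]] Ck] := lb_ereal_inf_adherent en1 fAk.
  by exists (C, r); split => //; exact/ltW.
pose H (p : nat * nat) : \bar R := ((G p.1).2 p.2 ^+ s.+1)%:E.
have H0 p : 0 <= H p.
  rewrite lee_fin exprn_ge0//.
  by have [[_ /(_ p.2)/andP[]]] := PG p.1.
apply: (@le_trans _ _ (\esum_(p in setT) H p)).
  have /card_esym/ppcard_eqP[f] := card_nat2.
  apply: ereal_inf_lbound => /=.
  exists (fun k => (G (f k).1).1 (f k).2), (fun k => (G (f k).1).2 (f k).2).
  split; first split.
  - move=> t [i _ Ait]; have [[/(_ t Ait)[j _ Ct] _ _] _] := PG i.
    by exists (f^-1%FUN (i, j)) => //=; rewrite invK ?inE.
  - by move=> k; have [[_ /(_ (f k).2)]] := PG (f k).1.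
  - by move=> k; have [[_ _ /(_ (f k).2)]] := PG (f k).1.
  transitivity (\sum_(0 <= k <oo) H (f k)); last exact: eq_eseriesr.
  rewrite -(esum_pred_image H f xpredT)//; last by rewrite [X in set_inj X _](_ : _ = setT) //; apply/seteqP.
  congr esum; apply/seteqP; split => // p _.
  by exists (f^-1%FUN p) => //; rewrite invK ?inE.
rewrite (_ : esum _ _ = \sum_(i <oo) \sum_(j <oo) H (i, j)); last first.
  pose J : nat -> set (nat * nat) := fun i => [set (i, j) | j in setT].
  rewrite (_ : setT = \bigcup_k J k); last first.
    by rewrite predeqE => -[a b]; split => // _; exists a => //; exists b.
  rewrite esum_bigcupT//=; last first.
    apply/trivIsetP => i j _ _ ij.
    rewrite predeqE => -[k m] /=; split => //= -[] [_] _ [<-{k} _].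
    by move=> [m' _] [] /esym/eqP; rewrite (negbTE ij).
  rewrite -(image_id [set: nat]) -fun_true esum_pred_image//; last first.
    by move=> k _; exact: esum_ge0.
  apply: eq_eseriesr => /= j _.
  rewrite -(esum_pred_image H (pair j) predT)//=; last first.
    by move=> ? ? _ _; exact: (@can_inj _ _ _ snd).
  by congr esum; rewrite predeqE => -[a b]; split; move=> [i _ <-]; exists i.
apply: lee_lim.
- apply: is_cvg_nneseries => k *.
  by apply: nneseries_ge0 => m *; exact: (H0 (k, m)).
- by apply: is_cvg_nneseries => k *; apply: adde_ge0 => //; exact: pre_ge0.
- by near=> k; apply: lee_sum => i _; exact: (PG i).2.
Unshelve. all: by end_near. Qed.

Let hausdorff0 : hausdorff set0 = 0.
Proof.
apply/eqP; rewrite eq_le; apply/andP; split.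
  by apply: ge_ereal_sup => _ [delta d0 <-]; rewrite pre0.
apply: ereal_sup_ubound; by exists 1%R; [exact: ltr01|exact: (pre0 ltr01)].
Qed.

Let hausdorff_ge0 A : 0 <= hausdorff A.
Proof.
apply: (le_trans (pre_ge0 1 A)).
by apply: ereal_sup_ubound; exists 1%R => //; rewrite /= ltr01.
Qed.

Let le_hausdorff : {homo hausdorff : A B / A `<=` B >-> A <= B}.
Proof.
move=> A B AB; apply: ge_ereal_sup => _ [delta d0 <-].
apply: (le_trans (pre_le delta AB)).
by apply: ereal_sup_ubound; exists delta.
Qed.

Let hausdorff_subadditive : sigma_subadditive hausdorff.
Proof.
move=> A; apply: ge_ereal_sup => _ [delta d0 <-].
apply: (le_trans (pre_subadditive delta A)).
apply: lee_nneseries => [k _ _|k _]; first exact: pre_ge0.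
by apply: ereal_sup_ubound; exists delta.
Qed.

HB.instance Definition _ := isOuterMeasure.Build R 'rV[R]_n hausdorff
  hausdorff0 hausdorff_ge0 le_hausdorff hausdorff_subadditive.

End hausdorff.

Section continuous_functions.
Context {R : realType} {T : topologicalType} (K : set T).

(* Functions on K are represented by their extension by 0. Boundedness is
   automatic when K is compact; it makes the sup norm finite for every K. *)
Definition is_C0 (f : T -> R^o) : Prop :=
  [/\ {within K, continuous f}, exists M, forall x, K x -> `|f x| <= M &
      forall x, ~ K x -> f x = 0].

Definition C0_pred : {pred T -> R^o} := fun f => `[< is_C0 f >].

Lemma C0_submod : submod_closed C0_pred.
Proof.
split.
  apply/asboolP; split => //; first by move=> x; exact: cst_continuous.
  by exists 0 => x _; rewrite normr0.
move=> a f g /asboolP[cf [M fM] f0] /asboolP[cg [N gN] g0]; apply/asboolP; split.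
- by move=> x; apply: cvgD; [apply: cvgZr; exact: cf|exact: cg].
- exists (`|a| * M + N) => x Kx; rewrite (le_trans (ler_normD _ _))//.
  by rewrite lerD ?gN// normrM ler_wpM2l ?fM.
- by move=> x Kx; rewrite /= !fctE f0// g0// scaler0 addr0.
Qed.

HB.instance Definition _ := GRing.isSubmodClosed.Build R (T -> R^o) C0_pred C0_submod.

Record C0 := MkC0 { C0_fun :> T -> R^o ; C0_funP : C0_fun \in C0_pred }.

HB.instance Definition _ := [isSub of C0 for C0_fun].
HB.instance Definition _ := [Choice of C0 by <:].
HB.instance Definition _ := [SubChoice_isSubLmodule of C0 by <:].

Definition C0_norm (f : C0) : R := sup [set `|f x| | x in K].

Lemma C0_norm_ub (f : C0) x : K x -> `|f x| <= C0_norm f.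
Proof.
move=> Kx; apply: ub_le_sup; last by exists x.
have /asboolP[_ [M fM] _] := C0_funP f.
by exists M => _ [y Ky <-]; exact: fM.
Qed.

Lemma C0_norm_le (f : C0) (M : R) :
  0 <= M -> (forall x, K x -> `|f x| <= M) -> C0_norm f <= M.
Proof.
move=> M0 fM; rewrite /C0_norm.
have [->|/set0P E] := eqVneq [set `|f x| | x in K] set0; first by rewrite sup0.
by apply: ge_sup => // _ [x Kx <-]; exact: fM.
Qed.

Lemma C0_norm_ge0 (f : C0) : 0 <= C0_norm f.
Proof.
have [E|/set0P[_ [x Kx _]]] := eqVneq [set `|f x| | x in K] set0.
  by rewrite /C0_norm E sup0.
exact: le_trans (normr_ge0 (f x)) (C0_norm_ub f Kx).
Qed.

Lemma C0_normD (f g : C0) : C0_norm (f + g) <= C0_norm f + C0_norm g.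
Proof.
apply: C0_norm_le => [|x Kx]; first by rewrite addr_ge0// C0_norm_ge0.
by rewrite (le_trans (ler_normD _ _))// lerD// C0_norm_ub.
Qed.

Lemma C0_normZ (a : R) (f : C0) : C0_norm (a *: f) = `|a| * C0_norm f.
Proof.
have le (b : R) (h : C0) : C0_norm (b *: h) <= `|b| * C0_norm h.
  apply: C0_norm_le => [|x Kx]; first by rewrite mulr_ge0// C0_norm_ge0.
  by rewrite normrM ler_wpM2l// C0_norm_ub.
apply/eqP; rewrite eq_le le/=.
have [->|a0] := eqVneq a 0; first by rewrite normr0 mul0r C0_norm_ge0.
rewrite -ler_pdivlMl ?normr_gt0// -normfV.
by rewrite -[in leLHS](scalerK a0 f); exact: le.
Qed.

Lemma C0_norm0_eq0 (f : C0) : C0_norm f = 0 -> f = 0.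
Proof.
move=> f0; apply/val_inj/funext => x /=.
have [Kx|nKx] := pselect (K x).
  by apply/eqP; rewrite -normr_le0 -f0; exact: C0_norm_ub.
by have /asboolP[_ _ ->] := C0_funP f.
Qed.

HB.instance Definition _ :=
  @Lmodule_isNormed.Build R C0 C0_norm C0_normD C0_normZ C0_norm0_eq0.

Definition borel_C0 := g_sigma_algebraType (@open C0).

End continuous_functions.


Section sobolev.
Context {R : realType} {d : nat}.
Implicit Types (D Omega : set 'rV[R]_d) (u v phi : 'rV[R]_d -> R).
Implicit Types (G H : 'rV[R]_d -> 'rV[R]_d).

Notation leb := (lebesgue_rV d).

Definition basis_rV (i : 'I_d) : 'rV[R]_d := delta_mx ord0 i.

Definition pderiv (i : 'I_d) u : 'rV[R]_d -> R := fun x => 'D_(basis_rV i) u x.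

Fixpoint Ck (k : nat) u : Prop :=
  continuous u /\
  match k with
  | 0 => True
  | k'.+1 => forall i, (forall x, derivable u x (basis_rV i)) /\ Ck k' (pderiv i u)
  end.

Definition smooth u : Prop := forall k, Ck k u.

Definition test_fun Omega phi : Prop :=
  smooth phi /\ exists K, [/\ compact K, K `<=` Omega & forall x, ~ K x -> phi x = 0].

Definition L2 D u : Prop :=
  measurable_fun D u /\ (\int[leb]_(x in D) ((u x) ^+ 2)%:E < +oo)%E.

Definition L2_cvg D (w : nat -> 'rV[R]_d -> R) u : Prop :=
  (\int[leb]_(x in D) ((w k x - u x) ^+ 2)%:E)%E @[k --> \oo] --> 0%E.

Definition weak_gradient Omega u G : Prop :=
  forall i phi, test_fun Omega phi ->
    \int[leb]_(x in Omega) (u x * pderiv i phi x) =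
    - \int[leb]_(x in Omega) (G x ord0 i * phi x).

Definition H1 Omega u G : Prop :=
  [/\ L2 Omega u, forall i, L2 Omega (fun x => G x ord0 i) & weak_gradient Omega u G].

(* (M xi) . eta; vectors are rows *)
Definition bform (M : 'M[R]_d) (xi eta : 'rV[R]_d) : R := dotp (xi *m M^T) eta.

End sobolev.

Section dirichlet_to_neumann.
Context {R : realType} {d : nat}.
Implicit Types (Omega : set 'rV[R]_d) (u v g phi : 'rV[R]_d -> R).
Implicit Types (G H : 'rV[R]_d -> 'rV[R]_d).

Notation leb := (lebesgue_rV d).

(* (d-1)-dimensional Hausdorff measure, on its Caratheodory sigma-algebra;
   its normalization is immaterial below *)
Definition surface : set (caratheodory_type (@hausdorff R d d.-2)) -> \bar R :=
  @hausdorff R d d.-2.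

HB.instance Definition _ := isMeasure.Build _ _ _ surface
  (caratheodory_measure0 (@hausdorff R d d.-2))
  (caratheodory_measure_ge0 (mu := @hausdorff R d d.-2))
  (caratheodory_measure_sigma_additive (mu := @hausdorff R d d.-2)).

Definition boundary Omega : set 'rV[R]_d := closure Omega `\` Omega.

(* Near each boundary point, Omega is the strict epigraph of a Lipschitz
   function gamma in some direction e; gamma is a function on the hyperplane
   orthogonal to e, extended to be constant along e. *)
Definition lipschitz_boundary Omega : Prop :=
  forall x0, boundary Omega x0 ->
  exists (r : R) (e : 'rV[R]_d) (gamma : 'rV[R]_d -> R),
    [/\ 0 < r, enorm e = 1,
        exists C, forall x y, `|gamma x - gamma y| <= C * enorm (x - y),
        forall x s, gamma (x + s *: e) = gamma x &
        forall x, enorm (x - x0) < r -> (Omega x <-> gamma x < dotp x e)].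

Definition L2_boundary Omega g : Prop :=
  measurable_fun (boundary Omega) (g : caratheodory_type (@hausdorff R d d.-2) -> R) /\
  (\int[surface]_(x in boundary Omega) ((g x) ^+ 2)%:E < +oo)%E.

(* u \in H^1(Omega) has weak gradient G and trace g: (u, G, g) is the limit, in
   L^2(Omega) x L^2(Omega)^d x L^2(boundary), of (w, grad w, w) with w smooth
   up to the boundary. *)
Definition has_trace Omega u G g : Prop :=
  [/\ H1 Omega u G, L2_boundary Omega g &
      exists w : nat -> 'rV[R]_d -> R,
        [/\ forall k, smooth (w k), L2_cvg Omega w u,
            forall i, L2_cvg Omega (fun k => pderiv i (w k)) (fun x => G x ord0 i) &
            (\int[surface]_(x in boundary Omega) ((w k x - g x) ^+ 2)%:E)%E
              @[k --> \oo] --> 0%E]].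

(* H^{1/2}(boundary): the trace space of H^1(Omega) *)
Definition H12 Omega g : Prop := exists u G, has_trace Omega u G g.

(* g is a class modulo surface-null sets, hence the essential support. *)
Definition boundary_supp Omega g : set 'rV[R]_d :=
  [set x | boundary Omega x /\ forall eps, 0 < eps ->
     ~ surface.-negligible [set y | [/\ boundary Omega y, enorm (y - x) < eps & g y != 0]]].

(* The test functions are the v \in H^1_0(Omega), i.e. those of zero trace. *)
Definition dirichlet_solution Omega (B : 'rV[R]_d -> 'M[R]_d) g u G : Prop :=
  has_trace Omega u G g /\
  forall v H, has_trace Omega v H (fun=> 0) ->
    \int[leb]_(x in Omega) bform (B x) (G x) (H x) = 0.

(* <Lambda_B g, phi>: the conormal derivative of the solution u is the functional
   phi |-> \int_Omega B grad u . grad v, with v any H^1 extension of phi. *)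
Definition DtN Omega (B : 'rV[R]_d -> 'M[R]_d) g phi : R :=
  get [set r | exists u G v H,
         [/\ dirichlet_solution Omega B g u G, has_trace Omega v H phi &
             r = \int[leb]_(x in Omega) bform (B x) (G x) (H x)]].

End dirichlet_to_neumann.

Section homogenization.
Context {R : realType} {d : nat}.
Implicit Types (u v w : 'rV[R]_d -> R) (G H : 'rV[R]_d -> 'rV[R]_d).

Notation leb := (lebesgue_rV d).

Definition cell : set 'rV[R]_d := [set y | forall i, 0 < y ord0 i < 1].

Definition cell_periodic (T : Type) (f : 'rV[R]_d -> T) : Prop :=
  forall i y, f (y + basis_rV i) = f y.

(* The H^1(Y)-closure of the smooth periodic functions; H is the gradient of v. *)
Definition H1per v H : Prop :=
  [/\ L2 cell v, forall i, L2 cell (fun y => H y ord0 i) &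
      exists w : nat -> 'rV[R]_d -> R,
        [/\ forall k, smooth (w k) /\ cell_periodic (w k), L2_cvg cell w v &
            forall i, L2_cvg cell (fun k => pderiv i (w k)) (fun y => H y ord0 i)]].

Definition W1per v H : Prop := H1per v H /\ \int[leb]_(y in cell) v y = 0.

Definition corrector (A : 'rV[R]_d -> 'M[R]_d) (j : 'I_d) chi G : Prop :=
  W1per chi G /\
  forall v H, W1per v H ->
    \int[leb]_(y in cell) bform (A y) (G y) (H y) =
    \int[leb]_(y in cell) bform (A y) (basis_rV j) (H y).

Definition hom_entry (A : 'rV[R]_d -> 'M[R]_d) (i j : 'I_d) G : R :=
  let vol := fine (leb cell) in
  vol^-1 * (\int[leb]_(y in cell) A y i j) -
  vol^-1 * \sum_k \int[leb]_(y in cell) (A y i k * G y ord0 k).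

Definition hom_tensor (A : 'rV[R]_d -> 'M[R]_d) : 'M[R]_d :=
  \matrix_(i, j) get [set r | exists chi G, corrector A j chi G /\ r = hom_entry A i j G].

(* u \in W^{1,oo}(Y) with norm at most M *)
Definition W1oo_cell u (M : R) : Prop :=
  [/\ measurable_fun cell u, {ae leb, forall y, cell y -> `|u y| <= M} &
      exists G, [/\ weak_gradient cell u G,
        forall i, measurable_fun cell (fun y => G y ord0 i) &
        forall i, {ae leb, forall y, cell y -> `|G y ord0 i| <= M}]].

Definition test_fun_itv (a b : R) (phi : R -> R) : Prop :=
  (forall k t, derivable (derive1n k phi) t 1) /\
  exists a' b', [/\ a < a', b' < b & forall t, ~ (a' <= t <= b') -> phi t = 0].

(* a \in W^{1,oo}([sm,sp]; W^{1,oo}(Y)) with weak t-derivative da and norm at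
   most M, a being the representative that is continuous in t. The norm is the
   largest essential supremum of a, da and the components of their gradients. *)
Definition W1oo_time (sm sp : R) (a da : R -> 'rV[R]_d -> R) (M : R) : Prop :=
  let Q := `[sm, sp] `*` cell : set (measurableTypeR R * 'rV[R]_d) in
  [/\ measurable_fun Q (fun p => a p.1 p.2) /\ measurable_fun Q (fun p => da p.1 p.2),
      forall t, sm <= t <= sp -> forall eps, 0 < eps ->
        \forall s \near t, sm <= s <= sp ->
          {ae leb, forall y, cell y -> `|a s y - a t y| <= eps},
      forall phi, test_fun_itv sm sp phi ->
        {ae leb, forall y, cell y ->
           \int[lebesgue_measure]_(t in `[sm, sp]) (a t y * derive1 phi t) =
           - \int[lebesgue_measure]_(t in `[sm, sp]) (da t y * phi t)},
      {ae lebesgue_measure, forall t, sm <= t <= sp -> W1oo_cell (a t) M} &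
      {ae lebesgue_measure, forall t, sm <= t <= sp -> W1oo_cell (da t) M}].

End homogenization.

Section inverse_problem.
Context {R : realType} {d : nat}.
Variables (Omega : set 'rV[R]_d) (sm sp : R) (A : R -> 'rV[R]_d -> 'M[R]_d).

Notation leb := (lebesgue_rV d).
Notation X := (@C0 R _ (closure Omega)).

(* L^oo(Omega) functions with values in [sm, sp]: the domain of obs0. *)
Definition admissible (sigma : 'rV[R]_d -> R) : Prop :=
  measurable_fun Omega sigma /\ {ae leb, forall x, Omega x -> sm <= sigma x <= sp}.

(* The entry (j, l) is at index mxvec_index j l. *)
Definition obs0 (J L : nat) (phi : 'I_J -> 'rV[R]_d -> R) (g : 'I_L -> 'rV[R]_d -> R)
    (sigma : 'rV[R]_d -> R) : 'cV[R]_(J * L) :=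
  (mxvec (\matrix_(j, l) DtN Omega (fun x => hom_tensor (A (sigma x))) (g l) (phi j)))^T.

Definition prior_exp (theta : X) : 'rV[R]_d -> R := fun x => expR (theta x).

Definition prior_level (n : nat) (c : nat -> \bar R) (f : 'I_n -> X) (theta : X) :
    'rV[R]_d -> R :=
  fun x => \sum_(i < n) f i x *
    \1_[set x | Omega x /\ (c i <= (theta x)%:E < c i.+1)%E] x.

Definition is_level_prior (P : X -> 'rV[R]_d -> R) : Prop :=
  exists (n : nat) (c : nat -> \bar R) (f : 'I_n -> X),
    [/\ c 0 = -oo%E, c n = +oo%E, forall i, (i < n)%N -> (c i < c i.+1)%E,
        forall i x, closure Omega x -> 0 < f i x &
        P = prior_level c f].

(* Degenerate marginals are allowed: s = 0 stands for the Dirac mass at m. *)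
Definition gaussian (mu : probability (@borel_C0 R _ (closure Omega)) R) : Prop :=
  forall l : {linear X -> R^o}, continuous l ->
  exists m s : R, forall B : set (measurableTypeR R), measurable B ->
    mu (l @^-1` B) = if s == 0 then \d_m B else normal_prob m s B.

(* For almost every x, theta(x) has positive variance, i.e. is not mu-a.s.
   constant. Otherwise a level set {theta = c} may have positive Lebesgue measure
   with positive probability (e.g. mu the Dirac mass at a constant c). *)
Definition nondegenerate_prior (mu : probability (@borel_C0 R _ (closure Omega)) R) : Prop :=
  {ae leb, forall x, Omega x -> forall m : R, mu [set theta : X | theta x = m] <> 1%E}.

End inverse_problem.

Definition norm_cov {R : realType} {N : nat} (C : 'M[R]_N) (v : 'cV[R]_N) : R :=
  Num.sqrt ((v^T *m invmx C *m v) ord0 ord0).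

Definition covariance_matrix {R : realType} {N : nat} (C : 'M[R]_N) : Prop :=
  [/\ C^T = C, forall v : 'cV[R]_N, 0 <= (v^T *m C *m v) ord0 ord0 & C \in unitmx].

(* Main.v *)
(* Both the corrector problems on the cell and the Dirichlet problem on [Omega] are variational
   problems: find [N] in [N0 + V] with [int B N . K = 0] for all [K] in [V], where [V] is a
   complete linear space of gradient fields, namely the gradients of the periodic functions,
   resp. of the functions of zero trace. The output [int B N . H0] of such a problem is bounded
   in terms of the ellipticity constants of [B], and it is sequentially continuous in [B] for
   bounded almost everywhere convergence. The first problem shows that the homogenized tensor is
   symmetric, elliptic, bounded and continuous in [t]; the second one then bounds the
   observations uniformly over the admissible [sigma] and makes them continuous for almost
   everywhere convergence of [sigma]. Parts 1 and 3 follow from the uniform bound alone, since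
   [norm_cov] is a seminorm. For part 2 it remains that [P theta_k] converges almost everywhere
   to [P theta] when [theta_k] converges uniformly to [theta]. This is clear for the exponential
   prior; for the level set prior it holds as soon as the level sets [theta = c_i] are
   Lebesgue-null, which by Tonelli is [mu]-almost surely the case, as [theta x] is a non-degenerate
   Gaussian variable for almost every [x].

   Completeness of [V] rests on Poincare inequalities: on the cell by integrating along the
   coordinate directions, and on [Omega] in Friedrichs' form with the surface integral of the
   square on the right. The latter needs no regularity of the boundary, because the Hausdorff
   measure of a set dominates the Lebesgue measure of its projections on hyperplanes. *)

From HB Require Import structures.
Require Import Defs.
From mathcomp Require Import all_boot all_order all_algebra.
From mathcomp Require Import all_classical all_reals all_analysis.
From mathcomp Require Import measurable_realfun ring lra.

Set Implicit Arguments.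
Unset Strict Implicit.
Unset Printing Implicit Defensive.

Import Order.TTheory GRing.Theory Num.Theory.
Import numFieldNormedType.Exports.

Local Open Scope classical_set_scope.
Local Open Scope ring_scope.

(** * Projection in a semi-inner product space *)

(** Nothing is quotiented: functions and fields are genuine functions, so the energy is only a
    semi-inner product and a minimiser is determined only up to null sets. The unknown is the
    gradient field rather than its potential, so the Poincare inequalities enter only through the
    completeness of [V]. On [Omega], a field of [V] comes with smooth functions whose boundary
    values merely tend to zero in mean square. An admissible [sigma] has values in [[sm, sp]] only
    almost everywhere, and nothing is known of [A t] for other [t]. The tensor is therefore replaced
    by the one at a truncated [t], which is continuous on the whole line, and integrals have to be
    compared without measurability. In part 2 the exceptional set of [theta] must not depend on the
    approximating sequence: it is fixed by the level sets of [theta] alone. *)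

Section semi_inner_product.
Context {R : realType} {E : lmodType R}.
Variables (S V : set E) (b : E -> E -> R).
Hypothesis S_lin : forall x y (a : R), S x -> S y -> S (x + a *: y).
Hypothesis b_sym : forall x y, S x -> S y -> b x y = b y x.
Hypothesis b_lin : forall x y z (a : R), S x -> S y -> S z ->
  b (x + a *: y) z = b x z + a * b y z.
Hypothesis b_ge0 : forall x, S x -> 0 <= b x x.

Lemma sip_linr x y z (a : R) : S x -> S y -> S z ->
  b z (x + a *: y) = b z x + a * b z y.
Proof.
by move=> Sx Sy Sz; rewrite b_sym ?b_lin ?[b _ z]b_sym//; exact: S_lin.
Qed.

Lemma sip_sq x y (a : R) : S x -> S y ->
  b (x + a *: y) (x + a *: y) = b x x + 2 * a * b x y + a ^+ 2 * b y y.
Proof.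
move=> Sx Sy; have Sxy := S_lin a Sx Sy.
by rewrite b_lin// !sip_linr// (b_sym Sy Sx); ring.
Qed.

(** The discriminant criterion, including the degenerate case [r = 0]; every Cauchy-Schwarz
    inequality below comes from it. *)
Lemma quadratic_ge0 (p q r : R) : 0 <= p -> 0 <= r ->
  (forall s, 0 <= p + 2 * s * q + s ^+ 2 * r) -> q ^+ 2 <= p * r.
Proof.
move=> p0 r0 h; have [r1|] := ltP 0 r.
  (* The minimiser of the quadratic in [s]. *)
  have := h (- q / r).
  have -> : p + 2 * (- q / r) * q + (- q / r) ^+ 2 * r = (p * r - q ^+ 2) / r.
    by field; rewrite gt_eqF.
  by rewrite pmulr_lge0 ?invr_gt0// subr_ge0.
move=> r1; have r00 : r = 0 by apply/eqP; rewrite eq_le r1 r0.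
have [->|q0] := eqVneq q 0; first by rewrite expr0n/= mulr_ge0.
(* With [r = 0] the expression is affine in [s], and this [s] makes it equal to [-1]. *)
have := h (- (p + 1) / (2 * q)); rewrite r00 mulr0 addr0.
have -> : p + 2 * (- (p + 1) / (2 * q)) * q = - 1 by field.
by rewrite lerNr oppr0 ler10.
Qed.

Lemma sip_cauchy_schwarz x y : S x -> S y -> b x y ^+ 2 <= b x x * b y y.
Proof.
move=> Sx Sy; apply: quadratic_ge0; [exact: b_ge0|exact: b_ge0|move=> s].
by rewrite -sip_sq//; apply: b_ge0; exact: S_lin.
Qed.

Hypothesis V_S : V `<=` S.
Hypothesis V_lin : forall x y (a : R), V x -> V y -> V (x + a *: y).
Hypothesis V_complete : forall h : nat -> E, (forall n, V (h n)) ->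
  (forall e : R, 0 < e -> exists N, forall n m, (N <= n)%N -> (N <= m)%N ->
     b (h n - h m) (h n - h m) <= e) ->
  exists2 h0, V h0 & b (h n - h0) (h n - h0) @[n --> \oo] --> (0 : R).

(** A minimising sequence of [b (g + h) (g + h)] over [V] is Cauchy by the parallelogram law.
    Orthogonality is obtained quantitatively along the sequence and then passed to the limit. *)
Lemma sip_projection g : (exists v, V v) -> S g ->
  exists2 h, V h & forall k, V k -> b (g + h) k = 0.
Proof.
move=> [v0 Vv0] Sg.
have Sgh h : V h -> S (g + h).
  by move=> Vh; rewrite -[h]scale1r; apply: S_lin => //; exact: V_S.
pose Q := [set b (g + h) (g + h) | h in V].
have Qinf : has_inf Q.
  split; first by exists (b (g + v0) (g + v0)), v0.
  by exists 0 => _ [h Vh <-]; apply: b_ge0; exact: Sgh.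
pose m := inf Q.
have mle h : V h -> m <= b (g + h) (g + h).
  by move=> Vh; apply: ge_inf; [exact: Qinf.2|exists h].
have /choice[h hP] : forall n, exists h, V h /\ b (g + h) (g + h) < m + n.+1%:R^-1.
  move=> n; have n0 : 0 < n.+1%:R^-1 :> R by rewrite invr_gt0 ltr0n.
  by have [_ [h Vh <-] hn] := inf_adherent n0 Qinf; exists h.
have Vh n : V (h n) := (hP n).1.
have hle n : b (g + h n) (g + h n) <= m + n.+1%:R^-1 := ltW (hP n).2.
(* Moving from [h n] by [s *: k] cannot go below the infimum, which [h n] exceeds by at most
   [1/(n+1)]; the discriminant of this quadratic in [s] gives the bound. *)
have orth n k : V k -> b (g + h n) k ^+ 2 <= n.+1%:R^-1 * b k k.
  move=> Vk; apply: quadratic_ge0 => [||s]; first by rewrite invr_ge0.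
    by apply: b_ge0; exact: V_S.
  have := mle (h n + s *: k) (V_lin s (Vh n) Vk).
  rewrite addrA sip_sq; [|exact: Sgh|exact: V_S].
  have := hle n; move: (b (g + h n) (g + h n)) (b (g + h n) k) (b k k) n.+1%:R^-1.
  move=> x y z t h2 h1; lra.
(* Parallelogram law: the midpoint of [h n] and [h p] lies in [V], so its value is at least [m]. *)
have par n p : b (h n - h p) (h n - h p) <= 2 * n.+1%:R^-1 + 2 * p.+1%:R^-1.
  have Vnp : V (2^-1 *: h n + 2^-1 *: h p).
    apply: V_lin => //; rewrite (_ : 2^-1 *: h n = h n + (- 2^-1) *: h n); first exact: V_lin.
    rewrite -[X in X + _]scale1r -scalerDl; congr (_ *: _); lra.
  have e1 : h n - h p = (g + h n) + (-1) *: (g + h p).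
    by rewrite scaleN1r opprD addrACA subrr add0r.
  have e2 : b (g + h n + 1 *: (g + h p)) (g + h n + 1 *: (g + h p)) =
      4 * b (g + (2^-1 *: h n + 2^-1 *: h p)) (g + (2^-1 *: h n + 2^-1 *: h p)).
    have -> : g + h n + 1 *: (g + h p) = (g + h n) + (g + h p) by rewrite scale1r.
    set z := g + (_ + _); have Sz : S z by exact: Sgh.
    have -> : g + h n + (g + h p) = z + 1 *: z.
      rewrite scale1r /z addrACA [RHS]addrACA; congr (_ + _).
      rewrite [RHS]addrACA -!scalerDl.
      have -> : 2^-1 + 2^-1 = 1 :> R by lra.
      by rewrite !scale1r.
    by rewrite sip_sq//; ring.
  have Sn : S (g + h n) by exact: Sgh.
  have Sp : S (g + h p) by exact: Sgh.
  have m2 : m <= b (g + (2^-1 *: h n + 2^-1 *: h p)) (g + (2^-1 *: h n + 2^-1 *: h p)).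
    exact: mle.
  rewrite e1 sip_sq//; move: e2; rewrite sip_sq// => e2.
  have := hle n; have := hle p; move: n.+1%:R^-1 p.+1%:R^-1 => u v h1 h2; lra.
have [|h0 Vh0 h0P] := V_complete Vh.
  move=> e e0.
  have [N NP] : exists N : nat, 4 * N.+1%:R^-1 <= e.
    exists (Num.truncn (4 / e)).
    rewrite ler_pdivrMr ?ltr0n// mulrC -ler_pdivrMr//.
    by apply: ltW; rewrite truncnS_gt.
  exists N => n p Nn Np; apply: (le_trans (par n p)).
  have hN k : (N <= k)%N -> k.+1%:R^-1 <= N.+1%:R^-1 :> R.
    by move=> Nk; rewrite lef_pV2 ?posrE ?ltr0n// ler_nat.
  have := hN n Nn; have := hN p Np.
  move: n.+1%:R^-1 p.+1%:R^-1 N.+1%:R^-1 NP => u v w h1 h2 h3; lra.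
exists h0 => // k Vk; apply/eqP; rewrite -sqrf_eq0 eq_le sqr_ge0 andbT.
have Sk := V_S Vk.
(* From [(p - q)^2 <= 2 p^2 + 2 q^2] with [p = b (g + h n) k] and [q = b (h n - h0) k], and
   Cauchy-Schwarz for [q]. *)
pose u n := 2 * b k k * (n.+1%:R^-1 + b (h n - h0) (h n - h0)).
have u0 : u n @[n --> \oo] --> (0 : R).
  have -> : (0 : R) = 2 * b k k * (0 + 0) by rewrite addr0 mulr0.
  apply: cvgM; first exact: cvg_cst.
  by apply: cvgD => //; exact: cvg_harmonic.
have ule n : b (g + h0) k ^+ 2 <= u n.
  have Sd : S (h n - h0) by apply: V_S; rewrite -scaleN1r; exact: V_lin.
  have e : b (g + h0) k = b (g + h n) k - b (h n - h0) k.
    have -> : g + h0 = (g + h n) + (-1) *: (h n - h0).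
      by rewrite scaleN1r opprB addrA addrAC addrK.
    by rewrite b_lin//; [rewrite mulN1r|exact: Sgh].
  have h1 := orth n k Vk; have h2 := sip_cauchy_schwarz Sd Sk.
  rewrite e /u; move: h1 h2; set p := b (g + h n) k; set q := b (h n - h0) k.
  move: n.+1%:R^-1 (b k k) (b _ _) => t r w h1 h2.
  have : 0 <= (p + q) ^+ 2 by exact: sqr_ge0.
  nra.
have <- : limn u = 0 by exact: (cvg_lim (@Rhausdorff R) u0).
apply: limr_ge; first by apply/cvg_ex; exists 0.
by apply: nearW => n; exact: ule.
Qed.

End semi_inner_product.

(** * Square-integrable functions *)

Section square_integrable.
Context d (T : measurableType d) (R : realType) (mu : {measure set T -> \bar R}).
Variables (D : set T) (mD : measurable D).
Implicit Types f g : T -> R.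

Definition sqint f := measurable_fun D f /\
  (\int[mu]_(x in D) ((f x) ^+ 2)%:E < +oo)%E.

Lemma sqintP f : sqint f <->
  measurable_fun D f /\ mu.-integrable D (EFin \o (fun x => f x ^+ 2)).
Proof.
split=> -[mf If]; split => //.
  apply/integrableP; split.
    by apply/measurable_EFinP; exact: measurable_funX.
  by under eq_integral do rewrite /= ger0_norm ?sqr_ge0//.
move/integrableP : If => [_].
by under eq_integral do rewrite /= ger0_norm ?sqr_ge0//.
Qed.

Lemma sqint_prod f g : sqint f -> sqint g ->
  mu.-integrable D (EFin \o (fun x => f x * g x)).
Proof.
move=> /sqintP[mf If] /sqintP[mg Ig].
have := integrableD mD If Ig; apply: le_integrable => //.
  by apply/measurable_EFinP; exact: measurable_funM.
move=> x Dx /=; rewrite lee_fin [leRHS]ger0_norm ?addr_ge0 ?sqr_ge0//.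
rewrite ler_norml; have := sqr_ge0 (f x + g x); have := sqr_ge0 (f x - g x).
move: (f x) (g x) => a b; move=> h1 h2; apply/andP; split; nra.
Qed.

Lemma sqintD f g (a : R) : sqint f -> sqint g -> sqint (fun x => f x + a * g x).
Proof.
move=> sf sg; have [mf If] := (sqintP f).1 sf; have [mg Ig] := (sqintP g).1 sg.
have mfg : measurable_fun D (fun x => f x + a * g x).
  by apply: measurable_funD => //; exact: measurable_funM.
apply/sqintP; split => //.
have := integrableD mD (integrableZl mD 2 If) (integrableZl mD (2 * a ^+ 2) Ig).
apply: le_integrable => //.
  by apply/measurable_EFinP; exact: measurable_funX.
move=> x Dx /=; rewrite lee_fin.
rewrite ger0_norm ?sqr_ge0// ger0_norm; last first.
  by rewrite addr_ge0// mulr_ge0 ?sqr_ge0// mulr_ge0 ?sqr_ge0.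
rewrite -subr_ge0.
suff -> : 2 * f x ^+ 2 + 2 * a ^+ 2 * g x ^+ 2 - (f x + a * g x) ^+ 2 =
  (f x - a * g x) ^+ 2 by exact: sqr_ge0.
by ring.
Qed.

Lemma sqint0 : sqint (fun=> 0).
Proof.
split; first exact: measurable_cst.
by under eq_integral do rewrite expr0n/=; rewrite integral0.
Qed.

Lemma eq_sqint f g : {in D, f =1 g} -> sqint f -> sqint g.
Proof.
move=> fg [mf If]; split; first by apply: eq_measurable_fun mf.
by under eq_integral do rewrite -fg//.
Qed.

Lemma sqint_dominated f g (C : R) : 0 <= C -> measurable_fun D f -> sqint g ->
  {ae mu, forall x, D x -> f x ^+ 2 <= C * g x ^+ 2} -> sqint f.
Proof.
move=> C0 mf sg fg; split => //; have [mg Ig] := (sqintP g).1 sg.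
apply: (@le_lt_trans _ _ (\int[mu]_(x in D) (C%:E * ((g x) ^+ 2)%:E))%E); last first.
  rewrite ge0_integralZl ?lee_fin//.
  - by rewrite lte_mul_pinfty ?lee_fin//; exact: sg.2.
  - by apply/measurable_EFinP; exact: measurable_funX.
  - by move=> x _; rewrite lee_fin sqr_ge0.
apply: ae_ge0_le_integral => //.
- by move=> x _; rewrite lee_fin sqr_ge0.
- by apply/measurable_EFinP; exact: measurable_funX.
- by move=> x _; rewrite mule_ge0 ?lee_fin ?sqr_ge0.
- apply/measurable_EFinP; apply: measurable_funM => //.
  exact: measurable_funX.
Qed.

Definition nrm2 f : R := \int[mu]_(x in D) (f x ^+ 2).

Lemma nrm2_ge0 f : 0 <= nrm2 f.
Proof. by apply: Rintegral_ge0 => x _; exact: sqr_ge0. Qed.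

Lemma EFin_nrm2 f : sqint f ->
  (\int[mu]_(x in D) ((f x) ^+ 2)%:E)%E = (nrm2 f)%:E.
Proof.
move=> /sqintP[mf If]; rewrite /nrm2 /Rintegral fineK//.
exact: integrable_fin_num.
Qed.

Lemma sqintB f g : sqint f -> sqint g -> sqint (fun x => f x - g x).
Proof.
move=> sf sg; apply: eq_sqint (sqintD (-1) sf sg) => x _.
by rewrite mulN1r.
Qed.

Lemma nrm2_cvg (f : nat -> T -> R) g : (forall n, sqint (f n)) -> sqint g ->
  ((\int[mu]_(x in D) ((f n x - g x) ^+ 2)%:E)%E @[n --> \oo] --> 0%E) <->
  (nrm2 (fun x => f n x - g x) @[n --> \oo] --> (0 : R)).
Proof.
move=> sf sg.
have e n : (\int[mu]_(x in D) ((f n x - g x) ^+ 2)%:E)%E =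
    (nrm2 (fun x => f n x - g x))%:E by apply: EFin_nrm2; exact: sqintB.
under eq_fun do rewrite e.
split => h; first exact: (fine_cvg h).
by apply: (@cvg_EFin _ _ _ _ _ 0); [apply: nearW|exact: h].
Qed.

(* A sequence converging at a geometric rate converges almost everywhere, since
   [2 |a| <= 2^-k + 2^k a^2]; Fatou's lemma then identifies the limit. *)
Lemma sqint_fast_cvg (f : nat -> T -> R) : (forall n, sqint (f n)) ->
  (forall n, nrm2 (fun x => f n.+1 x - f n x) <= (4 ^- n)) ->
  {ae mu, forall x, D x -> cvgn (f ^~ x)}.
Proof.
move=> sf fc.
pose a n x := f n.+1 x - f n x.
have sa n : sqint (a n) by exact: sqintB.
(* The weight [2^n] against the rate [4^-n] leaves terms of integral at most [2^-n], so the sum is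
   integrable, hence finite almost everywhere. *)
pose F n x : \bar R := ((2 ^+ n) * a n x ^+ 2)%:E.
have F0 n x : (0 <= F n x)%E by rewrite lee_fin mulr_ge0 ?sqr_ge0.
have mF n : measurable_fun D (F n).
  apply/measurable_EFinP; apply: measurable_funM => //.
  by apply: measurable_funX; exact: (sa n).1.
have IF : (\int[mu]_(x in D) (\sum_(n <oo) F n x) < +oo)%E.
  rewrite integral_nneseries//.
  apply: (@le_lt_trans _ _ (\sum_(n <oo) (geometric 1 (2^-1) n)%:E)%E); last first.
    have h1 : `|2^-1| < 1 :> R by rewrite ger0_norm ?invr_ge0//; lra.
    have h := @cvg_geometric_series R 1 _ h1.
    have -> : (\sum_(n <oo) (geometric 1 (2^-1) n)%:E)%E = (1 / (1 - 2^-1))%:E :> \bar R.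
      apply/cvg_lim => //.
      rewrite (_ : (fun n : nat => _) = EFin \o series (geometric 1 2^-1)); last first.
        by apply/funext => n; rewrite /= /series/= -sumEFin.
      by apply: (@cvg_EFin _ _ _ _ _ (1 / (1 - 2^-1))); [apply: nearW|exact: h].
    by rewrite ltey.
  apply: lee_nneseries => [n _ _|n _]; first exact: integral_ge0.
  rewrite /F; under eq_integral do rewrite EFinM.
  rewrite ge0_integralZl//; last 2 first.
    by apply/measurable_EFinP; apply: measurable_funX; exact: (sa n).1.
    by move=> x _; rewrite lee_fin sqr_ge0.
  rewrite (EFin_nrm2 (sa n)) -EFinM lee_fin /geometric/= mul1r.
  rewrite -ler_pdivlMl ?exprn_gt0// exprVn -invfM -exprMn.
  by rewrite (_ : 2 * 2 = 4 :> R) ?fc//; ring.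
have mS : measurable_fun D (fun x => \sum_(n <oo) F n x)%E.
  exact: ge0_emeasurable_sum.
have : mu.-integrable D (fun x => \sum_(n <oo) F n x)%E.
  apply/integrableP; split => //.
  by under eq_integral do rewrite gee0_abs ?nneseries_ge0//.
move/(integrable_ae mD); apply: filterS => x h Dx; have {h} := h Dx.
set S := (\sum_(n <oo) _)%E => Sfin.
have ak n : \sum_(0 <= k < n) (2 ^+ k * a k x ^+ 2) <= fine S.
  rewrite -lee_fin fineK// -sumEFin.
  by apply: nneseries_lim_ge => *; exact: F0.
have : cvgn (series (a ^~ x)).
  apply: normed_cvg; apply: nondecreasing_is_cvgn.
    by apply: nondecreasing_series => *; exact: normr_ge0.
  exists (1 + fine S) => _ [n _ <-]; rewrite /series/=.
  apply: (@le_trans _ _ (\sum_(0 <= k < n) (2^-1 * 2^-1 ^+ k + 2 ^+ k * a k x ^+ 2))).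
    apply: ler_sum => k _.
    have k0 : 0 < 2 ^+ k :> R by rewrite exprn_gt0.
    rewrite exprVn; have k1 : 2 ^+ k * (2 ^+ k)^-1 = 1 :> R by rewrite divff ?gt_eqF.
    have v0 : 0 < (2 ^+ k)^-1 :> R by rewrite invr_gt0.
    move: (2 ^+ k) (2 ^+ k)^-1 (a k x) k0 k1 v0 => p v b p0 pv v0.
    rewrite -(@ler_pM2l _ p)//.
    have -> : p * (2^-1 * v + p * b ^+ 2) = 2^-1 * (p * v) + (p * `|b|) ^+ 2.
      by rewrite exprMn real_normK ?num_real//; ring.
    rewrite pv; have := sqr_ge0 (p * `|b| - 1); have := sqr_ge0 (p * `|b|); nra.
  rewrite big_split/= lerD//.
  have := @geometric_seriesE R 2^-1 2^-1.
  move=> /(_ ltac:(by apply/eqP; lra)) /(congr1 (@^~ n)) /=.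
  rewrite /series/= => ->.
  have : 0 <= 2^-1 ^+ n :> R by rewrite exprn_ge0 ?invr_ge0.
  move: (2^-1 ^+ n) => t t0.
  rewrite (_ : 2^-1 * (1 - t) / (1 - 2^-1) = 1 - t); first lra.
  by field.
move=> cS; have -> : f ^~ x = (fun n => f 0%N x + series (a ^~ x) n).
  by apply/funext => n; rewrite [LHS](eq_sum_telescope (f ^~ x)).
by apply: is_cvgD => //; exact: is_cvg_cst.
Qed.

Lemma ae_eq_nrm2 f g : measurable_fun D f -> measurable_fun D g ->
  {ae mu, forall x, D x -> f x = g x} -> nrm2 f = nrm2 g.
Proof.
move=> mf mg fg; congr fine; apply: ae_eq_integral => //.
- by apply/measurable_EFinP; exact: measurable_funX.
- by apply/measurable_EFinP; exact: measurable_funX.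
- by apply: filterS fg => x h Dx; rewrite h.
Qed.

Lemma limn_einf_le (u : nat -> \bar R) (e : \bar R) (N : nat) :
  (forall n, (N <= n)%N -> (u n <= e)%E) -> (limn_einf u <= e)%E.
Proof.
move=> ue; apply: (le_trans (limn_einf_sup _)); rewrite limn_esup_lim.
apply: lime_le; first exact: is_cvg_esups.
near=> n; apply: ge_ereal_sup => _ [k /= nk <-]; apply: ue.
by apply: leq_trans nk; near: n; exists N.
Unshelve. all: by end_near. Qed.

(** Riesz-Fischer: a fast subsequence converges almost everywhere, and Fatou's lemma turns the
    Cauchy bound into a bound on the distance to the limit. *)
Lemma sqint_complete (f : nat -> T -> R) : (forall n, sqint (f n)) ->
  (forall e : R, 0 < e -> exists N, forall n m, (N <= n)%N -> (N <= m)%N ->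
     nrm2 (fun x => f n x - f m x) <= e) ->
  exists2 g, sqint g & nrm2 (fun x => f n x - g x) @[n --> \oo] --> (0 : R).
Proof.
move=> sf cf.
have /choice[N NP] : forall p, exists N, forall n m, (N <= n)%N -> (N <= m)%N ->
    nrm2 (fun x => f n x - f m x) <= 4 ^- p.
  by move=> p; apply: cf; rewrite invr_gt0 exprn_gt0.
(* A sum of the [N k] rather than [N p] itself, so that [M p] and [M p.+1] are both at least
   [N p]. *)
pose M p := (\sum_(k < p.+1) N k)%N.
have MN p k : (k <= p)%N -> (N k <= M p)%N.
  move=> kp; rewrite /M (bigD1 (Ordinal (kp : k < p.+1)%N))//= leq_addr//.
have [Z [mZ Z0 fZ]] : {ae mu, forall x, D x -> cvgn (fun p => f (M p) x)}.
  apply: (@sqint_fast_cvg (fun p => f (M p))) => // p.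
  by apply: NP; exact: MN.
(* Set to zero on [Z], the subsequence converges at every point of [D], so its limit is measurable
   although the measure need not be complete. *)
pose h p x := f (M p) x * \1_(~` Z) x.
have mh p : measurable_fun D (h p).
  apply: measurable_funM; first exact: (sf _).1.
  by apply: measurable_indic; exact: measurableC.
pose g x := limn (h ^~ x).
have hg x : D x -> h ^~ x @ \oo --> g x.
  move=> Dx; have [Zx|Zx] := pselect (Z x).
    have h0 p : h p x = 0 by rewrite /h indicE memNset ?mulr0//; apply: contrapT.
    by apply/cvg_ex; exists 0; under eq_fun do rewrite h0; exact: cvg_cst.
  have h1 p : h p x = f (M p) x by rewrite /h indicE mem_set ?mulr1.
  have e : h ^~ x = (fun p => f (M p) x) by exact/funext.
  rewrite /g e.
  by apply: contrapT => nc; apply: Zx; apply: fZ => /(_ Dx).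
have mg : measurable_fun D g by exact: measurable_fun_cvg mh hg.
have main n p : (N p <= n)%N ->
    (\int[mu]_(x in D) ((f n x - g x) ^+ 2)%:E <= (4 ^- p)%:E)%E.
  move=> pn.
  have mfn k : measurable_fun D (fun x => f n x - h k x).
    by apply: measurable_funB => //; exact: (sf n).1.
  rewrite (@eq_integral _ _ _ _ D (fun x => limn_einf (fun k => ((f n x - h k x) ^+ 2)%:E))); last first.
    move=> x /[!inE] Dx; apply/esym; apply: (cvg_limn_einf_sup _).1.
    apply: (@cvg_EFin _ _ _ _ _ ((f n x - g x) ^+ 2)); first by apply: nearW.
    have hx : (f n x - h k x) @[k --> \oo] --> f n x - g x.
      by apply: cvgB; [exact: cvg_cst|exact: hg].
    exact: (cvg_comp _ _ hx (@exprn_continuous _ 2 _)).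
  apply: le_trans; first apply: fatou => //.
  - by move=> k; apply/measurable_EFinP; exact: measurable_funX.
  - by move=> k x _; rewrite lee_fin sqr_ge0.
  apply: (@limn_einf_le _ _ p) => k pk.
  have e1 : {ae mu, forall x, D x -> f n x - f (M k) x = f n x - h k x}.
    exists Z; split => // x /=; apply: contra_notP => Zx Dx.
    by rewrite /h indicE mem_set ?mulr1.
  have s1 : sqint (fun x => f n x - h k x).
    apply: (@sqint_dominated _ (fun x => f n x - f (M k) x) 1) => //.
      exact: sqintB.
    by apply: filterS e1 => x e Dx; rewrite e// mul1r.
  rewrite (EFin_nrm2 s1) lee_fin -(ae_eq_nrm2 _ _ e1)//; last exact: (sqintB (sf _) (sf _)).1.
  by apply: NP => //; exact: MN.
have sg : sqint g.
  have s1 : sqint (fun x => f (N 0%N) x - g x).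
    split; first by apply: measurable_funB => //; exact: (sf _).1.
    by apply: (le_lt_trans (main _ _ (leqnn _))); rewrite ltry.
  by apply: eq_sqint (sqintB (sf (N 0%N)) s1) => x _; rewrite opprB addrC subrK.
exists g => //.
apply/cvgrPdist_le => e e0.
have [p pe] : exists p : nat, 4 ^- p <= e.
  have : geometric 1 4^-1 n @[n --> \oo] --> (0 : R).
    by apply: cvg_geometric; rewrite ger0_norm ?invr_ge0//; lra.
  move/cvgrPdist_le => /(_ _ e0) [p _ /(_ p (leqnn _))] /=.
  rewrite sub0r normrN mul1r exprVn ger0_norm ?invr_ge0 ?exprn_ge0// => hp.
  by exists p.
exists (N p) => // n /= pn; rewrite sub0r normrN ger0_norm ?nrm2_ge0//.
apply: le_trans pe; rewrite -lee_fin -EFin_nrm2; last exact: sqintB.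
exact: main.
Qed.

End square_integrable.

(** * Variational problems for vector fields *)

Section dot_product.
Context {R : realType} {n : nat}.
Implicit Types x y z : 'rV[R]_n.

Lemma dotpC x y : dotp x y = dotp y x.
Proof. by apply: eq_bigr => i _; rewrite mulrC. Qed.

Lemma dotpDZl x y z (a : R) : dotp (x + a *: y) z = dotp x z + a * dotp y z.
Proof.
rewrite /dotp mulr_sumr -big_split/=; apply: eq_bigr => i _.
by rewrite !mxE mulrDl mulrA.
Qed.

Lemma dotp_ge0 x : 0 <= dotp x x.
Proof. by apply: sumr_ge0 => i _; rewrite -expr2 sqr_ge0. Qed.

Lemma enorm_sq x : enorm x ^+ 2 = dotp x x.
Proof. by rewrite sqr_sqrtr ?dotp_ge0. Qed.

Lemma enorm_ge0 x : 0 <= enorm x.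
Proof. exact: sqrtr_ge0. Qed.

Lemma dotp_coord x i : x ord0 i ^+ 2 <= dotp x x.
Proof.
rewrite /dotp (bigD1 i)//= -expr2 lerDl sumr_ge0// => j _.
by rewrite -expr2 sqr_ge0.
Qed.

Lemma coord_le_enorm x i : `|x ord0 i| <= enorm x.
Proof. by rewrite -sqrtr_sqr ler_wsqrtr// dotp_coord. Qed.

Lemma dotp_sub_le x y : dotp (x - y) (x - y) <= 2 * dotp x x + 2 * dotp y y.
Proof.
rewrite /dotp !mulr_sumr -big_split/=; apply: ler_sum => i _; rewrite !mxE.
have := sqr_ge0 (x ord0 i + y ord0 i); move: (x ord0 i) (y ord0 i) => a b; nra.
Qed.

End dot_product.

Lemma cvgr_sum (R : realType) I (s : seq I) (u : I -> nat -> R) (l : I -> R) :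
  (forall i, u i n @[n --> \oo] --> l i) ->
  \sum_(i <- s) u i n @[n --> \oo] --> \sum_(i <- s) l i.
Proof.
move=> ul; elim: s => [|i s IH].
  by under eq_fun do rewrite big_nil; rewrite big_nil; exact: cvg_cst.
by under eq_fun do rewrite big_cons; rewrite big_cons; exact: cvgD.
Qed.

Lemma cvg0_sq (R : realType) (u e : nat -> R) :
  (forall n, u n ^+ 2 <= e n) -> e n @[n --> \oo] --> (0 : R) ->
  u n @[n --> \oo] --> (0 : R).
Proof.
move=> ue /cvgrPdist_le e0; apply/cvgrPdist_le => eps eps0.
have eps2 : 0 < eps ^+ 2 by rewrite exprn_gt0.
apply: filterS (e0 _ eps2) => n; rewrite !sub0r !normrN => h.
rewrite -ler_sqr ?nnegrE ?(ltW eps0)//.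
rewrite real_normK ?num_real// (le_trans (ue n))// (le_trans _ h)//.
exact: ler_norm.
Qed.

Section vector_fields.
Context d (T : measurableType d) (R : realType) (mu : {measure set T -> \bar R}).
Variables (D : set T) (mD : measurable D) (n : nat).
Implicit Types (G H K N : T -> 'rV[R]_n) (B : T -> 'M[R]_n).

Definition L2vec G := forall i, sqint mu D (fun x => G x ord0 i).

Definition ip G H : R := \int[mu]_(x in D) dotp (G x) (H x).

Lemma L2vecD G H (a : R) : L2vec G -> L2vec H -> L2vec (G + a *: H).
Proof.
move=> sG sH i; apply: eq_sqint (sqintD mD a (sG i) (sH i)) => x _.
by rewrite ?fctE !mxE.
Qed.

Lemma L2vec0 : L2vec 0.
Proof. by move=> i; apply: eq_sqint (sqint0 _ _) => x _; rewrite ?fctE mxE. Qed.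

Lemma L2vecB G H : L2vec G -> L2vec H -> L2vec (G - H).
Proof. by move=> sG sH; rewrite -scaleN1r; exact: L2vecD. Qed.

Lemma integrable_dotp G H : L2vec G -> L2vec H ->
  mu.-integrable D (EFin \o (fun x => dotp (G x) (H x))).
Proof.
move=> sG sH; rewrite (_ : _ \o _ =
    fun x => (\sum_(i <- index_enum 'I_n) (G x ord0 i * H x ord0 i)%:E)%E); last first.
  by apply/funext => x /=; rewrite sumEFin.
by apply: integrable_sum => // i _; exact: sqint_prod.
Qed.

Lemma ipDZl G H K (a : R) : L2vec G -> L2vec H -> L2vec K ->
  ip (G + a *: H) K = ip G K + a * ip H K.
Proof.
move=> sG sH sK; rewrite /ip -RintegralZl//; last exact: integrable_dotp.
rewrite -RintegralD//; last 2 first.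
- exact: integrable_dotp.
- by have := integrableZl mD a (integrable_dotp sH sK); apply: eq_integrable.
by apply: eq_Rintegral => x _; rewrite ?fctE dotpDZl.
Qed.

Lemma ipC G H : ip G H = ip H G.
Proof. by apply: eq_Rintegral => x _; rewrite dotpC. Qed.

Lemma ip_ge0 G : 0 <= ip G G.
Proof. by apply: Rintegral_ge0 => x _; exact: dotp_ge0. Qed.

Lemma ipDZr G H K (a : R) : L2vec G -> L2vec H -> L2vec K ->
  ip K (G + a *: H) = ip K G + a * ip K H.
Proof. by move=> *; rewrite ipC ipDZl// ![ip K _]ipC. Qed.

Lemma ip_cauchy_schwarz G H : L2vec G -> L2vec H ->
  ip G H ^+ 2 <= ip G G * ip H H.
Proof.
apply: sip_cauchy_schwarz => [x y a|x y _ _|x y z a|x _]; first exact: L2vecD.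
- exact: ipC.
- exact: ipDZl.
- exact: ip_ge0.
Qed.

Lemma Rintegral_sum I (s : seq I) (f : I -> T -> R) :
  (forall i, mu.-integrable D (EFin \o f i)) ->
  \int[mu]_(x in D) (\sum_(i <- s) f i x) = \sum_(i <- s) \int[mu]_(x in D) f i x.
Proof.
move=> fi; elim: s => [|i s IH].
  under eq_Rintegral do rewrite big_nil; rewrite big_nil.
  by rewrite Rintegral_cst// mul0r.
rewrite big_cons -IH -RintegralD//.
  by apply: eq_Rintegral => x _; rewrite big_cons.
have := integrable_sum mD s (P := xpredT) (fun i _ => fi i).
by apply: eq_integrable => // x _ /=; rewrite -sumEFin.
Qed.

Lemma ip_nrm2 G : L2vec G -> ip G G = \sum_i nrm2 mu D (fun x => G x ord0 i).
Proof.
move=> sG; rewrite /ip /nrm2 -Rintegral_sum.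
  by apply: eq_Rintegral => x _; apply: eq_bigr => i _; rewrite expr2.
by move=> i; exact: sqint_prod.
Qed.

Lemma nrm2_le_ip G i : L2vec G -> nrm2 mu D (fun x => G x ord0 i) <= ip G G.
Proof.
by move=> sG; rewrite ip_nrm2// (bigD1 i)//= lerDl sumr_ge0// => *; exact: nrm2_ge0.
Qed.

Lemma L2vec_complete (F : nat -> T -> 'rV[R]_n) : (forall k, L2vec (F k)) ->
  (forall e : R, 0 < e -> exists N : nat, forall k m, (N <= k)%N -> (N <= m)%N ->
     ip (F k - F m) (F k - F m) <= e) ->
  exists2 G, L2vec G & ip (F k - G) (F k - G) @[k --> \oo] --> (0 : R).
Proof.
move=> sF cF.
have /choice[g gP] : forall i, exists g, sqint mu D g /\
    nrm2 mu D (fun x => F k x ord0 i - g x) @[k --> \oo] --> (0 : R).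
  move=> i; have [||g sg cg] := @sqint_complete _ _ _ mu D mD (fun k x => F k x ord0 i).
  - by move=> k; exact: sF.
  - move=> e /cF[N NP]; exists N => k m Nk Nm; apply: le_trans (NP k m Nk Nm).
    have -> : nrm2 mu D (fun x => F k x ord0 i - F m x ord0 i) =
        nrm2 mu D (fun x => (F k - F m) x ord0 i).
      by apply: eq_Rintegral => x _; rewrite ?fctE !mxE.
    by apply: nrm2_le_ip; exact: L2vecB.
  by exists g.
pose G x : 'rV[R]_n := \row_i g i x.
have sG : L2vec G.
  by move=> i; apply: eq_sqint (gP i).1 => x _; rewrite mxE.
exists G => //.
have e k : ip (F k - G) (F k - G) = \sum_i nrm2 mu D (fun x => F k x ord0 i - g i x).
  rewrite ip_nrm2; last exact: L2vecB.
  by apply: eq_bigr => i _; apply: eq_Rintegral => x _; rewrite ?fctE !mxE.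
under eq_fun do rewrite e.
have := @cvgr_sum R _ (index_enum 'I_n)
  (fun i k => nrm2 mu D (fun x => F k x ord0 i - g i x)) (fun=> 0)
  (fun i => (gP i).2).
by rewrite [\sum_(i <- _) 0]big1.
Qed.

Lemma le_Rintegral_ae (f g : T -> R) :
  mu.-integrable D (EFin \o f) -> mu.-integrable D (EFin \o g) ->
  {ae mu, forall x, D x -> f x <= g x} ->
  \int[mu]_(x in D) f x <= \int[mu]_(x in D) g x.
Proof.
move=> If Ig fg; rewrite -subr_ge0 -RintegralB//.
have mf : measurable_fun D f by apply/measurable_EFinP; exact: measurable_int If.
have mg : measurable_fun D g by apply/measurable_EFinP; exact: measurable_int Ig.
(* The difference is nonnegative only almost everywhere; its positive part is nonnegative everywhere
   and has the same integral. *)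
have -> : \int[mu]_(x in D) (g x - f x) = \int[mu]_(x in D) Num.max 0 (g x - f x).
  congr fine; apply: ae_eq_integral => //.
  - by apply/measurable_EFinP; exact: measurable_funB.
  - apply/measurable_EFinP; apply: measurable_maxr => //.
    exact: measurable_funB.
  - by apply: filterS fg => x h Dx; rewrite max_r// subr_ge0 h.
by apply: Rintegral_ge0 => x _; rewrite le_max lexx.
Qed.

Lemma sqint_le_integrable (f h : T -> R) : measurable_fun D f ->
  mu.-integrable D (EFin \o h) -> {ae mu, forall x, D x -> f x ^+ 2 <= h x} ->
  sqint mu D f.
Proof.
move=> mf /integrableP[/measurable_EFinP mh Ih] fh; split => //.
apply: le_lt_trans Ih; apply: ae_ge0_le_integral => //.
- by move=> x _; rewrite lee_fin sqr_ge0.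
- by apply/measurable_EFinP; exact: measurable_funX.
- by apply/measurable_EFinP; exact: measurableT_comp.
- apply: filterS fh => x h1 Dx /=; rewrite lee_fin.
  by rewrite (le_trans (h1 Dx)) ?ler_norm.
Qed.

Definition mulB B G : T -> 'rV[R]_n := fun x => G x *m (B x)^T.

Definition tensor B (al be : R) : Prop :=
  [/\ forall i j, measurable_fun D (fun x => B x i j),
      {ae mu, forall x, D x -> (B x)^T = B x} &
      {ae mu, forall x, D x -> forall xi : 'rV[R]_n,
         al * enorm xi ^+ 2 <= bform (B x) xi xi /\
         enorm (xi *m (B x)^T) <= be * enorm xi}].

Section tensor_field.
Variables (B : T -> 'M[R]_n) (al be : R).
Hypotheses (al0 : 0 < al) (be0 : 0 < be) (tB : tensor B al be).

Lemma mulB_bound G : {ae mu, forall x, D x ->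
  dotp (mulB B G x) (mulB B G x) <= be ^+ 2 * dotp (G x) (G x)}.
Proof.
have [_ _] := tB; apply: filterS => x h Dx; have [_ {}h] := h Dx (G x).
rewrite -!enorm_sq -exprMn ler_pXn2r// nnegrE ?enorm_ge0//.
by rewrite mulr_ge0 ?enorm_ge0// ltW.
Qed.

Lemma measurable_mulB B' G i : (forall i j, measurable_fun D (fun x => B' x i j)) ->
  L2vec G -> measurable_fun D (fun x => mulB B' G x ord0 i).
Proof.
move=> mB' sG; rewrite (_ : (fun x => _) =
    fun x => \sum_j (G x ord0 j * B' x i j)); last first.
  by apply/funext => x; rewrite mxE; apply: eq_bigr => j _; rewrite mxE.
by apply: measurable_sum => j; apply: measurable_funM; [exact: (sG j).1|exact: mB'].
Qed.

Lemma L2vec_mulB G : L2vec G -> L2vec (mulB B G).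
Proof.
move=> sG i; have [mB _ _] := tB.
apply: (@sqint_le_integrable _ (fun x => be ^+ 2 * dotp (G x) (G x))).
- exact: measurable_mulB.
- by have := integrableZl mD (be ^+ 2) (integrable_dotp sG sG); apply: eq_integrable.
- apply: filterS (mulB_bound G) => x h Dx.
  exact: le_trans (dotp_coord _ _) (h Dx).
Qed.

Lemma ip_mulB_le G : L2vec G -> ip (mulB B G) (mulB B G) <= be ^+ 2 * ip G G.
Proof.
move=> sG; have sBG := L2vec_mulB sG.
rewrite /ip -RintegralZl//; last exact: integrable_dotp.
apply: le_Rintegral_ae; [exact: integrable_dotp| |exact: mulB_bound].
by have := integrableZl mD (be ^+ 2) (integrable_dotp sG sG); apply: eq_integrable.
Qed.

Lemma mulBD G H (a : R) : mulB B (G + a *: H) = mulB B G + a *: mulB B H.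
Proof. by apply/funext => x; rewrite /mulB !fctE mulmxDl -scalemxAl. Qed.

Definition frm G H := ip (mulB B G) H.

Lemma frmDl G H K (a : R) : L2vec G -> L2vec H -> L2vec K ->
  frm (G + a *: H) K = frm G K + a * frm H K.
Proof. by move=> *; rewrite /frm mulBD ipDZl//; exact: L2vec_mulB. Qed.

Lemma frmDr G H K (a : R) : L2vec G -> L2vec H -> L2vec K ->
  frm K (G + a *: H) = frm K G + a * frm K H.
Proof. by move=> *; rewrite /frm ipDZr//; exact: L2vec_mulB. Qed.

Lemma frmC G H : L2vec G -> L2vec H -> frm G H = frm H G.
Proof.
move=> sG sH; have [mB sB _] := tB; have sBG := L2vec_mulB sG.
have sBH := L2vec_mulB sH; congr fine.
apply: ae_eq_integral => //; [exact: measurable_int (integrable_dotp sBG sH)|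
  exact: measurable_int (integrable_dotp sBH sG)|].
apply: filterS sB => x h Dx; congr EFin; rewrite dotpC /dotp /mulB (h Dx).
under eq_bigr do rewrite mxE mulr_sumr.
under [RHS]eq_bigr do rewrite mxE mulr_suml.
rewrite exchange_big/=; apply: eq_bigr => i _; apply: eq_bigr => j _.
rewrite -{1}(h Dx) mxE; ring.
Qed.

Lemma frm_ge G : L2vec G -> al * ip G G <= frm G G.
Proof.
move=> sG; have sBG := L2vec_mulB sG; have [_ _ eB] := tB.
rewrite /frm /ip -RintegralZl//; last exact: integrable_dotp.
apply: le_Rintegral_ae; last 2 first.
- exact: integrable_dotp.
- by apply: filterS eB => x h Dx; rewrite -enorm_sq; exact: (h Dx _).1.
by have := integrableZl mD al (integrable_dotp sG sG); apply: eq_integrable.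
Qed.

Lemma frm_bound G H : L2vec G -> L2vec H ->
  frm G H ^+ 2 <= be ^+ 2 * ip G G * ip H H.
Proof.
move=> sG sH; have sBG := L2vec_mulB sG.
apply: (le_trans (ip_cauchy_schwarz sBG sH)).
by rewrite ler_wpM2r ?ip_ge0// ip_mulB_le.
Qed.

End tensor_field.

Section variational.
Variable (V : set (T -> 'rV[R]_n)).
Hypothesis V_L2 : V `<=` L2vec.
Hypothesis V0 : V 0.
Hypothesis V_lin : forall G H (a : R), V G -> V H -> V (G + a *: H).
Hypothesis V_complete : forall F : nat -> T -> 'rV[R]_n, (forall k, V (F k)) ->
  (forall e : R, 0 < e -> exists N : nat, forall k m, (N <= k)%N -> (N <= m)%N ->
     ip (F k - F m) (F k - F m) <= e) ->
  exists2 G, V G & ip (F k - G) (F k - G) @[k --> \oo] --> (0 : R).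

(* [N] is the field [B]-orthogonal to [V] in the affine space [N0 + V]. *)
Definition variational B N0 N := V (N - N0) /\ forall K, V K -> frm B N K = 0.

Variables (al be : R) (al0 : 0 < al) (be0 : 0 < be).

(** Boundedness and coercivity make [frm B] and [ip] comparable on [V], so completeness for [ip]
    gives the completeness that [sip_projection] asks for. The field is [N0] plus the correction
    found there. *)
Lemma variational_exists B N0 : tensor B al be -> L2vec N0 ->
  exists N, variational B N0 N.
Proof.
move=> tB sN0.
have [|||||||H VH HP] := @sip_projection R (T -> 'rV[R]_n) L2vec V (frm B) _ _ _ _ V_L2 V_lin _ N0.
- by move=> *; exact: L2vecD.
- by move=> *; exact: (frmC be0 tB).
- by move=> *; exact: (frmDl be0 tB).
- move=> G sG; apply: le_trans (frm_ge be0 tB sG).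
  by rewrite mulr_ge0 ?ip_ge0// ltW.
- move=> F VF cF; have sF k := V_L2 (VF k).
  have [|G VG cG] := V_complete VF.
    move=> e e0; have [|N NP] := cF (al * e); first by rewrite mulr_gt0.
    exists N => k m Nk Nm; rewrite -(ler_pM2l al0).
    by apply: le_trans (NP k m Nk Nm); apply: (frm_ge be0 tB); exact: L2vecB.
  exists G => //; have sG := V_L2 VG.
  have : be * ip (F k - G) (F k - G) @[k --> \oo] --> be * (0 : R).
    by apply: cvgM => //; exact: cvg_cst.
  rewrite mulr0 => h; apply: squeeze_cvgr h; last exact: cvg_cst.
  apply: nearW => k; have sFG := L2vecB (sF k) sG.
  have h0 : 0 <= frm B (F k - G) (F k - G).
    by apply: le_trans (frm_ge be0 tB sFG); rewrite mulr_ge0 ?ip_ge0// ltW.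
  rewrite h0 /= -ler_sqr ?nnegrE ?mulr_ge0 ?ip_ge0 ?(ltW be0)//.
    apply: (le_trans (frm_bound be0 tB sFG sFG)).
  by rewrite exprMn [in leRHS]expr2 !mulrA.
- by exists 0.
- exact: sN0.
by exists (N0 + H); split => //; rewrite addrAC subrr add0r.
Qed.

Lemma variational_L2 B N0 N : L2vec N0 -> variational B N0 N -> L2vec N.
Proof.
move=> sN0 [VN _]; rewrite -(subrK N0 N) addrC -[N - N0]scale1r.
by apply: L2vecD => //; exact: V_L2.
Qed.

(** Testing with [N - N0] gives [frm B N N = frm B N N0], so that [al |N|^2 <= be |N| |N0|]. *)
Lemma variational_bound B N0 N : tensor B al be -> L2vec N0 ->
  variational B N0 N -> ip N N <= (be / al) ^+ 2 * ip N0 N0.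
Proof.
move=> tB sN0 hN; have sN := variational_L2 sN0 hN.
have [VN NP] := hN.
have e : frm B N N = frm B N N0.
  have := NP _ VN; rewrite -scaleN1r (frmDr be0 tB)// mulN1r.
  by move/eqP; rewrite subr_eq0 => /eqP.
have h1 := frm_ge be0 tB sN; have h2 := frm_bound be0 tB sN sN0.
move: h1 h2 (ip_ge0 N) (ip_ge0 N0); rewrite e.
move: (frm B N N0) (ip N N) (ip N0 N0) => q p r h1 h2 p0 r0.
rewrite exprMn exprVn mulrAC ler_pdivlMr ?exprn_gt0//.
have [->|pn] := eqVneq p 0; first by rewrite mul0r mulr_ge0// sqr_ge0.
have {p0 pn}p0 : 0 < p by rewrite lt_neqAle eq_sym pn.
rewrite -(ler_pM2l p0) [leRHS]mulrCA [leRHS]mulrA; apply: le_trans h2.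
rewrite (_ : p * (p * al ^+ 2) = (al * p) ^+ 2); last by ring.
have a0 : 0 <= al * p by rewrite mulr_ge0 ?(ltW al0) ?(ltW p0).
by rewrite ler_sqr// nnegrE (le_trans a0 h1).
Qed.

Lemma variational_output_bound B N0 N H0 : tensor B al be -> L2vec N0 ->
  L2vec H0 -> variational B N0 N ->
  frm B N H0 ^+ 2 <= be ^+ 2 * (be / al) ^+ 2 * ip N0 N0 * ip H0 H0.
Proof.
move=> tB sN0 sH0 hN; have sN := variational_L2 sN0 hN.
apply: (le_trans (frm_bound be0 tB sN sH0)).
rewrite ler_wpM2r ?ip_ge0// -mulrA ler_wpM2l ?sqr_ge0//.
exact: (variational_bound tB sN0 hN).
Qed.

(** The difference of two solutions lies in [V] and has zero energy, hence zero norm, and does not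
    contribute to the output. Values chosen by [get] can therefore be computed from any solution. *)
Lemma variational_output_unique B N0 N N' H0 : tensor B al be -> L2vec N0 ->
  L2vec H0 -> variational B N0 N -> variational B N0 N' -> frm B N H0 = frm B N' H0.
Proof.
move=> tB sN0 sH0 vN vN'.
have sN := variational_L2 sN0 vN; have sN' := variational_L2 sN0 vN'.
have VD : V (N - N').
  have -> : N - N' = (N - N0) + (-1) *: (N' - N0).
    by rewrite scaleN1r opprB addrA subrK.
  by apply: V_lin; [exact: vN.1|exact: vN'.1].
have sD := V_L2 VD.
have frmD K : L2vec K -> frm B (N - N') K = frm B N K - frm B N' K.
  by move=> sK; have := frmDl be0 tB (-1) sN sN' sK; rewrite scaleN1r mulN1r.
have D0 : ip (N - N') (N - N') = 0.
  apply/eqP; rewrite eq_le ip_ge0 andbT -(pmulr_rle0 _ al0).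
  by apply: (le_trans (frm_ge be0 tB sD)); rewrite frmD// vN.2// vN'.2// subrr.
apply/eqP; rewrite -subr_eq0 -frmD// -sqrf_eq0 eq_le sqr_ge0 andbT.
by have := frm_bound be0 tB sD sH0; rewrite D0 mulr0 mul0r.
Qed.

(** Dominated convergence for the fixed field [N]: both products are bounded by [be |N|], whence the
    dominating function [4 be^2 |N|^2]. *)
Lemma ip_mulB_cvg0 (Bk : nat -> T -> 'M[R]_n) B N :
  (forall k, tensor (Bk k) al be) -> tensor B al be -> L2vec N ->
  {ae mu, forall x, D x -> forall i j, Bk k x i j @[k --> \oo] --> B x i j} ->
  ip (mulB (Bk k) N - mulB B N) (mulB (Bk k) N - mulB B N) @[k --> \oo] --> (0 : R).
Proof.
move=> tBk tB sN BkB.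
pose E k := mulB (Bk k) N - mulB B N.
have sE k : L2vec (E k).
  exact: L2vecB (L2vec_mulB be0 (tBk k) sN) (L2vec_mulB be0 tB sN).
pose f k x : \bar R := (dotp (E k x) (E k x))%:E.
have mf k : measurable_fun D (f k).
  exact: measurable_int (integrable_dotp (sE k) (sE k)).
have fB : {ae mu, forall x k, D x ->
    (`|f k x| <= (4 * be ^+ 2 * dotp (N x) (N x))%:E)%E}.
  have h1 : {ae mu, forall x k, D x -> dotp (mulB (Bk k) N x) (mulB (Bk k) N x)
      <= be ^+ 2 * dotp (N x) (N x)}.
    by apply: ae_foralln => k; exact: (mulB_bound be0 (tBk k)).
  have h2 := mulB_bound be0 tB N.
  apply: filterS2 h1 h2 => x h1 h2 k Dx.
  rewrite /f abse_EFin lee_fin ger0_norm ?dotp_ge0//.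
  apply: (le_trans (dotp_sub_le (mulB (Bk k) N x) (mulB B N x))).
  by have := h1 k Dx; have := h2 Dx; lra.
have f0 : {ae mu, forall x, D x -> f ^~ x @ \oo --> 0%E}.
  apply: filterS BkB => x h Dx.
  apply: (@cvg_EFin _ _ _ _ _ 0); first by apply: nearW.
  rewrite /comp/= (_ : (fun k => _) = fun k : nat => \sum_i (\sum_j N x ord0 j * (Bk k x i j - B x i j)) ^+ 2); last first.
    apply/funext => k; apply: eq_bigr => i _; rewrite -expr2; congr (_ ^+ 2).
    rewrite /E !fctE !mxE -sumrB; apply: eq_bigr => j _.
    by rewrite !mxE mulrBr.
  have := @cvgr_sum R _ (index_enum 'I_n) (fun i k => (\sum_j N x ord0 j * (Bk k x i j - B x i j)) ^+ 2) (fun=> 0).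
  rewrite [\sum_(i <- _) 0]big1//; apply => i.
  have h0 : \sum_j N x ord0 j * (Bk k x i j - B x i j) @[k --> \oo] --> (0 : R).
    have := @cvgr_sum R _ (index_enum 'I_n) (fun j k => N x ord0 j * (Bk k x i j - B x i j)) (fun=> 0).
    rewrite [\sum_(i <- _) 0]big1//; apply => j.
    have hB : Bk k x i j - B x i j @[k --> \oo] --> (0 : R).
      by rewrite -(subrr (B x i j)); apply: cvgB; [exact: h|exact: cvg_cst].
    rewrite -[X in _ --> X](mulr0 (N x ord0 j)).
    by apply: cvgM hB; exact: cvg_cst.
  rewrite -[X in _ --> X](mulr0 (0 : R)); under eq_fun do rewrite expr2.
  exact: cvgM.
have iN : mu.-integrable D (fun x => (4 * be ^+ 2 * dotp (N x) (N x))%:E).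
  by have := integrableZl mD (4 * be ^+ 2) (integrable_dotp sN sN); apply: eq_integrable.
have [_ _] := dominated_convergence mD mf (@measurable_cst _ _ _ _ _ 0%E) f0 iN fB.
by rewrite integral0 => /fine_cvg.
Qed.

(** The error [D = Nk - N] lies in [V]; testing with it gives [al |D|^2 <= |(Bk - B) N| |D|]. Only
    the fixed limit field [N] is multiplied by [Bk - B], which is what lets dominated convergence
    apply. *)
Lemma variational_cvg (Bk : nat -> T -> 'M[R]_n) B N0 (Nk : nat -> T -> 'rV[R]_n) N H0 :
  (forall k, tensor (Bk k) al be) -> tensor B al be -> L2vec N0 -> L2vec H0 ->
  (forall k, variational (Bk k) N0 (Nk k)) -> variational B N0 N ->
  {ae mu, forall x, D x -> forall i j, Bk k x i j @[k --> \oo] --> B x i j} ->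
  frm (Bk k) (Nk k) H0 @[k --> \oo] --> frm B N H0.
Proof.
move=> tBk tB sN0 sH0 vNk vN BkB.
have sN := variational_L2 sN0 vN.
have sNk k := variational_L2 sN0 (vNk k).
pose E k := mulB (Bk k) N - mulB B N.
have sBkN k G : L2vec G -> L2vec (mulB (Bk k) G) by move=> sG; exact: (L2vec_mulB be0 (tBk k) sG).
have sBN : L2vec (mulB B N) := L2vec_mulB be0 tB sN.
have sE k : L2vec (E k) := L2vecB (sBkN k N sN) sBN.
have ee := ip_mulB_cvg0 tBk tB sN BkB.
have VD k : V (Nk k - N).
  have -> : Nk k - N = (Nk k - N0) + (-1) *: (N - N0).
    by rewrite scaleN1r opprB addrA subrK.
  by apply: V_lin; [exact: (vNk k).1|exact: vN.1].
have sD k : L2vec (Nk k - N) := V_L2 (VD k).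
have frmE' k G : L2vec G -> ip (E k) G = frm (Bk k) N G - frm B N G.
  by move=> sG; rewrite /E -scaleN1r ipDZl ?mulN1r//; exact: sBkN.
have eD k : frm (Bk k) (Nk k - N) (Nk k - N) = - ip (E k) (Nk k - N).
  rewrite frmE'// vN.2// subr0.
  by rewrite -{1}scaleN1r (frmDl be0 (tBk k))// mulN1r (vNk k).2// sub0r.
have Dle k : ip (Nk k - N) (Nk k - N) <= al ^- 2 * ip (E k) (E k).
  have h1 := frm_ge be0 (tBk k) (sD k); rewrite eD in h1.
  have h2 := ip_cauchy_schwarz (sE k) (sD k).
  move: h1 h2 (ip_ge0 (Nk k - N)) (ip_ge0 (E k)).
  move: (ip (E k) (E k)) (ip (Nk k - N) (Nk k - N)) (ip (E k) (Nk k - N)) => r p q h1 h2 p0 r0.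
  rewrite ler_pdivlMl ?exprn_gt0//.
  have [->|pn] := eqVneq p 0; first by rewrite mulr0.
  have {p0 pn}p0 : 0 < p by rewrite lt_neqAle eq_sym pn.
  rewrite -(ler_pM2r p0); apply: le_trans h2.
  rewrite (_ : al ^+ 2 * p * p = (al * p) ^+ 2); last by ring.
  have a0 : 0 <= al * p by rewrite mulr_ge0 ?(ltW al0) ?(ltW p0).
  have : (al * p) ^+ 2 <= (- q) ^+ 2.
    by apply: lerXn2r => //; rewrite nnegrE// (le_trans a0 h1).
  by rewrite sqrrN.
suff h : frm (Bk k) (Nk k) H0 - frm B N H0 @[k --> \oo] --> (0 : R).
  rewrite -[X in _ --> X]add0r.
  rewrite (_ : (fun k => _) = fun k =>
    (frm (Bk k) (Nk k) H0 - frm B N H0) + frm B N H0); last first.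
    by apply/funext => k; rewrite subrK.
  by apply: cvgD h _; exact: cvg_cst.
(* From [(a + b)^2 <= 2 a^2 + 2 b^2], where [a] is the error due to the field, which costs
   [be^2 al^-2], and [b] the error due to the coefficients. *)
pose C := 2 * (be ^+ 2 * al ^- 2 + 1) * ip H0 H0.
apply: (@cvg0_sq _ _ (fun k => C * ip (E k) (E k))); last first.
  by rewrite -(mulr0 C); apply: cvgM => //; exact: cvg_cst.
move=> k.
have -> : frm (Bk k) (Nk k) H0 - frm B N H0 =
    frm (Bk k) (Nk k - N) H0 + ip (E k) H0.
  have := frmDl be0 (tBk k) (-1) (sNk k) sN sH0.
  by rewrite scaleN1r mulN1r frmE'// => ->; rewrite addrA subrK.
have h1 := frm_bound be0 (tBk k) (sD k) sH0.
have h2 := ip_cauchy_schwarz (sE k) sH0.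
have h3 : be ^+ 2 * ip (Nk k - N) (Nk k - N) * ip H0 H0 <=
    be ^+ 2 * (al ^- 2 * ip (E k) (E k)) * ip H0 H0.
  by rewrite ler_wpM2r ?ip_ge0// ler_wpM2l ?sqr_ge0.
move: (le_trans h1 h3) h2; rewrite /C.
move: (frm _ _ _) (ip (E k) H0) (ip (E k) (E k)) (ip H0 H0) (al ^- 2) => a b r h v h4 h5.
have : 0 <= (a - b) ^+ 2 by exact: sqr_ge0.
have -> : 2 * (be ^+ 2 * v + 1) * h * r = 2 * (be ^+ 2 * (v * r) * h) + 2 * (r * h) by ring.
rewrite !sqrrD mulrN sqrrN; lra.
Qed.

End variational.

End vector_fields.

(** * Lebesgue measure on R^n *)

Section dyadic_grid.
Context {R : realType} (n : nat).
Implicit Types (x : 'rV[R]_n) (k : nat) (z : 'rV[int]_n).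

(** Cells are indexed by a countable type. This makes open sets measurable for the coordinate
    sigma-algebra, and later reduces the evaluation of a random function to countably many points at
    each scale. *)
Definition dyadic_floor k x : 'rV[int]_n := \row_i Num.floor (2 ^+ k * x ord0 i).

Definition dyadic_point k z : 'rV[R]_n := \row_i ((z ord0 i)%:~R / 2 ^+ k).

Lemma dyadic_close k x i :
  `|x ord0 i - dyadic_point k (dyadic_floor k x) ord0 i| <= 2 ^- k.
Proof.
rewrite !mxE; have k0 : 0 < 2 ^+ k :> R by rewrite exprn_gt0.
have /andP[h1 h2] := floor_itv (2 ^+ k * x ord0 i).
rewrite ger0_norm; last by rewrite subr_ge0 ler_pdivrMr// (mulrC (x ord0 i)).
rewrite -(ler_pM2l k0) mulrBr divff ?gt_eqF// mulrCA divff ?gt_eqF// mulr1.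
by move: h2; rewrite ?intrD lerBlDr => /ltW; rewrite addrC.
Qed.

Lemma measurable_dyadic_cell k z : measurable (dyadic_floor k @^-1` [set z]).
Proof.
have -> : dyadic_floor k @^-1` [set z] =
    \bigcap_(i in [set: 'I_n]) [set x : 'rV[R]_n | (z ord0 i)%:~R / 2 ^+ k <= x ord0 i < (z ord0 i + 1)%:~R / 2 ^+ k].
  have k0 : 0 < 2 ^+ k :> R by rewrite exprn_gt0.
  apply/seteqP; split => x /= h.
    move=> i _ /=; rewrite -h mxE ler_pdivrMr// ltr_pdivlMr// (mulrC (x ord0 i)).
    exact: floor_itv.
  apply/rowP => i; rewrite mxE; apply: floor_def.
  by have := h i I; rewrite /= ler_pdivrMr// ltr_pdivlMr// (mulrC (x ord0 i)).
apply: fin_bigcap_measurable => // i _.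
rewrite (_ : [set x | _] = (fun x : 'rV[R]_n => x ord0 i) @^-1`
  `[(z ord0 i)%:~R / 2 ^+ k, (z ord0 i + 1)%:~R / 2 ^+ k[%classic); last first.
  by apply/seteqP; split => x /=; rewrite in_itv.
by rewrite -[X in measurable X]setTI; apply: measurable_coord.
Qed.

Lemma measurable_dyadic_floor k (Z : set 'rV[int]_n) :
  measurable (dyadic_floor k @^-1` Z).
Proof.
rewrite (_ : _ @^-1` Z = \bigcup_z (if z \in Z then dyadic_floor k @^-1` [set z] else set0)).
  apply: countable_bigcupT_measurable; first exact: countableP.
  by move=> z; case: ifPn => _ //; exact: measurable_dyadic_cell.
apply/seteqP; split => [x /= Zx|x [z _]].
  by exists (dyadic_floor k x) => //; rewrite mem_set.
by case: ifPn => // /set_mem zZ /= ->.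
Qed.

Lemma open_measurable_rV (U : set 'rV[R]_n) : open U -> measurable U.
Proof.
move=> oU.
rewrite (_ : U = \bigcup_k (dyadic_floor k @^-1` [set z | dyadic_floor k @^-1` [set z] `<=` U])).
  by apply: bigcup_measurable => k _; exact: measurable_dyadic_floor.
apply/seteqP; split => [x Ux|x [k _] /=]; last exact.
have /nbhs_ballP[e /= e0 eU] : nbhs x U by exact: open_nbhs_nbhs.
(* Two points of one cell are both within [2^-k] of its corner, whence the factor 2. *)
have [k ke] : exists k : nat, 2 * 2 ^- k < e.
  have : geometric 2 2^-1 n @[n --> \oo] --> (0 : R).
    by apply: cvg_geometric; rewrite ger0_norm ?invr_ge0//; lra.
  move/cvgrPdist_lt => /(_ _ e0) [p _ /(_ p (leqnn _))] /=.
  rewrite sub0r normrN exprVn ger0_norm ?mulr_ge0 ?invr_ge0 ?exprn_ge0// => hp.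
  by exists p.
exists k => //= y /= yx; apply: eU; split => // i j; rewrite ord1.
have h1 := dyadic_close k x j; have h2 := dyadic_close k y j.
rewrite /ball/=; rewrite yx in h2; rewrite distrC in h2.
apply: le_lt_trans ke.
rewrite -(subrK (dyadic_point k (dyadic_floor k x) ord0 j) (x ord0 j)) -addrA.
by rewrite (le_trans (ler_normD _ _))// mulr_natl mulr2n lerD.
Qed.

Lemma closed_measurable_rV (U : set 'rV[R]_n) : closed U -> measurable U.
Proof.
by move=> cU; rewrite -[U]setCK; apply: measurableC; apply: open_measurable_rV; apply: closed_openC.
Qed.

Lemma continuous_measurable_rV (f : 'rV[R]_n -> R) :
  continuous f -> measurable_fun setT f.
Proof.
move=> /continuousP cf _.
apply: (measurability _ (RGenOInfty.measurableE R)) => //.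
move=> _ [_ [a ->] <-]; rewrite setTI.
by apply: open_measurable_rV; apply: cf; exact: interval_open.
Qed.

Lemma continuous_coord (i : 'I_n) : continuous (fun x : 'rV[R]_n => x ord0 i).
Proof. exact: coord_continuous. Qed.

End dyadic_grid.

Section lebesgue_rV_theory.
Context {R : realType}.
Notation leb1 := (@lebesgue_measure R).

Lemma ge0_integral_cons n (f : 'rV[R]_n.+1 -> \bar R) :
  measurable_fun setT f -> (forall x, (0 <= f x)%E) ->
  (\int[lebesgue_rV n.+1]_x f x =
   \int[(leb1 \x lebesgue_rV n)%E]_p f (cons_rV p))%E.
Proof.
move=> mf f0.
have := @ge0_integral_pushforward _ _ _ _ R _ (@measurable_cons_rV R n)
  (leb1 \x lebesgue_rV n)%E setT f measurableT mf (fun x _ => f0 x).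
by rewrite preimage_setT.
Qed.

Lemma measurable_comp_cons n (f : 'rV[R]_n.+1 -> \bar R) :
  measurable_fun setT f -> measurable_fun setT (f \o @cons_rV R n).
Proof. by move=> mf; apply: measurableT_comp => //; exact: measurable_cons_rV. Qed.

Lemma ge0_integral_cons1 n (f : 'rV[R]_n.+1 -> \bar R) :
  measurable_fun setT f -> (forall x, (0 <= f x)%E) ->
  (\int[lebesgue_rV n.+1]_x f x =
   \int[leb1]_t \int[lebesgue_rV n]_v f (cons_rV (t, v)))%E.
Proof.
move=> mf f0; rewrite ge0_integral_cons//.
have h := @fubini_tonelli1 _ _ _ _ R (@lebesgue_measure R) (lebesgue_rV n) _ (measurable_comp_cons mf) (fun=> f0 _).
exact: h.
Qed.

Lemma ge0_integral_cons2 n (f : 'rV[R]_n.+1 -> \bar R) :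
  measurable_fun setT f -> (forall x, (0 <= f x)%E) ->
  (\int[lebesgue_rV n.+1]_x f x =
   \int[lebesgue_rV n]_v \int[leb1]_t f (cons_rV (t, v)))%E.
Proof.
move=> mf f0; rewrite ge0_integral_cons//.
have h := @fubini_tonelli2 _ _ _ _ R (@lebesgue_measure R) (lebesgue_rV n) _ (measurable_comp_cons mf) (fun=> f0 _).
exact: h.
Qed.

Lemma lebesgue_rV_box n (I : 'I_n -> set R) : (forall i, measurable (I i)) ->
  lebesgue_rV n [set x | forall i, I i (x ord0 i)] = (\prod_i leb1 (I i))%E.
Proof.
elim: n I => [|n IH] I mI.
  rewrite [X in lebesgue_rV 0 X](_ : _ = setT); last first.
    by apply/seteqP; split => // x _ [].
  by rewrite big_ord0 /= diracT.
pose I' i := I (lift ord0 i).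
pose A' := [set x : 'rV[R]_n | forall i, I' i (x ord0 i)].
have mA' : measurable A'.
  rewrite (_ : A' = \bigcap_(i in [set: 'I_n]) [set x : 'rV[R]_n | I' i (x ord0 i)]).
    apply: fin_bigcap_measurable => // i _.
    by rewrite -[X in measurable X]setTI; exact: (@measurable_coord R n i measurableT _ (mI (lift ord0 i))).
  by apply/seteqP; split => x /= h i; [move=> _; exact: h|exact: h].
rewrite big_ord_recl -(IH I')//.
rewrite -(product_measure1E leb1 (lebesgue_rV n) (mI ord0) mA').
transitivity ((leb1 \x lebesgue_rV n)%E
  (@cons_rV R n @^-1` [set x | forall i, I i (x ord0 i)])) => //.
congr ((leb1 \x lebesgue_rV n)%E _); apply/seteqP; split => [[t v] /= h|[t v] [/= h1 h2] i].
  split; first by have := h ord0; rewrite mxE unlift_none.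
  by move=> i; have := h (lift ord0 i); rewrite mxE liftK.
by rewrite mxE; case: unliftP => [j ->|->] /=; [exact: h2|]. by move=> i; exact: mI.
Qed.

Lemma lebesgue_cell n : lebesgue_rV n (@cell R n) = 1%E.
Proof.
rewrite (_ : cell = [set x | forall i, `]0, 1[%classic (x ord0 i)]).
  rewrite [LHS](lebesgue_rV_box (I := fun=> `]0, 1[%classic))// big1// => i _.
  by rewrite lebesgue_measure_itv/= lte_fin ltr01 oppr0 adde0.
by apply/seteqP; split => x h i; have := h i; rewrite /= in_itv.
Qed.

Lemma measurable_cell n : measurable (@cell R n).
Proof.
rewrite (_ : cell = \bigcap_(i in [set: 'I_n])
  ((fun x : 'rV[R]_n => x ord0 i) @^-1` `]0, 1[%classic)).
  apply: fin_bigcap_measurable => // i _.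
  by rewrite -[X in measurable X]setTI; apply: measurable_coord.
by apply/seteqP; split => x h i; have := h i; rewrite /= in_itv => // /(_ I).
Qed.

Lemma lebesgue_cube n (c : 'rV[R]_n) (r : R) : 0 <= r ->
  lebesgue_rV n [set x | forall i, `|x ord0 i - c ord0 i| <= r] =
  ((2 * r) ^+ n)%:E.
Proof.
move=> r0.
rewrite (_ : [set x | _] =
  [set x | forall i, `[c ord0 i - r, c ord0 i + r]%classic (x ord0 i)]).
  rewrite [LHS](lebesgue_rV_box (I := fun i => `[c ord0 i - r, c ord0 i + r]%classic))//.
  have e i : leb1 `[c ord0 i - r, c ord0 i + r]%classic = (2 * r)%:E.
    rewrite lebesgue_measure_itv/= lte_fin; case: ltP => h.
      by rewrite -EFinD; congr EFin; ring.
    by congr EFin; lra.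
  under eq_bigr do rewrite e.
  by rewrite prodEFin big_const_ord iter_mulr_1.
apply/seteqP; split => x h i; have := h i; rewrite /= in_itv/= ler_distl//.
Qed.

End lebesgue_rV_theory.

(** * Smooth functions and Poincare's inequality on the cell *)

Section smooth_functions.
Context {R : realType} {n : nat}.
Implicit Types (u v w : 'rV[R]_n -> R) (x : 'rV[R]_n) (i : 'I_n).
Notation leb1 := (@lebesgue_measure R).

Lemma smooth_continuous w : smooth w -> continuous w.
Proof. by move/(_ 0%N) => []. Qed.

Lemma smooth_derivable w x i : smooth w -> derivable w x (basis_rV i).
Proof. by move/(_ 1%N) => [_ /(_ i)[]]. Qed.

Lemma smooth_pderiv_continuous w i : smooth w -> continuous (pderiv i w).
Proof. by move/(_ 1%N) => [_ /(_ i)[_ []]]. Qed.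

Lemma smooth_measurable w : smooth w -> measurable_fun setT w.
Proof. by move=> sw; apply: continuous_measurable_rV; exact: smooth_continuous. Qed.

Lemma smooth_pderiv_measurable w i : smooth w -> measurable_fun setT (pderiv i w).
Proof.
by move=> sw; apply: continuous_measurable_rV; exact: smooth_pderiv_continuous.
Qed.

Lemma pderivD u v (a : R) i : (forall x, derivable u x (basis_rV i)) ->
  (forall x, derivable v x (basis_rV i)) ->
  pderiv i (fun x => u x + a * v x) = (fun x => pderiv i u x + a * pderiv i v x).
Proof.
move=> du dv; apply/funext => x; rewrite /pderiv.
rewrite -[LHS]/('D_(basis_rV i) (u + (a \*: (v : _ -> R^o))) x).
by rewrite deriveD ?deriveZ//; exact: derivableZ.
Qed.

Lemma CkD k u v (a : R) : Ck k u -> Ck k v -> Ck k (fun x => u x + a * v x).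
Proof.
have contD f h : continuous f -> continuous h -> continuous (fun x : 'rV[R]_n => f x + a * h x : R).
  by move=> cf ch x; exact: (cvgD (cf x) (cvgM (cvg_cst a) (ch x))).
elim: k u v => [|k IH] u v [cu du] [cv dv]; first by split => //; exact: contD.
split; first exact: contD.
move=> i; split.
  move=> x; rewrite -[X in derivable X]/(u + (a \*: (v : _ -> R^o))).
  by apply: derivableD; [exact: (du i).1|apply: derivableZ; exact: (dv i).1].
rewrite pderivD; [|exact: (du i).1|exact: (dv i).1].
by apply: IH; [exact: (du i).2|exact: (dv i).2].
Qed.

Lemma smoothD u v (a : R) : smooth u -> smooth v -> smooth (fun x => u x + a * v x).
Proof. by move=> su sv k; exact: CkD. Qed.

Lemma pderiv_cst (c : R) i : pderiv i (fun _ : 'rV[R]_n => c) = (fun=> 0).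
Proof. by apply/funext => x; exact: (derive_cst (c : R^o)). Qed.

Lemma smooth_cst (c : R) : smooth (fun _ : 'rV[R]_n => c).
Proof.
move=> k; elim: k c => [|k IH] c; first by split => //; exact: cst_continuous.
split; first exact: cst_continuous.
move=> i; split; first by move=> x; exact: derivable_cst.
by rewrite pderiv_cst.
Qed.

Lemma smooth_pderivD u v (a : R) i : smooth u -> smooth v ->
  pderiv i (fun x => u x + a * v x) = (fun x => pderiv i u x + a * pderiv i v x).
Proof. by move=> su sv; apply: pderivD => x; exact: smooth_derivable. Qed.

Lemma line_quotient w x i (s h : R) :
  h^-1 *: ((w \o shift (x + s *: basis_rV i)) (h *: basis_rV i) - w (x + s *: basis_rV i))
  = h^-1 *: (((fun r : R => w (x + r *: basis_rV i)) \o shift s) (h *: 1) -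
     w (x + s *: basis_rV i)) :> R.
Proof.
by rewrite /= [h *: 1]mulr1 scalerDl addrCA.
Qed.

Lemma derivable_line w x i (s : R) : smooth w ->
  derivable (fun r : R => w (x + r *: basis_rV i)) s 1.
Proof.
move=> sw; have := @smooth_derivable w (x + s *: basis_rV i) i sw.
by rewrite /derivable; under eq_fun do rewrite line_quotient.
Qed.

Lemma derive1_line w x i (s : R) :
  derive1 (fun r : R => w (x + r *: basis_rV i)) s = pderiv i w (x + s *: basis_rV i).
Proof.
rewrite derive1E /pderiv /derive.
set f := (X in _ = lim (X @ _)); set h := (X in lim (X @ _) = _).
by have -> : f = h by apply/funext => r; exact: line_quotient.
Qed.

Lemma continuous_line (f : 'rV[R]_n -> R) x i : continuous f ->
  continuous (fun r : R => f (x + r *: basis_rV i)).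
Proof.
move=> cf r.
have h : x + s *: basis_rV i @[s --> r] --> x + r *: basis_rV i.
  by apply: cvgD; [exact: cvg_cst|exact: scalel_continuous].
exact: (cvg_comp _ _ h (cf _)).
Qed.

Lemma line_FTC w x i (a b : R) : smooth w -> a < b ->
  (\int[leb1]_(s in `[a, b]) (pderiv i w (x + s *: basis_rV i))%:E =
   (w (x + b *: basis_rV i))%:E - (w (x + a *: basis_rV i))%:E)%E.
Proof.
move=> sw ab.
have cl := @continuous_line _ x i (smooth_continuous sw).
apply: (@continuous_FTC2 _ _ (fun r : R => w (x + r *: basis_rV i))) => //.
- apply: continuous_subspaceT; apply: continuous_line.
  exact: smooth_pderiv_continuous.
- split => [s _| |]; first exact: derivable_line.
  + by apply: cvg_at_right_filter; exact: cl.
  + by apply: cvg_at_left_filter; exact: cl.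
- by move=> s _; rewrite derive1_line.
Qed.

(** Cauchy-Schwarz against the constant 1, from the nonnegativity of the integral of [(f + s)^2] for
    all [s]. *)
Lemma itv_cauchy_schwarz (f : R -> R) (a b : R) : a < b -> continuous f ->
  (\int[leb1]_(s in `[a, b]) f s) ^+ 2 <=
  (b - a) * \int[leb1]_(s in `[a, b]) (f s ^+ 2).
Proof.
move=> ab cf; rewrite mulrC.
have intc (h : R -> R) : continuous h -> leb1.-integrable `[a, b] (EFin \o h).
  move=> ch; apply: continuous_compact_integrable; first exact: segment_compact.
  exact: continuous_subspaceT.
have cf2 : continuous (fun s => f s ^+ 2).
  by move=> s; exact: (cvg_comp _ _ (cf s) (@exprn_continuous _ 2 _)).
have mab : measurable `[a, b] by exact: measurable_itv.
have fab : fine (leb1 `[a, b]) = b - a.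
  by rewrite lebesgue_measure_itv/= lte_fin ab.
apply: quadratic_ge0 => [||s].
- by apply: Rintegral_ge0 => *; exact: sqr_ge0.
- by rewrite subr_ge0 ltW.
have -> : \int[leb1]_(t in `[a, b]) (f t ^+ 2) + 2 * s * \int[leb1]_(t in `[a, b]) f t +
    s ^+ 2 * (b - a) = \int[leb1]_(t in `[a, b]) ((f t + s) ^+ 2).
  rewrite -fab -Rintegral_cst// -RintegralZl//; last exact: intc.
  have c1 : continuous (fun t => 2 * s * f t).
    by move=> t; apply: cvgM; [exact: cvg_cst|exact: cf].
  rewrite -RintegralD//; [|exact: intc|exact: intc].
  rewrite -RintegralD//; last 2 first.
  - by apply: intc => t; apply: cvgD; [exact: cf2|exact: c1].
  - by apply: intc => t; exact: cvg_cst.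
  by apply: eq_Rintegral => t _; ring.
by apply: Rintegral_ge0 => *; exact: sqr_ge0.
Qed.

Lemma line_diff_sq w x i (a b : R) : smooth w -> a < b ->
  (((w (x + b *: basis_rV i) - w (x + a *: basis_rV i)) ^+ 2)%:E <=
   (b - a)%:E * \int[leb1]_(s in `[a, b]) ((pderiv i w (x + s *: basis_rV i)) ^+ 2)%:E)%E.
Proof.
move=> sw ab; have cd := @continuous_line _ x i (smooth_pderiv_continuous (i := i) sw).
have c2 : continuous (fun s : R => pderiv i w (x + s *: basis_rV i) ^+ 2).
  by move=> s; exact: (cvg_comp _ _ (cd s) (@exprn_continuous _ 2 _)).
have i2 : leb1.-integrable `[a, b] (EFin \o fun s : R => pderiv i w (x + s *: basis_rV i) ^+ 2).
  apply: continuous_compact_integrable; first exact: segment_compact.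
  exact: continuous_subspaceT.
have := itv_cauchy_schwarz ab cd; rewrite /Rintegral line_FTC// => h.
rewrite -[X in (_ <= _ * X)%E]fineK; last exact: integrable_fin_num.
by rewrite -EFinM lee_fin.
Qed.

End smooth_functions.

(** * Slicing the unit cell *)

Section cell_slices.
Context {R : realType}.
Notation leb1 := (@lebesgue_measure R).
Notation I01 := (`]0%R, 1%R[%classic : set R).

Lemma cell_cons n (t : R) (v : 'rV[R]_n) :
  cell (cons_rV (t, v)) <-> I01 t /\ cell v.
Proof.
rewrite /= in_itv/=; split => [h|[h1 h2] i].
  split; first by have := h ord0; rewrite mxE unlift_none.
  by move=> i; have := h (lift ord0 i); rewrite mxE liftK.
by rewrite mxE; case: unliftP => [j _|_] /=; [exact: h2|].
Qed.

Lemma restrict_cell_cons n (f : 'rV[R]_n.+1 -> \bar R) (t : R) (v : 'rV[R]_n) :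
  (f \_ cell) (cons_rV (t, v)) =
  if t \in I01 then ((fun v => f (cons_rV (t, v))) \_ cell) v else 0%E.
Proof.
rewrite /patch; have := cell_cons t v.
case: (boolP (cons_rV (t, v) \in cell)) => [/set_mem h1|/negP h1].
  by move=> [/(_ h1)[h2 h3] _]; rewrite !mem_set.
case: (boolP (t \in I01)) => [/set_mem h2|//] [_ h3].
case: ifPn => // /set_mem h4; exfalso; apply: h1; apply: mem_set.
exact: h3.
Qed.

Section nonnegative.
Variables (n : nat) (f : 'rV[R]_n.+1 -> \bar R).
Hypotheses (mf : measurable_fun setT f) (f0 : forall x, (0 <= f x)%E).

Let mfc : measurable_fun setT (f \_ cell).
Proof.
by apply: (measurable_restrictT f (@measurable_cell R n.+1)).1; exact: measurable_funTS.
Qed.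

Let fc0 x : (0 <= (f \_ cell) x)%E.
Proof. by rewrite /patch; case: ifP. Qed.

Lemma integral_cell_cons1 :
  (\int[lebesgue_rV n.+1]_(x in cell) f x =
   \int[leb1]_(t in I01) \int[lebesgue_rV n]_(v in cell) f (cons_rV (t, v)))%E.
Proof.
rewrite integral_mkcond ge0_integral_cons1// [RHS]integral_mkcond.
apply: eq_integral => t _.
under eq_integral do rewrite restrict_cell_cons.
rewrite [RHS]/patch; case: ifPn => _; last by rewrite integral0.
by rewrite [RHS]integral_mkcond.
Qed.

Lemma integral_cell_cons2 :
  (\int[lebesgue_rV n.+1]_(x in cell) f x =
   \int[lebesgue_rV n]_(v in cell) \int[leb1]_(t in I01) f (cons_rV (t, v)))%E.
Proof.
rewrite integral_mkcond ge0_integral_cons2// [RHS]integral_mkcond.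
apply: eq_integral => v _.
under eq_integral do rewrite restrict_cell_cons.
rewrite [RHS]/patch; case: ifPn => vc.
  rewrite [RHS]integral_mkcond; apply: eq_integral => t _.
  by rewrite /patch vc.
rewrite -[RHS](integral0 leb1 setT); apply: eq_integral => t _.
by rewrite /patch (negbTE vc) if_same.
Qed.

Lemma measurable_slice1 (t : R) : measurable_fun setT (fun v => f (cons_rV (t, v))).
Proof.
apply: (measurableT_comp mf); apply: measurableT_comp; first exact: measurable_cons_rV.
exact: measurable_pair1.
Qed.

Lemma measurable_slice2 (v : 'rV[R]_n) : measurable_fun setT (fun t => f (cons_rV (t, v))).
Proof.
apply: (measurableT_comp mf); apply: measurableT_comp; first exact: measurable_cons_rV.
exact: measurable_pair2.
Qed.

Lemma measurable_cell_integral1 : measurable_fun I01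
  (fun t => \int[lebesgue_rV n]_(v in cell) f (cons_rV (t, v)))%E.
Proof.
have := @measurable_fun_fubini_tonelli_F _ _ _ _ R (lebesgue_rV n) _
  (measurable_comp_cons mfc) (fun=> fc0 _).
move=> /(measurable_funTS (D := I01)); apply: eq_measurable_fun => t tI.
rewrite /fubini_F /comp; under eq_integral do rewrite restrict_cell_cons tI.
by rewrite [RHS]integral_mkcond.
Qed.

Lemma measurable_cell_integral2 : measurable_fun cell
  (fun v => \int[leb1]_(t in I01) f (cons_rV (t, v)))%E.
Proof.
have := @measurable_fun_fubini_tonelli_G _ _ _ _ R leb1 _
  (measurable_comp_cons mfc) (fun=> fc0 _).
move=> /(measurable_funTS (D := cell)); apply: eq_measurable_fun => v vc.
rewrite /fubini_G /comp; under eq_integral do rewrite restrict_cell_cons.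
rewrite [RHS]integral_mkcond; apply: eq_integral => t _.
by rewrite /patch vc.
Qed.

End nonnegative.

Definition upd n (x : 'rV[R]_n) (i : 'I_n) (s : R) : 'rV[R]_n :=
  \row_j (if j == i then s else x ord0 j).

Lemma upd_cons0 n (t s : R) (v : 'rV[R]_n) :
  upd (cons_rV (t, v)) ord0 s = cons_rV (s, v).
Proof.
apply/rowP => j; rewrite !mxE; case: unliftP => [k ->|->] /=.
  by [].
by rewrite ?eqxx.
Qed.

Lemma upd_cons_lift n (t s : R) (v : 'rV[R]_n) (i : 'I_n) :
  upd (cons_rV (t, v)) (lift ord0 i) s = cons_rV (t, upd v i s).
Proof.
apply/rowP => j; rewrite !mxE; case: unliftP => [k ->|->] /=.
  by rewrite (inj_eq lift_inj) mxE.
by rewrite ?(negbTE (neq_lift _ _)).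
Qed.

Lemma cell_upd n (x : 'rV[R]_n) i (s : R) : cell x -> 0 < s < 1 -> cell (upd x i s).
Proof. by move=> cx s01 j; rewrite mxE; case: ifP. Qed.

(** On a set of mass one the integral is a mean: if every value exceeded it by [e], the mean would
    exceed itself. An infinite mean puts no constraint on [t]. *)
Lemma mean_le_value d (T : measurableType d) (m : {measure set T -> \bar R})
  (D : set T) (h : T -> \bar R) (e : R) : measurable D -> m D = 1%E ->
  measurable_fun D h -> (forall t, D t -> (0 <= h t)%E) -> 0 < e ->
  exists2 t, D t & (h t <= \int[m]_(t in D) h t + e%:E)%E.
Proof.
move=> mD m1 mh h0 e0; apply: contrapT => nex.
set M := (\int[m]_(t in D) h t)%E.
have hM t : D t -> (M + e%:E <= h t)%E.
  move=> Dt; rewrite leNgt; apply/negP => ht; apply: nex; exists t => //.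
  exact: ltW.
have M0 : (0 <= M)%E by exact: integral_ge0.
have : (M + e%:E <= M)%E.
  rewrite -[leLHS]mule1 -m1 -integral_cst//.
  by apply: ge0_le_integral => // t _; rewrite adde_ge0// lee_fin ltW.
have [Moo|Mfin] := eqVneq M +oo%E.
  have [t Dt] : exists t, D t.
    apply: contrapT => nD; move: m1; rewrite (_ : D = set0) ?measure0.
      by move=> /eqP; rewrite eqe eq_sym oner_eq0.
    by apply/seteqP; split => // t Dt; apply: nD; exists t.
  by exfalso; apply: nex; exists t => //; rewrite -/M Moo addye// leey.
have Mf : M \is a fin_num by rewrite ge0_fin_numE// ltey.
by rewrite -(fineK Mf) -EFinD lee_fin gerDl leNgt e0.
Qed.

(* The cube has side one, so a function varies along each line by at most its
   Dirichlet energy on that line; the point [y] is found by induction on [n]. *)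
Lemma cell_poincare n (f : 'rV[R]_n -> R) (g : 'I_n -> 'rV[R]_n -> R) (e : R) :
  measurable_fun setT f -> (forall i, measurable_fun setT (g i)) ->
  (forall i x, 0 <= g i x) ->
  (forall i x (s : R), cell x -> (0 < s < 1)%R ->
    ((f x - f (upd x i s)) ^+ 2)%:E <=
      \int[leb1]_(r in I01) (g i (upd x i r))%:E)%E -> 0 < e ->
  exists y, (\int[lebesgue_rV n]_(x in cell) ((f x - f y) ^+ 2)%:E <=
    (2 ^+ n)%:E * \sum_i \int[lebesgue_rV n]_(x in cell) (g i x)%:E + e%:E)%E.
Proof.
elim: n f g e => [|n IH] f g e mf mg g0 fg e0.
  exists 0; rewrite big_ord0 mule0 add0e.
  rewrite (eq_integral (fun=> 0%E)); last first.
    by move=> x _; rewrite (_ : x = 0) ?subrr ?expr0n//; apply/rowP => -[].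
  by rewrite integral0 lee_fin ltW.
have mEg i : measurable_fun setT (fun x => (g i x)%:E) by exact/measurable_EFinP.
have Eg0 i x : (0 <= (g i x)%:E)%E by rewrite lee_fin.
pose h (b : R) := (\sum_(i < n) \int[lebesgue_rV n]_(v in cell) (g (lift ord0 i) (cons_rV (b, v)))%:E)%E.
have h0 b : (0 <= h b)%E by apply: sume_ge0 => i _; exact: integral_ge0.
have mh : measurable_fun I01 h.
  apply: emeasurable_sum => i.
  exact: (measurable_cell_integral1 (mEg (lift ord0 i)) (Eg0 (lift ord0 i))).
have m01 : leb1 I01 = 1%E by rewrite lebesgue_measure_itv/= lte_fin ltr01 oppr0 adde0.
have c0 : 0 < 2 ^+ n :> R by rewrite exprn_gt0.
(* A slice on which the energy in the remaining directions is at most average. The slack is divided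
   by [2^n] because the induction hypothesis multiplies it by that factor. *)
have [b bI hb] : exists2 b, I01 b & (h b <= \int[leb1]_(t in I01) h t + (e / 4 / 2 ^+ n)%:E)%E.
  by apply: (@mean_le_value _ _ leb1 I01 h (e / 4 / 2 ^+ n)) => //; rewrite !divr_gt0.
have Ih : (\int[leb1]_(t in I01) h t =
    \sum_(i < n) \int[lebesgue_rV n.+1]_(x in cell) (g (lift ord0 i) x)%:E)%E.
  rewrite ge0_integral_sum//; last 2 first.
  - move=> i; exact: (measurable_cell_integral1 (mEg (lift ord0 i)) (Eg0 (lift ord0 i))).
  - by move=> i t _; exact: integral_ge0.
  by apply: eq_bigr => i _; rewrite integral_cell_cons1.
have [|||||w hw] := IH (fun v => f (cons_rV (b, v))) (fun i v => g (lift ord0 i) (cons_rV (b, v))) (e / 4).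
- by apply/measurable_EFinP; apply: (measurable_slice1 (f := EFin \o f)); exact/measurable_EFinP.
- by move=> i; apply/measurable_EFinP; exact: (measurable_slice1 (mEg (lift ord0 i))).
- by move=> i x; exact: g0.
- move=> i x s cx s01; have := fg (lift ord0 i) (cons_rV (b, x)) s.
  rewrite upd_cons_lift => /(_ _ s01); under eq_integral do rewrite upd_cons_lift.
  by apply; exact/cell_cons.
- by rewrite divr_gt0.
exists (cons_rV (b, w)).
(* The difference is split at the projection of [x] to the slice [b]: one move along the first
   direction, then one inside the slice. *)
pose K1 x := ((f x - f (upd x ord0 b)) ^+ 2)%:E.
pose K2 x := ((f (upd x ord0 b) - f (cons_rV (b, w))) ^+ 2)%:E.
have mupd : measurable_fun setT (fun x : 'rV[R]_n.+1 => f (upd x ord0 b)).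
  apply: (measurableT_comp mf); apply: measurable_to_rV => i.
  under eq_fun do rewrite mxE.
  by case: eqP => _; [exact: measurable_cst|exact: measurable_coord].
have mK1 : measurable_fun setT K1.
  by apply/measurable_EFinP; apply: measurable_funX; exact: measurable_funB.
have mK2 : measurable_fun setT K2.
  by apply/measurable_EFinP; apply: measurable_funX; apply: measurable_funB => //; exact: measurable_cst.
have K10 x : (0 <= K1 x)%E by rewrite lee_fin sqr_ge0.
have K20 x : (0 <= K2 x)%E by rewrite lee_fin sqr_ge0.
have IK1 : (\int[lebesgue_rV n.+1]_(x in cell) K1 x <=
    \int[lebesgue_rV n.+1]_(x in cell) (g ord0 x)%:E)%E.
  rewrite (integral_cell_cons2 mK1 K10) (integral_cell_cons2 (mEg ord0) (Eg0 ord0)).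
  apply: ge0_le_integral => //.
  - exact: measurable_cell.
  - by move=> v _; exact: integral_ge0.
  - exact: (measurable_cell_integral2 mK1 K10).
  - exact: (measurable_cell_integral2 (mEg ord0) (Eg0 ord0)).
  move=> v cv.
  rewrite -[leRHS]mule1 -m01 -integral_cst//.
  apply: ge0_le_integral => //.
  - exact: measurable_funTS (measurable_slice2 mK1 v).
  - move=> t tI; have := fg ord0 (cons_rV (t, v)) b.
    rewrite /K1 => /(_ _ _); under eq_integral do rewrite upd_cons0.
    by apply; [exact/cell_cons|move: bI; rewrite /= in_itv].
have IK2 : (\int[lebesgue_rV n.+1]_(x in cell) K2 x <=
    (2 ^+ n)%:E * (\sum_(i < n) \int[lebesgue_rV n.+1]_(x in cell) (g (lift ord0 i) x)%:E) + (e / 2)%:E)%E.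
  rewrite (integral_cell_cons1 mK2 K20) /K2.
  set Z := (\int[lebesgue_rV n]_(x in cell) _)%E in hw.
  rewrite (eq_integral (cst Z)); last first.
    by move=> t _; apply: eq_integral => v _; rewrite upd_cons0.
  rewrite integral_cst; last exact: measurable_itv.
  rewrite [X in (_ * X)%E]m01 mule1.
  apply: (le_trans hw).
  apply: (@le_trans _ _ ((2 ^+ n)%:E * (\int[leb1]_(t in I01) h t + (e / 4 / 2 ^+ n)%:E) + (e / 4)%:E)%E).
    by rewrite leeD2r// lee_pmul2l.
  rewrite Ih ge0_muleDr ?lee_fin ?divr_ge0 ?(ltW e0) ?(ltW c0)//; last first.
    by apply: sume_ge0 => i _; exact: integral_ge0.
  rewrite -EFinM mulrC divfK ?gt_eqF// -addeA -EFinD leeD2l// lee_fin; lra.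
(* From [(p - r)^2 <= 2 (p - q)^2 + 2 (q - r)^2]: one doubling per dimension, hence the constant
   [2^n]. *)
have e1 : (\int[lebesgue_rV n.+1]_(x in cell) ((f x - f (cons_rV (b, w))) ^+ 2)%:E <=
   2%:E * (\int[lebesgue_rV n.+1]_(x in cell) K1 x + \int[lebesgue_rV n.+1]_(x in cell) K2 x))%E.
  rewrite -ge0_integralD//; [|exact: measurable_cell|exact: measurable_funTS|exact: measurable_funTS].
  rewrite -ge0_integralZl//; last 3 first.
  - exact: measurable_cell.
  - by apply: emeasurable_funD; exact: measurable_funTS.
  - by move=> x _; exact: adde_ge0.
  apply: ge0_le_integral => //.
  - exact: measurable_cell.
  - by move=> x _; rewrite lee_fin sqr_ge0.
  - apply/measurable_EFinP; apply: measurable_funX; apply: measurable_funB.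
      exact: measurable_funTS.
    exact: measurable_cst.
  - apply: emeasurable_funM; first exact: measurable_cst.
    by apply: emeasurable_funD; exact: measurable_funTS.
  move=> x _; rewrite /K1 /K2 -EFinD -EFinM lee_fin.
  move: (f x) (f (upd x ord0 b)) (f (cons_rV (b, w))) => p q r.
  have := sqr_ge0 ((p - q) - (q - r)); nra.
apply: (le_trans e1).
apply: (le_trans (lee_wpmul2l _ (leeD IK1 IK2))); first by rewrite lee_fin.
rewrite big_ord_recl.
set A := (\int[_]_(x in cell) _)%E; set B := (\sum_(i < n) _)%E.
have A0 : (0 <= A)%E by exact: integral_ge0.
have B0 : (0 <= B)%E by apply: sume_ge0 => i _; exact: integral_ge0.
move: A B A0 B0 => A B A0 B0.
have c1 : 1 <= 2 ^+ n :> R by rewrite exprn_ege1//; lra.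
rewrite !ge0_muleDr ?adde_ge0 ?mule_ge0 ?lee_fin ?exprn_ge0 ?divr_ge0 ?(ltW e0)//.
rewrite muleA -!EFinM -exprS addeA (_ : 2 * (e / 2) = e); last by field.
rewrite leeD2r// leeD2r// lee_wpmul2r// lee_fin exprS; lra.
Qed.

End cell_slices.

Section cell_smooth.
Context {R : realType}.
Notation leb1 := (@lebesgue_measure R).
Notation I01 := (`]0%R, 1%R[%classic : set R).

(** Tonelli, peeling off coordinates until direction [i] comes first. The cell and its slices have
    mass one, so a constant line integral is the whole integral. *)
Lemma cell_integral_line n (f : 'rV[R]_n -> \bar R) i (c : \bar R) :
  measurable_fun setT f -> (forall x, (0 <= f x)%E) ->
  (forall x, cell x -> \int[leb1]_(r in I01) f (upd x i r) = c)%E ->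
  (\int[lebesgue_rV n]_(x in cell) f x = c)%E.
Proof.
elim: n f i => [|n IH] f i mf f0 fc; first by case: i fc.
have m01 : leb1 I01 = 1%E by rewrite lebesgue_measure_itv/= lte_fin ltr01 oppr0 adde0.
(* A dummy first coordinate, which [upd] overwrites. *)
have h01 : I01 2^-1 by rewrite /= in_itv/=; apply/andP; split; lra.
case: (unliftP ord0 i) fc => [j ->|->] fc.
  rewrite (integral_cell_cons1 mf f0) (eq_integral (cst c)).
    by rewrite integral_cst; [rewrite [X in (_ * X)%E]m01 mule1|exact: measurable_itv].
  move=> t /set_mem tI; apply: (IH (fun v => f (cons_rV (t, v))) j).
  - exact: measurable_slice1.
  - by move=> v.
  - move=> v cv; rewrite -[RHS](fc (cons_rV (t, v))); last exact/cell_cons.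
    by apply: eq_integral => r _; rewrite upd_cons_lift.
rewrite (integral_cell_cons2 mf f0) (eq_integral (cst c)).
  by rewrite integral_cst; [rewrite [X in (_ * X)%E]lebesgue_cell mule1|exact: measurable_cell].
move=> v /set_mem cv; rewrite -[RHS](fc (cons_rV (2^-1, v))); last exact/cell_cons.
by apply: eq_integral => r _; rewrite upd_cons0.
Qed.

Context {n : nat}.
Implicit Types (w f : 'rV[R]_n -> R) (x : 'rV[R]_n).

Lemma continuous_compact_bounded (K : set 'rV[R]_n) f : compact K -> continuous f ->
  exists2 M, 0 <= M & forall x, K x -> `|f x| <= M.
Proof.
move=> cK cf.
have : compact (f @` K).
  by apply: continuous_compact => //; exact: continuous_subspaceT.
move/compact_bounded => [M [Mr h]].
exists (`|M| + 1); first by rewrite addr_ge0.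
move=> x Kx; apply: (h (`|M| + 1)); last by exists x.
by rewrite (le_lt_trans (ler_norm M))// ltrDl.
Qed.

Lemma continuous_cell_bounded f : continuous f ->
  exists2 M, 0 <= M & forall x, cell x -> `|f x| <= M.
Proof.
move=> cf; have := @rV_compact R n (fun=> `[0, 1]%classic) (fun=> @segment_compact _ _ _).
move=> /continuous_compact_bounded /(_ cf)[M M0 h]; exists M => // x cx.
by apply: h => i /=; rewrite in_itv/=; have /andP[h1 h2] := cx i; rewrite !ltW.
Qed.

Lemma bounded_sqint (D : set 'rV[R]_n) f (M : R) : measurable D ->
  (lebesgue_rV n D < +oo)%E -> measurable_fun D f -> (forall x, D x -> `|f x| <= M) ->
  sqint (lebesgue_rV n) D f.
Proof.
move=> mD D1 mf fM; split => //.
apply: (@le_lt_trans _ _ (\int[lebesgue_rV n]_(x in D) (cst (M ^+ 2)%:E) x)%E).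
  apply: ge0_le_integral => //.
  - by move=> x _; rewrite lee_fin sqr_ge0.
  - by apply/measurable_EFinP; exact: measurable_funX.
  - by move=> x Dx; rewrite lee_fin -[leLHS]real_normK ?num_real// lerXn2r ?nnegrE ?(le_trans _ (fM x Dx))// fM.
by rewrite integral_cst// lte_mul_pinfty// lee_fin sqr_ge0.
Qed.

Lemma continuous_cell_sqint f : continuous f -> sqint (lebesgue_rV n) cell f.
Proof.
move=> cf; have [M _ fM] := continuous_cell_bounded cf.
apply: bounded_sqint fM; first exact: measurable_cell.
- by rewrite [X in (X < _)%E]lebesgue_cell ltry.
- by apply: measurable_funTS; exact: continuous_measurable_rV.
Qed.

Lemma upd_line x i (s : R) : upd x i s = upd x i 0 + s *: basis_rV i.
Proof.
apply/rowP => j; rewrite !mxE eqxx/=; case: eqVneq => _.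
  by rewrite add0r mulr1.
by rewrite mulr0 addr0.
Qed.

Lemma upd_id x i : upd x i (x ord0 i) = x.
Proof. by apply/rowP => j; rewrite mxE; case: eqP => [->|]. Qed.

Lemma measurable_line (f : 'rV[R]_n -> R) x i : continuous f ->
  measurable_fun setT (fun r : R => f (upd x i r)).
Proof.
move=> cf; under eq_fun do rewrite upd_line.
by apply: continuous_measurable_fun; exact: continuous_line.
Qed.

(** Newton-Leibniz and Cauchy-Schwarz on a segment of length at most 1. This is the hypothesis that
    [cell_poincare] puts on lines. *)
Lemma smooth_cell_line w i x (s : R) : smooth w -> cell x -> 0 < s < 1 ->
  (((w x - w (upd x i s)) ^+ 2)%:E <=
   \int[leb1]_(r in I01) ((pderiv i w (upd x i r)) ^+ 2)%:E)%E.
Proof.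
move=> sw cx s01; set z := upd x i 0.
have mp : measurable_fun setT (fun r : R => ((pderiv i w (upd x i r)) ^+ 2)%:E).
  apply/measurable_EFinP; apply: measurable_funX; apply: measurable_line.
  exact: smooth_pderiv_continuous.
have main (a b : R) : 0 < a -> a < b -> b < 1 ->
    (((w (upd x i b) - w (upd x i a)) ^+ 2)%:E <=
     \int[leb1]_(r in I01) ((pderiv i w (upd x i r)) ^+ 2)%:E)%E.
  move=> a0 ab b1; rewrite (upd_line x i a) (upd_line x i b).
  apply: (le_trans (line_diff_sq _ _ sw ab)).
  apply: (@le_trans _ _ (1 * \int[leb1]_(s in `[a, b]) ((pderiv i w (z + s *: basis_rV i)) ^+ 2)%:E)%E).
    apply: lee_wpmul2r; last by rewrite lee_fin; lra.
    by apply: integral_ge0 => r _; rewrite lee_fin sqr_ge0.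
  rewrite mul1e; under eq_integral do rewrite -upd_line.
  apply: ge0_subset_integral => //.
  - exact: measurable_funTS.
  - by move=> r _; rewrite lee_fin sqr_ge0.
  - by move=> r /=; rewrite !in_itv/= => /andP[h1 h2]; apply/andP; split; lra.
have /andP[x0 x1] := cx i; have /andP[s0 s1] := s01.
rewrite -{1}(upd_id x i).
have [xs|sx|<-] := ltgtP (x ord0 i) s.
- rewrite -sqrrN opprB; exact: main.
- exact: main.
- by rewrite subrr expr0n/=; apply: integral_ge0 => r _; rewrite lee_fin sqr_ge0.
Qed.

(** [cell_poincare] bounds the distance of [w] to the constant [w y]. For mean zero on a set of mass
    one, the integral of [(w - w y)^2] is that of [w^2] plus [(w y)^2], so the bound holds for [w]
    itself. *)
Lemma smooth_cell_poincare w : smooth w -> \int[lebesgue_rV n]_(x in cell) w x = 0 ->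
  nrm2 (lebesgue_rV n) cell w <=
  2 ^+ n * \sum_i nrm2 (lebesgue_rV n) cell (pderiv i w).
Proof.
move=> sw w0; apply/ler_addgt0Pr => e e0.
have mc := @measurable_cell R n.
have [|||||y] := @cell_poincare R n w (fun i x => pderiv i w x ^+ 2) e.
- exact: smooth_measurable.
- by move=> i; apply: measurable_funX; exact: smooth_pderiv_measurable.
- by move=> i x; exact: sqr_ge0.
- by move=> i x s cx s01; exact: smooth_cell_line.
- by [].
have sp i : sqint (lebesgue_rV n) cell (pderiv i w).
  by apply: continuous_cell_sqint; exact: smooth_pderiv_continuous.
have cw := smooth_continuous sw.
have sqw : sqint (lebesgue_rV n) cell w by exact: continuous_cell_sqint.
have sqc (c : R) : sqint (lebesgue_rV n) cell (fun=> c).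
  by apply: continuous_cell_sqint; exact: cst_continuous.
have -> : (\sum_i \int[lebesgue_rV n]_(x in cell) (pderiv i w x ^+ 2)%:E =
    (\sum_i nrm2 (lebesgue_rV n) cell (pderiv i w))%:E)%E.
  by rewrite -sumEFin; apply: eq_bigr => i _; rewrite EFin_nrm2.
rewrite (EFin_nrm2 mc (sqintB mc sqw (sqc (w y)))) -EFinM -EFinD lee_fin; apply: le_trans.
rewrite /nrm2.
have I2 := ((sqintP _ _ _).1 sqw).2.
have Iw : (lebesgue_rV n).-integrable cell (EFin \o w).
  have := sqint_prod mc sqw (sqc 1); apply: eq_integrable => // x _ /=.
  by rewrite mulr1.
have Ic (c : R) : (lebesgue_rV n).-integrable cell (EFin \o (fun=> c)).
  have := sqint_prod mc (sqc c) (sqc 1); apply: eq_integrable => // x _ /=.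
  by rewrite mulr1.
have IZ (c : R) : (lebesgue_rV n).-integrable cell (EFin \o (fun x => c * w x)).
  by have := integrableZl mc c Iw; apply: eq_integrable.
have -> : \int[lebesgue_rV n]_(x in cell) ((w x - w y) ^+ 2) =
    \int[lebesgue_rV n]_(x in cell) (w x ^+ 2 + ((- 2 * w y) * w x + w y ^+ 2)).
  by apply: eq_Rintegral => x _; ring.
rewrite RintegralD//; last first.
  by have := integrableD mc (IZ (- 2 * w y)) (Ic (w y ^+ 2)); apply: eq_integrable.
rewrite RintegralD// RintegralZl// w0 mulr0 add0r Rintegral_cst//.
by rewrite [X in fine X]lebesgue_cell mulr1 lerDl sqr_ge0.
Qed.

(** On each line the derivative integrates to the difference of the end values, which periodicity
    makes zero. *)
Lemma periodic_pderiv_mean w i : smooth w -> cell_periodic w ->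
  \int[lebesgue_rV n]_(x in cell) pderiv i w x = 0.
Proof.
move=> sw pw; have mc := @measurable_cell R n.
have cp := @smooth_pderiv_continuous _ _ w i sw.
have [M M0 pM] := continuous_cell_bounded cp.
pose p := pderiv i w.
(* [cell_integral_line] asks for nonnegativity everywhere: [p] is shifted by its bound [M] on the
   cell, and truncated at 0 for the points outside. *)
pose f x : \bar R := (Num.max (p x + M) 0)%:E.
have fp x : cell x -> f x = (p x + M)%:E.
  move=> cx; rewrite /f max_l//; have := pM x cx; rewrite ler_norml -/p; lra.
have mf : measurable_fun setT f.
  apply/measurable_EFinP; apply: measurable_maxr; last exact: measurable_cst.
  by apply: measurable_funD; [exact: smooth_pderiv_measurable|exact: measurable_cst].
have f0 x : (0 <= f x)%E by rewrite lee_fin le_max lexx orbT.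
have If : (\int[lebesgue_rV n]_(x in cell) f x = M%:E)%E.
  apply: (@cell_integral_line n f i) => // x cx.
  have cl : continuous (fun r : R => p (upd x i 0 + r *: basis_rV i)).
    exact: continuous_line.
  transitivity (\int[leb1]_(r in I01) (p (upd x i 0 + r *: basis_rV i) + M)%:E)%E.
    apply: eq_integral => r /set_mem rI; rewrite -upd_line fp//; apply: cell_upd => //.
  have mcl : measurable_fun setT (fun r : R => p (upd x i 0 + r *: basis_rV i) + M).
    apply: measurable_funD; last exact: measurable_cst.
    exact: continuous_measurable_fun.
  rewrite integral_itv_obnd_cbnd; last by apply/measurable_EFinP; apply: measurable_funTS.
  rewrite integral_itv_bndo_bndc; last by apply/measurable_EFinP; apply: measurable_funTS.
  under eq_integral do rewrite EFinD.
  rewrite integralD_EFin; last 3 first.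
  - exact: measurable_itv.
  - apply: continuous_compact_integrable; first exact: segment_compact.
    exact: continuous_subspaceT.
  - apply: continuous_compact_integrable; first exact: segment_compact.
    by apply: continuous_subspaceT; exact: cst_continuous.
  rewrite line_FTC// scale1r scale0r addr0 pw subee// add0e.
  rewrite integral_cst; last exact: measurable_itv.
  have mcc : leb1 `[0%R, 1%R]%classic = 1%E.
    by rewrite lebesgue_measure_itv/= lte_fin ltr01 oppr0 adde0.
  by rewrite [X in (_ * X)%E]mcc mule1.
have sqp : sqint (lebesgue_rV n) cell p by exact: continuous_cell_sqint.
have sqc (c : R) : sqint (lebesgue_rV n) cell (fun=> c).
  by apply: continuous_cell_sqint; exact: cst_continuous.
have Ip : (lebesgue_rV n).-integrable cell (EFin \o p).
  have := sqint_prod mc sqp (sqc 1); apply: eq_integrable => // x _ /=.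
  by rewrite mulr1.
have Ic (c : R) : (lebesgue_rV n).-integrable cell (EFin \o (fun=> c)).
  have := sqint_prod mc (sqc c) (sqc 1); apply: eq_integrable => // x _ /=.
  by rewrite mulr1.
have : \int[lebesgue_rV n]_(x in cell) (p x + M) = M.
  rewrite /Rintegral (eq_integral f) ?If// => x /set_mem cx.
  by rewrite fp.
rewrite RintegralD// Rintegral_cst// [X in fine X]lebesgue_cell mulr1.
by move=> h; apply: (@addIr _ M); rewrite add0r.
Qed.

End cell_smooth.

(** * Convergence and completeness for the squared norm *)

Section nrm2_theory.
Context d (T : measurableType d) (R : realType) (mu : {measure set T -> \bar R}).
Variables (D : set T) (mD : measurable D).
Implicit Types f g : T -> R.
Notation sq := (sqint mu D).
Notation nr := (nrm2 mu D).

(** [nrm2] is a squared norm, so this bound with its factors 2 takes the place of the triangle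
    inequality here and below. *)
Lemma nrm2D_le f g (a : R) : sq f -> sq g ->
  nr (fun x => f x + a * g x) <= 2 * nr f + 2 * a ^+ 2 * nr g.
Proof.
move=> sf sg; have [_ If] := (sqintP _ _ _).1 sf; have [_ Ig] := (sqintP _ _ _).1 sg.
have [_ Ifg] := (sqintP _ _ _).1 (sqintD mD a sf sg).
have I2f : mu.-integrable D (EFin \o (fun x => 2 * f x ^+ 2)).
  by have := integrableZl mD 2 If; apply: eq_integrable.
have I2g : mu.-integrable D (EFin \o (fun x => 2 * a ^+ 2 * g x ^+ 2)).
  by have := integrableZl mD (2 * a ^+ 2) Ig; apply: eq_integrable.
rewrite /nrm2 -RintegralZl// -[X in _ <= _ + X]RintegralZl// -RintegralD//.
apply: le_Rintegral => //.
  by have := integrableD mD I2f I2g; apply: eq_integrable.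
move=> x _; rewrite -subr_ge0; have := sqr_ge0 (f x - a * g x); congr (0 <= _).
by ring.
Qed.

Lemma nrm2B_le f g : sq f -> sq g ->
  nr (fun x => f x - g x) <= 2 * nr f + 2 * nr g.
Proof.
move=> sf sg; have := nrm2D_le (-1) sf sg.
rewrite sqrrN expr1n mulr1; apply: le_trans; rewrite le_eqVlt; apply/orP; left.
by apply/eqP; apply: eq_Rintegral => x _; rewrite mulN1r.
Qed.

Lemma nrm2_triangle f g h : sq f -> sq g -> sq h ->
  nr (fun x => f x - h x) <= 2 * nr (fun x => f x - g x) + 2 * nr (fun x => h x - g x).
Proof.
move=> sf sg sh.
have := nrm2B_le (sqintB mD sf sg) (sqintB mD sh sg).
apply: le_trans; rewrite le_eqVlt; apply/orP; left.
by apply/eqP; apply: eq_Rintegral => x _; congr (_ ^+ 2); ring.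
Qed.

Lemma nrm2_cvgD (f g : nat -> T -> R) f0 g0 (a : R) :
  (forall k, sq (f k)) -> (forall k, sq (g k)) -> sq f0 -> sq g0 ->
  nr (fun x => f k x - f0 x) @[k --> \oo] --> (0 : R) ->
  nr (fun x => g k x - g0 x) @[k --> \oo] --> (0 : R) ->
  nr (fun x => (f k x + a * g k x) - (f0 x + a * g0 x)) @[k --> \oo] --> (0 : R).
Proof.
move=> sf sg sf0 sg0 cf cg.
have c0 : 2 * nr (fun x => f k x - f0 x) + 2 * a ^+ 2 * nr (fun x => g k x - g0 x)
    @[k --> \oo] --> 2 * (0 : R) + 2 * a ^+ 2 * 0.
  by apply: cvgD; apply: cvgM => //; exact: cvg_cst.
rewrite !mulr0 addr0 in c0; apply: squeeze_cvgr c0; last exact: cvg_cst.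
apply: nearW => k; rewrite nrm2_ge0/=.
have := nrm2D_le a (sqintB mD (sf k) sf0) (sqintB mD (sg k) sg0).
apply: le_trans; rewrite le_eqVlt; apply/orP; left.
by apply/eqP; apply: eq_Rintegral => x _; congr (_ ^+ 2); ring.
Qed.

(* Two sequences with the same limit: [g] is squeezed between [f] and [h]. *)
Lemma nrm2_cvg_trans (f g : nat -> T -> R) h :
  (forall k, sq (f k)) -> (forall k, sq (g k)) -> sq h ->
  nr (fun x => f k x - h x) @[k --> \oo] --> (0 : R) ->
  nr (fun x => g k x - f k x) @[k --> \oo] --> (0 : R) ->
  nr (fun x => g k x - h x) @[k --> \oo] --> (0 : R).
Proof.
move=> sf sg sh cf cg.
have c0 : 2 * nr (fun x => g k x - f k x) + 2 * nr (fun x => f k x - h x)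
    @[k --> \oo] --> 2 * (0 : R) + 2 * 0.
  by apply: cvgD; apply: cvgM => //; exact: cvg_cst.
rewrite !mulr0 addr0 in c0; apply: squeeze_cvgr c0; last exact: cvg_cst.
apply: nearW => k; rewrite nrm2_ge0/=.
apply: (le_trans (nrm2_triangle (sg k) (sf k) sh)).
rewrite lerD2l ler_wpM2l// le_eqVlt; apply/orP; left; apply/eqP.
by apply: eq_Rintegral => x _; ring.
Qed.

Lemma cvg0_ex_le (e : nat -> R) (eps : R) : e k @[k --> \oo] --> (0 : R) -> 0 < eps ->
  exists N : nat, forall k, (N <= k)%N -> e k <= eps.
Proof.
move=> /cvgrPdist_le h eps0; have [N _ NP] := h _ eps0.
exists N => k Nk; have := NP k Nk; rewrite sub0r normrN.
exact: le_trans (ler_norm _).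
Qed.

Lemma harmonic_cvg0 (e : nat -> R) : (forall k, 0 <= e k <= k.+1%:R^-1) ->
  e k @[k --> \oo] --> (0 : R).
Proof.
move=> eP; have := @cvg_harmonic R; apply: squeeze_cvgr; last exact: cvg_cst.
exact: nearW.
Qed.

(* A sequence whose energy distance tends to [0] is Cauchy for [nr] as soon as a
   Poincare inequality holds. *)
Lemma poincare_cauchy (w : nat -> T -> R) (E : nat -> R) (C : R) :
  0 <= C -> (forall k, sq (w k)) -> E k @[k --> \oo] --> (0 : R) ->
  (forall k m, nr (fun x => w k x - w m x) <= C * (E k + E m)) ->
  exists2 v, sq v & nr (fun x => w k x - v x) @[k --> \oo] --> (0 : R).
Proof.
move=> C0 sw E0 wE; apply: sqint_complete => // e e0.
(* [C + 1] in place of [C], which may be zero. *)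
have c1 : 0 < e / (2 * (C + 1)) by rewrite divr_gt0// mulr_gt0// ltr_wpDl.
have [N NP] := cvg0_ex_le E0 c1.
exists N => k m Nk Nm; apply: (le_trans (wE k m)).
have h1 := NP k Nk; have h2 := NP m Nm.
apply: (@le_trans _ _ (C * (e / (C + 1)))).
  rewrite ler_wpM2l// (le_trans (lerD h1 h2))//.
  by rewrite le_eqVlt; apply/orP; left; apply/eqP; field; rewrite gt_eqF// ltr_wpDl.
by rewrite mulrA ler_pdivrMr ?ltr_wpDl// mulrC ler_pM2l// lerDl.
Qed.

End nrm2_theory.

Lemma L2_cvgP {R : realType} {n : nat} (D : set 'rV[R]_n) (w : nat -> 'rV[R]_n -> R)
  (u : 'rV[R]_n -> R) : measurable D -> (forall k, sqint (lebesgue_rV n) D (w k)) ->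
  sqint (lebesgue_rV n) D u ->
  L2_cvg D w u <->
  (nrm2 (lebesgue_rV n) D (fun x => w k x - u x) @[k --> \oo] --> (0 : R)).
Proof. by move=> mD sw su; exact: (nrm2_cvg mD sw su). Qed.

(** * The homogenized tensor *)

Section periodic_gradients.
Context {R : realType} {n : nat}.
Notation leb := (@lebesgue_rV R n).
Notation cell := (@cell R n).
Notation field := ('rV[R]_n -> 'rV[R]_n).
Implicit Types (w u v : 'rV[R]_n -> R) (G H F : field).

Let mc : measurable cell := @measurable_cell R n.

(** Only the field is kept, since the corrector enters the tensor through its gradient alone. *)
Definition periodic_gradient : set field := [set H | exists v, W1per v H].

Lemma cell_integrable u : sqint leb cell u -> leb.-integrable cell (EFin \o u).
Proof.
move=> su.
have s1 : sqint leb cell (fun=> 1).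
  by apply: continuous_cell_sqint; exact: cst_continuous.
by have := sqint_prod mc su s1; apply: eq_integrable => // x _ /=; rewrite mulr1.
Qed.

Lemma cell_L2vec_cst (xi : 'rV[R]_n) : L2vec leb cell (fun=> xi).
Proof. by move=> i; apply: continuous_cell_sqint; exact: cst_continuous. Qed.

Lemma H1per_L2 v H : H1per v H -> L2vec leb cell H.
Proof. by case. Qed.

Lemma smooth_sqint w : smooth w -> sqint leb cell w.
Proof. by move=> sw; apply: continuous_cell_sqint; exact: smooth_continuous. Qed.

Lemma smooth_pderiv_sqint w i : smooth w -> sqint leb cell (pderiv i w).
Proof. by move=> sw; apply: continuous_cell_sqint; exact: smooth_pderiv_continuous. Qed.

Lemma H1perD u v G H (a : R) : H1per u G -> H1per v H ->
  H1per (fun x => u x + a * v x) (G + a *: H).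
Proof.
move=> [su sG [wu [wuP cu cG]]] [sv sH [wv [wvP cv cH]]]; split.
- exact: sqintD.
- exact: L2vecD.
have swu k : sqint leb cell (wu k) by apply: smooth_sqint; exact: (wuP k).1.
have swv k : sqint leb cell (wv k) by apply: smooth_sqint; exact: (wvP k).1.
exists (fun k x => wu k x + a * wv k x); split.
- move=> k; split; first by apply: smoothD; [exact: (wuP k).1|exact: (wvP k).1].
  by move=> i y; rewrite (wuP k).2 (wvP k).2.
- apply/(L2_cvgP mc (fun k => sqintD mc a (swu k) (swv k)) (sqintD mc a su sv)).
  exact: (nrm2_cvgD mc a swu swv su sv ((L2_cvgP mc swu su).1 cu) ((L2_cvgP mc swv sv).1 cv)).
- move=> i; have su' k := @smooth_pderiv_sqint (wu k) i (wuP k).1.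
  have sv' k := @smooth_pderiv_sqint (wv k) i (wvP k).1.
  have e k := @smooth_pderivD _ _ (wu k) (wv k) a i (wuP k).1 (wvP k).1.
  rewrite (_ : (fun k => _) = fun k x => pderiv i (wu k) x + a * pderiv i (wv k) x); last first.
    by apply/funext => k; rewrite e.
  rewrite (_ : (fun x => _) = fun x => G x ord0 i + a * H x ord0 i); last first.
    by apply/funext => x; rewrite ?fctE !mxE.
  apply/(L2_cvgP mc (fun k => sqintD mc a (su' k) (sv' k)) (sqintD mc a (sG i) (sH i))).
  exact: (nrm2_cvgD mc a su' sv' (sG i) (sH i) ((L2_cvgP mc su' (sG i)).1 (cG i))
    ((L2_cvgP mc sv' (sH i)).1 (cH i))).
Qed.

Lemma periodic_gradientD G H (a : R) : periodic_gradient G -> periodic_gradient H ->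
  periodic_gradient (G + a *: H).
Proof.
move=> [u [hu u0]] [v [hv v0]]; exists (fun x => u x + a * v x); split.
  exact: H1perD.
have [su _ _] := hu; have [sv _ _] := hv.
have Iv : leb.-integrable cell (EFin \o (fun x => a * v x)).
  by have := integrableZl mc a (cell_integrable sv); apply: eq_integrable.
rewrite RintegralD//; last exact: cell_integrable.
by rewrite RintegralZl ?u0 ?v0 ?mulr0 ?addr0//; exact: cell_integrable.
Qed.

Lemma periodic_gradient0 : periodic_gradient 0.
Proof.
have s0 : sqint leb cell (fun=> 0) by exact: sqint0.
exists (fun=> 0); split; last by rewrite Rintegral_cst ?mul0r.
split => //; first exact: L2vec0.
exists (fun _ _ => 0); split.
- by move=> k; split => //; exact: smooth_cst.
- rewrite /L2_cvg; under eq_fun do (under eq_integral do rewrite subrr expr0n/=).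
  by under eq_fun do rewrite integral0; exact: cvg_cst.
- move=> i; rewrite /L2_cvg pderiv_cst.
  under eq_fun do (under eq_integral do rewrite mxE subrr expr0n/=).
  by under eq_fun do rewrite integral0; exact: cvg_cst.
Qed.

Lemma periodic_gradient_L2 : periodic_gradient `<=` @L2vec _ _ R leb cell n.
Proof. by move=> H [v [hv _]]; exact: H1per_L2 hv. Qed.

Lemma H1per_approx v H (e : R) : H1per v H -> 0 < e ->
  exists w, [/\ smooth w, cell_periodic w &
    \sum_i nrm2 leb cell (fun x => pderiv i w x - H x ord0 i) <= e].
Proof.
move=> [sv sH [w [wP _ cH]]] e0.
have := @cvgr_sum R _ (index_enum 'I_n)
  (fun i k => nrm2 leb cell (fun x => pderiv i (w k) x - H x ord0 i)) (fun=> 0).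
rewrite [\sum_(i <- _) 0]big1// => /(_ _)/cvg0_ex_le/(_ e0) [|N NP].
  move=> i; apply/(L2_cvgP mc _ (sH i)); last exact: cH.
  by move=> k; apply: smooth_pderiv_sqint; exact: (wP k).1.
by exists (w N); split; [exact: (wP N).1|exact: (wP N).2|exact: NP].
Qed.

Lemma smooth_sub_mean w (c : R) : smooth w -> smooth (fun x => w x - c).
Proof.
move=> sw; have := smoothD (-1) sw (smooth_cst (n := n) c).
by under eq_fun do rewrite mulN1r.
Qed.

Lemma pderiv_sub_mean w (c : R) i : smooth w -> pderiv i (fun x => w x - c) = pderiv i w.
Proof.
move=> sw; have := smooth_pderivD (-1) i sw (smooth_cst (n := n) c).
under eq_fun do rewrite mulN1r; move=> ->; apply/funext => x.
by rewrite pderiv_cst mulr0 addr0.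
Qed.

Lemma mean_sub u : sqint leb cell u ->
  \int[leb]_(x in cell) (u x - \int[leb]_(x in cell) u x) = 0.
Proof.
move=> su; rewrite RintegralB//; first last.
- by apply: cell_integrable; apply: continuous_cell_sqint; exact: cst_continuous.
- exact: cell_integrable.
by rewrite Rintegral_cst// [X in fine X]lebesgue_cell mulr1 subrr.
Qed.

(** The limit field exists in L2, but a potential has to be produced. Smooth periodic functions with
    gradients close to the [F k], recentred to mean zero, form a Cauchy sequence by Poincare's
    inequality, and their limit provides it. *)
Lemma periodic_gradient_complete (F : nat -> field) :
  (forall k, periodic_gradient (F k)) ->
  (forall e : R, 0 < e -> exists N : nat, forall k m, (N <= k)%N -> (N <= m)%N ->
     ip leb cell (F k - F m) (F k - F m) <= e) ->
  exists2 G, periodic_gradient G & ip leb cell (F k - G) (F k - G) @[k --> \oo] --> (0 : R).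
Proof.
move=> VF cF; have sF k := periodic_gradient_L2 (VF k).
have [G sG cG] := L2vec_complete mc sF cF; exists G => //.
have /choice[w wP] : forall k, exists w, [/\ smooth w, cell_periodic w &
    \sum_i nrm2 leb cell (fun x => pderiv i w x - F k x ord0 i) <= k.+1%:R^-1].
  by move=> k; have [v [hv _]] := VF k; apply: H1per_approx hv _; rewrite invr_gt0.
have sw k : smooth (w k) by have [] := wP k.
have pw k : cell_periodic (w k) by have [] := wP k.
have sdw k i : sqint leb cell (pderiv i (w k)) by exact: smooth_pderiv_sqint.
have wF i : nrm2 leb cell (fun x => pderiv i (w k) x - F k x ord0 i) @[k --> \oo] --> (0 : R).
  apply: harmonic_cvg0 => k; rewrite nrm2_ge0/=; have [_ _] := wP k; apply: le_trans.
  by rewrite (bigD1 i)//= lerDl sumr_ge0// => *; exact: nrm2_ge0.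
have FG i : nrm2 leb cell (fun x => F k x ord0 i - G x ord0 i) @[k --> \oo] --> (0 : R).
  apply: squeeze_cvgr cG; last exact: cvg_cst.
  apply: nearW => k; rewrite nrm2_ge0/=.
  have := nrm2_le_ip mc i (L2vecB mc (sF k) sG); apply: le_trans.
  rewrite le_eqVlt; apply/orP; left; apply/eqP; apply: eq_Rintegral => x _.
  by rewrite ?fctE !mxE.
have wG i : nrm2 leb cell (fun x => pderiv i (w k) x - G x ord0 i) @[k --> \oo] --> (0 : R).
  by apply: (@nrm2_cvg_trans _ _ _ _ _ _ (fun k x => F k x ord0 i)) => // k; exact: sF.
pose m k := \int[leb]_(x in cell) w k x.
pose z k x := w k x - m k.
have sz k : smooth (z k) by exact: smooth_sub_mean.
have dz k i : pderiv i (z k) = pderiv i (w k) by exact: pderiv_sub_mean.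
have z0 k : \int[leb]_(x in cell) z k x = 0 by apply: mean_sub; exact: smooth_sqint.
pose E k := \sum_i nrm2 leb cell (fun x => pderiv i (w k) x - G x ord0 i).
have E0 : E k @[k --> \oo] --> (0 : R).
  have := @cvgr_sum R _ (index_enum 'I_n)
    (fun i k => nrm2 leb cell (fun x => pderiv i (w k) x - G x ord0 i)) (fun=> 0) wG.
  by rewrite [\sum_(i <- _) 0]big1.
have [v sv cv] : exists2 v, sqint leb cell v &
    nrm2 leb cell (fun x => z k x - v x) @[k --> \oo] --> (0 : R).
  (* [2^n] is the Poincare constant and the other 2 comes from [nrm2_triangle]. *)
  apply: (@poincare_cauchy _ _ _ _ _ mc z E (2 ^+ n * 2)) => //.
  - by move=> k; exact: smooth_sqint.
  move=> k l; have szz : smooth (fun x => z k x - z l x).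
    have := smoothD (-1) (sz k) (sz l); by under eq_fun do rewrite mulN1r.
  have dzz i : pderiv i (fun x => z k x - z l x) = fun x => pderiv i (w k) x - pderiv i (w l) x.
    have := smooth_pderivD (-1) i (sz k) (sz l); rewrite !dz.
    by under eq_fun do rewrite mulN1r; move=> ->; apply/funext => x; rewrite mulN1r.
  apply: (le_trans (smooth_cell_poincare szz _)).
    rewrite RintegralB//; last 2 first.
    - by apply: cell_integrable; exact: smooth_sqint.
    - by apply: cell_integrable; exact: smooth_sqint.
    by rewrite !z0 subrr.
  rewrite -mulrA ler_wpM2l ?exprn_ge0// /E -big_split/= mulr_sumr.
  apply: ler_sum => i _; rewrite dzz mulrDr.
  exact: nrm2_triangle.
(* The mean of [v] is subtracted from the limit and from the approximations alike, instead of being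
   shown to vanish. *)
pose c := \int[leb]_(x in cell) v x.
have sc : sqint leb cell (fun=> c) by apply: continuous_cell_sqint; exact: cst_continuous.
exists (fun x => v x - c); split; last exact: mean_sub.
split; [exact: sqintB|exact: sG|].
exists (fun k x => z k x - c); split.
- move=> k; split; first exact: smooth_sub_mean.
  by move=> i y; rewrite /z pw.
- have szc k : sqint leb cell (fun x => z k x - c).
    by apply: sqintB => //; exact: smooth_sqint.
  apply/(L2_cvgP mc szc (sqintB mc sv sc)).
  rewrite (_ : (fun k => _) = fun k => nrm2 leb cell (fun x => z k x - v x))//.
  by apply/funext => k; apply: eq_Rintegral => x _; congr (_ ^+ 2); ring.
- move=> i; rewrite (_ : (fun k => _) = fun k => pderiv i (w k)); last first.
    by apply/funext => k; rewrite pderiv_sub_mean.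
  by apply/(L2_cvgP mc (sdw ^~ i) (sG i)).
Qed.

(** For smooth functions this is [periodic_pderiv_mean]; Cauchy-Schwarz carries it to limits. It is
    the orthogonality behind the ellipticity of the homogenized tensor. *)
Lemma periodic_gradient_orth H (xi : 'rV[R]_n) : periodic_gradient H ->
  ip leb cell H (fun=> xi) = 0.
Proof.
move=> VH; have sH := periodic_gradient_L2 VH; have sxi := cell_L2vec_cst xi.
apply/eqP; rewrite -sqrf_eq0 eq_le sqr_ge0 andbT; apply/ler_addgt0Pr => e e0.
rewrite add0r; have [v [hv _]] := VH.
pose C := ip leb cell (fun=> xi) (fun=> xi).
have C0 : 0 <= C by exact: ip_ge0.
have c1 : 0 < e / (C + 1) by rewrite divr_gt0// ltr_wpDl.
have [w [sw pw wH]] := H1per_approx hv c1.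
pose W : field := fun x => \row_i pderiv i w x.
have sW : L2vec leb cell W.
  move=> i; apply: eq_sqint (smooth_pderiv_sqint i sw) => x _; by rewrite mxE.
have W0 : ip leb cell W (fun=> xi) = 0.
  rewrite /ip (_ : Rintegral _ _ _ = \sum_i \int[leb]_(x in cell) (pderiv i w x * xi ord0 i)).
    rewrite big1// => i _; rewrite RintegralZr//; last first.
      by apply: cell_integrable; exact: smooth_pderiv_sqint.
    by rewrite periodic_pderiv_mean// mul0r.
  rewrite -Rintegral_sum//.
    by apply: eq_Rintegral => x _; apply: eq_bigr => i _; rewrite mxE.
  move=> i; have := integrableZr mc (xi ord0 i) (cell_integrable (smooth_pderiv_sqint i sw)).
  by apply: eq_integrable.
have -> : ip leb cell H (fun=> xi) = - ip leb cell (W - H) (fun=> xi).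
  have := ipDZl mc (-1) sW sH sxi; rewrite scaleN1r W0 => ->.
  by rewrite add0r mulN1r opprK.
rewrite sqrrN; apply: (le_trans (ip_cauchy_schwarz mc (L2vecB mc sW sH) sxi)).
have h : ip leb cell (W - H) (W - H) <= e / (C + 1).
  rewrite ip_nrm2//; last exact: L2vecB.
  apply: le_trans wH; apply: ler_sum => i _; rewrite le_eqVlt; apply/orP; left.
  by apply/eqP; apply: eq_Rintegral => x _; rewrite ?fctE !mxE.
rewrite -/C (le_trans (ler_wpM2r C0 h))// mulrAC ler_pdivrMr ?ltr_wpDl//.
by rewrite ler_pM2l// lerDl.
Qed.

End periodic_gradients.

(** * Regularity of the coefficients in the parameter [t] *)

Section time_regularity.
Context {R : realType} {n : nat}.
Notation leb := (@lebesgue_rV R n).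
Notation cell := (@cell R n).
Variables (sm sp : R) (a da : R -> 'rV[R]_n -> R) (M : R).
Hypothesis h : W1oo_time sm sp a da M.

(** A section of a jointly measurable set is measurable, so this holds at every [t] and not just at
    almost every one. *)
Lemma W1oo_time_measurable t : sm <= t <= sp -> measurable_fun cell (a t).
Proof.
move=> tI _ Y mY; have [[ma _] _ _ _ _] := h.
pose Q : set (measurableTypeR R * 'rV[R]_n) := `[sm, sp] `*` cell.
have mQ : measurable Q by apply: measurableX; [exact: measurable_itv|exact: measurable_cell].
have := measurable_xsection t (ma mQ Y mY).
congr (measurable _); apply/seteqP; split => y.
  by rewrite /xsection/= inE => -[[_ cy] Yy].
by move=> [cy Yy]; rewrite /xsection/= inE; split => //; split => //=; rewrite in_itv.
Qed.

(** In the continuity in [t] the null set depends on the tolerance and on the time. Along a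
    sequence, with tolerances [1/(m+1)], only countably many null sets occur. *)
Lemma W1oo_time_cvg (u : nat -> R) t : sm <= t <= sp -> (forall k, sm <= u k <= sp) ->
  u k @[k --> \oo] --> t ->
  {ae leb, forall y, cell y -> a (u k) y @[k --> \oo] --> a t y}.
Proof.
move=> tI uI ut; have [_ ca _ _ _] := h.
have /choice[K KP] : forall m : nat, exists K : nat, forall k, (K <= k)%N ->
    {ae leb, forall y, cell y -> `|a (u k) y - a t y| <= m.+1%:R^-1}.
  move=> m; have m0 : 0 < m.+1%:R^-1 :> R by rewrite invr_gt0.
  have [K _ KP] := ut _ (ca t tI _ m0); exists K => k Kk.
  exact: (KP k Kk (uI k)).
have : {ae leb, forall y m k, (K m <= k)%N -> cell y -> `|a (u k) y - a t y| <= m.+1%:R^-1}.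
  apply: ae_foralln => m; apply: ae_foralln => k.
  have [Kk|Kk] := leqP (K m) k; last by apply: aeW => y.
  by apply: filterS (KP m k Kk) => y hy _.
apply: filterS => y hy cy; apply/cvgrPdist_le => e e0.
have := @cvg_harmonic R => /cvgrPdist_le /(_ _ e0)[m _ /(_ m (leqnn _))].
rewrite /= sub0r normrN ger0_norm ?invr_ge0// => me.
by exists (K m) => // k /= Kk; rewrite distrC (le_trans (hy m k Kk cy)).
Qed.

End time_regularity.

Section homogenized_tensor.
Context {R : realType} {n : nat}.
Notation leb := (@lebesgue_rV R n).
Notation cell := (@cell R n).
Notation field := ('rV[R]_n -> 'rV[R]_n).
Notation V := (@periodic_gradient R n).
Notation frm := (frm leb cell).
Notation e_ i := ((fun=> basis_rV i) : field).
Variables (al be : R) (al0 : 0 < al) (be0 : 0 < be).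
Implicit Types (A : 'rV[R]_n -> 'M[R]_n) (N G H : field).
Notation vari := (variational leb cell V).

Let mc : measurable cell := @measurable_cell R n.
Let se i : L2vec leb cell (e_ i) := cell_L2vec_cst (basis_rV i).

Lemma corrector_field_exists A j : tensor leb cell A al be -> exists N, vari A (e_ j) N.
Proof.
move=> tA; apply: (variational_exists mc periodic_gradient_L2 periodic_gradient0
  periodic_gradientD periodic_gradient_complete al0 be0 tA (se j)).
Qed.

Lemma periodic_gradientN G : V G -> V (- G).
Proof.
move=> VG; rewrite -[- G]add0r -scaleN1r.
by apply: periodic_gradientD => //; exact: periodic_gradient0.
Qed.

Lemma dotp_basis (x : 'rV[R]_n) i : dotp x (basis_rV i) = x ord0 i.
Proof.
rewrite /dotp (bigD1 i)//= mxE !eqxx mulr1 big1 ?addr0// => j ji.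
by rewrite mxE (negbTE ji) andbF mulr0.
Qed.

Lemma frm_basis A N i : frm A N (e_ i) = \int[leb]_(y in cell) (mulB A N y ord0 i).
Proof. by apply: eq_Rintegral => y _; rewrite dotp_basis. Qed.

(** When [G] is a corrector gradient, [e_ j - G] solves the variational problem with [N0 = e_ j];
    the entry is the [i]-th component of the mean flux of this field. *)
Lemma hom_entry_frm A i j G : tensor leb cell A al be -> L2vec leb cell G ->
  hom_entry A i j G = frm A (e_ j - G) (e_ i).
Proof.
move=> tA sG; rewrite /hom_entry [X in fine X]lebesgue_cell invr1 !mul1r.
have := frmDl mc be0 tA (-1) (se j) sG (se i); rewrite scaleN1r mulN1r => ->.
congr (_ - _).
  rewrite frm_basis; apply: eq_Rintegral => y _.
  rewrite mxE (bigD1 j)//= !mxE !eqxx mul1r big1 ?addr0// => k kj.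
  by rewrite mxE (negbTE kj) andbF mul0r.
rewrite frm_basis -Rintegral_sum//.
  apply: eq_Rintegral => y _; rewrite mxE; apply: eq_bigr => k _.
  by rewrite mxE mulrC.
move=> k; have [mA _ _] := tA.
have sA : sqint leb cell (fun y => A y i k).
  have := L2vec_mulB mc be0 tA (se k) i; apply: eq_sqint => y _.
  rewrite mxE (bigD1 k)//= !mxE !eqxx mul1r big1 ?addr0// => l lk.
  by rewrite mxE (negbTE lk) andbF mul0r.
exact: sqint_prod.
Qed.

Lemma corrector_variational A j chi G : tensor leb cell A al be ->
  corrector A j chi G -> vari A (e_ j) (e_ j - G).
Proof.
move=> tA [wG hG]; have VG : V G by exists chi.
have sG := periodic_gradient_L2 VG; split.
  by rewrite addrAC subrr add0r; exact: periodic_gradientN.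
move=> K VK; have sK := periodic_gradient_L2 VK; have [v wv] := VK.
have := frmDl mc be0 tA (-1) (se j) sG sK; rewrite scaleN1r mulN1r => ->.
by apply/eqP; rewrite subr_eq0; apply/eqP; exact/esym/(hG v).
Qed.

(** [get] returns some value of [hom_entry]: the existence of a corrector makes the set inhabited,
    and the uniqueness of the output identifies the value chosen. *)
Lemma hom_tensorE A i j N : tensor leb cell A al be -> vari A (e_ j) N ->
  hom_tensor A i j = frm A N (e_ i).
Proof.
move=> tA vN; rewrite mxE.
set S := [set r | _].
have sN := variational_L2 mc periodic_gradient_L2 (se j) vN.
have [chi wchi] : V (e_ j - N) by rewrite -opprB; apply: periodic_gradientN; exact: vN.1.
have : S (get S).
  apply: getPex; exists (hom_entry A i j (e_ j - N)), chi, (e_ j - N); split => //.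
  split => // v H wH; have VH : V H by exists v.
  have sH := periodic_gradient_L2 VH.
  have := frmDl mc be0 tA (-1) (se j) sN sH; rewrite scaleN1r mulN1r vN.2// subr0.
  by [].
move=> [chi' [G' [cG' ->]]].
have sG' : L2vec leb cell G' by apply: periodic_gradient_L2; exists chi'; exact: cG'.1.
rewrite hom_entry_frm//.
apply: (variational_output_unique mc periodic_gradient_L2 periodic_gradientD al0 be0 tA (se j) (se i)) => //.
exact: corrector_variational tA cG'.
Qed.

(** [N' - e_ i] lies in [V], to which the flux of [N] is orthogonal, so [e_ i] may be replaced by
    [N']. In this form symmetry and ellipticity can be read off. *)
Lemma hom_tensor_sym_form A i j N N' : tensor leb cell A al be ->
  vari A (e_ j) N -> vari A (e_ i) N' -> hom_tensor A i j = frm A N N'.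
Proof.
move=> tA vN vN'; rewrite (hom_tensorE i tA vN).
have sN := variational_L2 mc periodic_gradient_L2 (se j) vN.
have sN' := variational_L2 mc periodic_gradient_L2 (se i) vN'.
have := frmDr mc be0 tA (-1) sN' (se i) sN.
rewrite scaleN1r mulN1r vN.2; last exact: vN'.1.
by move=> /esym/eqP; rewrite subr_eq0 => /eqP.
Qed.

Lemma hom_tensor_sym A : tensor leb cell A al be -> (hom_tensor A)^T = hom_tensor A.
Proof.
move=> tA; have /choice[N vN] := fun j => corrector_field_exists j tA.
apply/matrixP => i j; rewrite mxE (hom_tensor_sym_form tA (vN i) (vN j)).
rewrite (hom_tensor_sym_form tA (vN j) (vN i)) (frmC mc be0 tA)//.
- exact: (variational_L2 mc periodic_gradient_L2 (se i) (vN i)).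
- exact: (variational_L2 mc periodic_gradient_L2 (se j) (vN j)).
Qed.

Lemma ip_basis i : ip leb cell (e_ i) (e_ i) = 1.
Proof.
rewrite /ip Rintegral_cst// [X in fine X]lebesgue_cell mulr1 dotp_basis.
by rewrite mxE !eqxx.
Qed.

Lemma hom_tensor_bound A i j : tensor leb cell A al be ->
  `|hom_tensor A i j| <= be * (be / al).
Proof.
move=> tA; have [N vN] := corrector_field_exists j tA.
rewrite (hom_tensorE i tA vN).
have := variational_output_bound mc periodic_gradient_L2 al0 be0 tA (se j) (se i) vN.
rewrite !ip_basis !mulr1 -exprMn => h.
rewrite -ler_sqr ?nnegrE//; last by rewrite mulr_ge0 ?divr_ge0 ?(ltW al0) ?(ltW be0).
by rewrite real_normK ?num_real.
Qed.

(** With [w] the combination of the [N j] with weights [xi_j], the form is the energy of [w], hence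
    at least [al |w|^2]. As [w - xi] is a periodic gradient, it is orthogonal to the constant [xi],
    so [|w|^2 >= |xi|^2] and the constant [al] survives. *)
Lemma hom_tensor_elliptic A (xi : 'rV[R]_n) : tensor leb cell A al be ->
  al * enorm xi ^+ 2 <= bform (hom_tensor A) xi xi.
Proof.
move=> tA; have /choice[N vN] := fun j => corrector_field_exists j tA.
have sN j := variational_L2 mc periodic_gradient_L2 (se j) (vN j).
(* Sums over an arbitrary list, so that the claims about them go by induction on it. *)
pose W (s : seq 'I_n) : field := \sum_(j <- s) xi ord0 j *: N j.
pose X (s : seq 'I_n) : field := \sum_(j <- s) xi ord0 j *: e_ j.
have sW s : L2vec leb cell (W s).
  rewrite /W; elim: s => [|j s IH]; first by rewrite big_nil; exact: L2vec0.
  by rewrite big_cons addrC; exact: L2vecD.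
have VW s : V (W s - X s).
  rewrite /W /X; elim: s => [|j s IH].
    by rewrite !big_nil subr0; exact: periodic_gradient0.
  rewrite !big_cons opprD addrACA -scalerBr addrC.
  by apply: periodic_gradientD => //; exact: (vN j).1.
have XE : X (index_enum 'I_n) = (fun=> xi).
  apply/funext => y; rewrite /X fct_sumE; apply/rowP => i; rewrite summxE.
  rewrite (bigD1 i)//= ?fctE !mxE !eqxx mulr1 big1 ?addr0// => j ji.
  by rewrite ?fctE !mxE eqxx/= eq_sym (negbTE ji) mulr0.
have frmW s K : L2vec leb cell K -> frm A (W s) K = \sum_(j <- s) xi ord0 j * frm A (N j) K.
  move=> sK; rewrite /W; elim: s => [|j s IH].
    rewrite !big_nil; have := frmDl mc be0 tA (-1) (sW [::]) (sW [::]) sK.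
    by rewrite /W big_nil scaleN1r subrr mulN1r subrr.
  rewrite !big_cons addrC (frmDl mc be0 tA _ (sW s))// IH; exact: addrC.
have frmWr s K : L2vec leb cell K -> frm A K (W s) = \sum_(j <- s) xi ord0 j * frm A K (N j).
  move=> sK; rewrite (frmC mc be0 tA sK (sW s)) frmW//.
  by apply: eq_bigr => j _; rewrite (frmC mc be0 tA (sN j) sK).
set w := W (index_enum 'I_n).
have sw : L2vec leb cell w by exact: sW.
have -> : bform (hom_tensor A) xi xi = frm A w w.
  rewrite frmW// /bform /dotp; apply: eq_bigr => i _; rewrite frmWr// mxE mulrC.
  congr (_ * _); apply: eq_bigr => j _; rewrite mxE.
  by rewrite (hom_tensor_sym_form tA (vN j) (vN i)) (frmC mc be0 tA).
apply: le_trans (frm_ge mc be0 tA sw); rewrite ler_pM2l// enorm_sq.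
have sxi : L2vec leb cell (fun=> xi) := cell_L2vec_cst xi.
have VwX : V (w - (fun=> xi)) by rewrite -XE; exact: VW.
have h0 : ip leb cell (w - (fun=> xi)) (fun=> xi) = 0 by exact: periodic_gradient_orth.
have e1 : ip leb cell (fun=> xi) (fun=> xi) = dotp xi xi.
  by rewrite /ip Rintegral_cst// [X in fine X]lebesgue_cell mulr1.
have := ipDZl mc (-1) sw sxi sxi; rewrite scaleN1r h0 mulN1r e1.
move=> /eqP; rewrite eq_sym subr_eq0 => /eqP e2.
have sd : L2vec leb cell (w - (fun=> xi)) by exact: L2vecB.
have h1 := ipDZr mc (-1) sw sxi sd; have h2 := ipDZl mc (-1) sw sxi sw.
rewrite scaleN1r in h1; rewrite scaleN1r in h2.
have := ip_ge0 leb cell (w - (fun=> xi)).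
rewrite h1 h2 h0 [ip _ _ (fun=> xi) w]ipC e2; lra.
Qed.

Lemma hom_tensor_cvg (Ak : nat -> 'rV[R]_n -> 'M[R]_n) A i j :
  (forall k, tensor leb cell (Ak k) al be) -> tensor leb cell A al be ->
  {ae leb, forall y, cell y -> forall i j, Ak k y i j @[k --> \oo] --> A y i j} ->
  hom_tensor (Ak k) i j @[k --> \oo] --> hom_tensor A i j.
Proof.
move=> tAk tA cA.
have /choice[Nk vNk] := fun k => corrector_field_exists j (tAk k).
have [N vN] := corrector_field_exists j tA.
rewrite (hom_tensorE i tA vN).
under eq_fun do rewrite (hom_tensorE i (tAk _) (vNk _)).
exact: (variational_cvg mc periodic_gradient_L2 periodic_gradientD al0 be0 tAk tA (se j) (se i) vNk vN cA).
Qed.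

End homogenized_tensor.

(** * Hausdorff measure and Friedrichs' inequality *)

Section metric_outer_measure.
Context {R : realType} (n s : nat).
Notation H := (@hausdorff R n s).
Local Open Scope ereal_scope.
Implicit Types (A B E : set 'rV[R]_n).

(** The diameter is reset to 0 when [C k] misses [A], so that a covering set is charged only to what
    it meets. *)
Let sub_cover (C : (set 'rV[R]_n)^nat) (r : R^nat) A : R^nat :=
  fun k => if `[< exists x, (C k `&` A) x >] then r k else 0%R.

Let sub_coverP (C : (set 'rV[R]_n)^nat) (r : R^nat) A B delta : (0 < delta)%R ->
  B `<=` A -> hausdorff_cover delta A C r ->
  hausdorff_cover delta B (fun k => C k `&` B) (sub_cover C r B).
Proof.
move=> d0 BA [AC r0 rC]; split.
- by move=> x Bx; have [k _ Ck] := AC _ (BA _ Bx); exists k.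
- by move=> k; rewrite /sub_cover; case: ifP => _; [exact: r0|rewrite lexx ltW].
- move=> k x y [Cx Bx] [Cy By]; rewrite /sub_cover ifT; first exact: rC.
  by apply/asboolP; exists x.
Qed.

(** A covering set of diameter at most [delta < dist] cannot meet both [A] and [B], so each term of
    the cover is charged at most once. *)
Lemma hausdorff_pre_separated A B (dist delta : R) : (0 < delta < dist)%R ->
  (forall x y, A x -> B y -> dist <= enorm (x - y))%R ->
  hausdorff_pre s delta A + hausdorff_pre s delta B <= hausdorff_pre s delta (A `|` B).
Proof.
move=> /andP[d0 dd] AB; apply: le_ereal_inf_tmp => _ [C [r [cov ->]]].
have [_ r0 rC] := cov.
have covA := sub_coverP d0 (@subsetUl _ A B) cov.
have covB := sub_coverP d0 (@subsetUr _ A B) cov.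
have pos D k : 0 <= ((sub_cover C r D k) ^+ s.+1)%:E.
  rewrite lee_fin exprn_ge0// /sub_cover; case: ifP => // _.
  by have /andP[] := r0 k.
apply: (@le_trans _ _ (\sum_(0 <= k <oo) ((sub_cover C r A k) ^+ s.+1)%:E +
    \sum_(0 <= k <oo) ((sub_cover C r B k) ^+ s.+1)%:E)).
  apply: leeD; apply: ereal_inf_lbound.
    by exists (fun k => C k `&` A), (sub_cover C r A).
  by exists (fun k => C k `&` B), (sub_cover C r B).
rewrite -nneseriesD//; apply: lee_nneseries => [k _ _|k _].
  exact: adde_ge0.
rewrite -EFinD lee_fin /sub_cover.
have rk : (0 <= r k)%R by have /andP[] := r0 k.
case: asboolP => [[x [Cx Ax]]|_]; case: asboolP => [[y [Cy By]]|_].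
- exfalso; have h1 := AB x y Ax By; have h2 := rC k x y Cx Cy.
  have /andP[_ h3] := r0 k; move: (le_trans h1 (le_trans h2 h3)).
  by rewrite leNgt dd.
- by rewrite expr0n/= addr0.
- by rewrite expr0n/= add0r.
- by rewrite expr0n/= addr0 exprn_ge0.
Qed.

Lemma hausdorff_pre_antitone A (d1 d2 : R) : (d1 <= d2)%R ->
  hausdorff_pre s d2 A <= hausdorff_pre s d1 A.
Proof.
move=> d12; apply: ereal_inf_le_tmp => _ [C [r [[AC r0 rC] ->]]].
exists C, r; split => //; split => // k; have /andP[-> h] := r0 k.
exact: le_trans h d12.
Qed.

Lemma hausdorff_pre_le A (delta : R) : (0 < delta)%R -> hausdorff_pre s delta A <= H A.
Proof. by move=> d0; apply: ereal_sup_ubound; exists delta. Qed.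

Lemma hausdorff_separated A B (dist : R) : (0 < dist)%R ->
  (forall x y, A x -> B y -> dist <= enorm (x - y))%R ->
  H A + H B <= H (A `|` B).
Proof.
move=> dist0 AB.
have [->|/negPf Hoo] := eqVneq (H (A `|` B)) +oo; first exact: leey.
have Hfin E : E `<=` A `|` B -> H E \is a fin_num.
  move=> EAB; rewrite ge0_fin_numE ?outer_measure_ge0//.
  apply: (le_lt_trans (le_outer_measure H _ _ EAB)).
  by rewrite ltey Hoo.
have HA := Hfin A (@subsetUl _ A B); have HB := Hfin B (@subsetUr _ A B).
have pp d1 d2 : (0 < d1)%R -> (0 < d2)%R ->
    hausdorff_pre s d1 A + hausdorff_pre s d2 B <= H (A `|` B).
  (* The scale has to be below [dist] for the separation, and at most [d1] and [d2] for the
     monotonicity in the scale. *)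
  move=> d10 d20; pose d : R := Num.min (Num.min d1 d2) (dist / 2)%R.
  have d0 : (0 < d)%R by rewrite !lt_min d10 d20 divr_gt0.
  have dd : (d < dist)%R.
    by rewrite gt_min; apply/orP; right; rewrite ltr_pdivrMr// ltr_pMr// ltr1n.
  apply: (@le_trans _ _ (hausdorff_pre s d (A `|` B))); last exact: hausdorff_pre_le.
  apply: (le_trans _ (@hausdorff_pre_separated A B dist d _ AB)); last by rewrite d0 dd.
  apply: leeD; apply: hausdorff_pre_antitone.
    by rewrite !ge_min lexx.
  by rewrite !ge_min lexx orbT.
rewrite -leeBrDr//; apply: ge_ereal_sup => _ [d1 d10 <-].
have fin1 : hausdorff_pre s d1 A \is a fin_num.
  rewrite ge0_fin_numE.
    by apply: (le_lt_trans (hausdorff_pre_le A d10)); rewrite -ge0_fin_numE// outer_measure_ge0.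
  apply: le_ereal_inf_tmp => _ [C [r [[_ r0 _] ->]]].
  apply: nneseries_ge0 => k _ _; rewrite lee_fin exprn_ge0//.
  by have /andP[] := r0 k.
rewrite leeBrDr// addeC -leeBrDr//; apply: ge_ereal_sup => _ [d2 d20 <-].
by rewrite leeBrDr// addeC; exact: pp.
Qed.

Lemma hausdorff_separated_coord A B i (b c : R) : (b < c)%R ->
  (forall x, A x -> x ord0 i <= b)%R -> (forall x, B x -> c <= x ord0 i)%R ->
  H A + H B <= H (A `|` B).
Proof.
move=> bc Ab Bc; apply: (@hausdorff_separated _ _ (c - b)%R); first by rewrite subr_gt0.
move=> x y Ax By; apply: le_trans (coord_le_enorm (x - y)%R i).
rewrite !mxE distrC; apply: le_trans (ler_norm _).
by apply: lerB; [exact: Bc|exact: Ab].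
Qed.

(* Caratheodory's criterion for a half-space: the slices of [E] between the levels
   [a - 1/(j+1)] are separated two by two, hence their measures are summable. *)
Lemma hausdorff_half_space i (a : R) :
  H.-caratheodory [set x : 'rV[R]_n | (a <= x ord0 i)%R].
Proof.
apply: le_caratheodory_measurable => E.
set F := [set x : 'rV[R]_n | (a <= x ord0 i)%R].
suff : H (E `&` F) + H (E `&` ~` F) <= H E by [].
have [->|/negPf Hoo] := eqVneq (H E) +oo; first exact: leey.
have HE : H E < +oo by rewrite ltey Hoo.
pose c (k : nat) : R := (a - k.+1%:R^-1)%R.
have cc k : (c k < c k.+1)%R.
  by rewrite /c ltrD2l ltrN2 ltf_pV2 ?posrE ?ltr0n// ltr_nat.
have ca k : (c k < a)%R by rewrite /c gtrBl invr_gt0.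
pose P k := E `&` [set x | (x ord0 i <= c k)%R].
pose Q k := E `&` [set x | (c k < x ord0 i <= c k.+1)%R].
have HP k : H (E `&` F) + H (P k) <= H E.
  rewrite addeC; apply: (@le_trans _ _ (H (P k `|` (E `&` F)))).
    apply: (@hausdorff_separated_coord _ _ i (c k) a (ca k)).
      by move=> x [].
    by move=> x [].
  by apply: le_outer_measure => x [[]|[]].
have PE k : H (P k) <= H E by apply: le_outer_measure => x [].
have PQ k : H (P k) + H (Q k.+1) <= H (P k.+2).
  apply: (@le_trans _ _ (H (P k `|` (Q k.+1)))).
    apply: (@hausdorff_separated_coord _ _ i (c k) (c k.+1) (cc k)).
      by move=> x [].
    by move=> x [_ /= /andP[/ltW]].
  apply: le_outer_measure => x [[Ex xk]|[Ex /= /andP[_ xk]]]; split => //=.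
  by rewrite (le_trans xk)// (le_trans (ltW (cc k)))// ltW.
(* Slices whose indices have the same parity are separated, and each parity class is bounded by one
   [P]: hence the two terms on the right. *)
have Ssum k : \sum_(0 <= j < k.+1) H (Q j) <= H (P k.+1) + H (P k).
  elim: k => [|k IH].
    rewrite big_nat1; apply: (@le_trans _ _ (H (P 1%N))).
      by apply: le_outer_measure => x [Ex /= /andP[_]].
    by rewrite leeDl// outer_measure_ge0.
  rewrite big_nat_recr//=; apply: (le_trans (leeD2r _ IH)).
  by rewrite -addeA [leRHS]addeC; apply: leeD2l; exact: PQ.
have Qs : \sum_(0 <= j <oo) H (Q j) < +oo.
  apply: (@le_lt_trans _ _ (H E + H E)); last by rewrite lte_add_pinfty.
  apply: lime_le; first by apply: is_cvg_nneseries => k _ _; exact: outer_measure_ge0.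
  apply: nearW => k; apply: (@le_trans _ _ (\sum_(0 <= j < k.+1) H (Q j))).
    by rewrite big_nat_recr//= leeDl// outer_measure_ge0.
  by apply: (le_trans (Ssum k)); apply: leeD.
have tail := nneseries_tail_cvg Qs (fun k _ => outer_measure_ge0 H (Q k)).
(* What lies below the level [a] is in [P k] or in a slice of index at least [k]; the latter
   contribute the tail of a convergent series. *)
have dec k : H (E `&` ~` F) <= H (P k) + \sum_(k <= j <oo) H (Q j).
  pose Q' j := if (k <= j)%N then Q j else set0.
  apply: (@le_trans _ _ (H (P k `|` \bigcup_j Q' j))).
    apply: le_outer_measure => x [Ex /= /negP]; rewrite -ltNge => xa.
    have [xk|xk] := leP (x ord0 i) (c k); first by left.
    right.
    have [m xm] : exists m, (x ord0 i <= c m)%R.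
      exists (Num.truncn ((a - x ord0 i)^-1)); rewrite /c lerBrDr -lerBrDl.
      rewrite -[leRHS]invrK lef_pV2 ?posrE ?invr_gt0 ?subr_gt0//.
      by apply: ltW; rewrite truncnS_gt.
    have [j [xj jm]] : exists j, (c j < x ord0 i <= c j.+1)%R /\ (k <= j)%N.
      have km : (k <= m)%N.
        rewrite leqNgt; apply/negP => mk.
        have : (c m <= c k)%R by rewrite /c lerD2l lerN2 lef_pV2 ?posrE// ler_nat ltnS ltnW.
        by move=> h; move: (lt_le_trans xk (le_trans xm h)); rewrite ltxx.
      elim: m km xm => [|m IH] km xm.
        by move: km; rewrite leqn0 => /eqP k0; move: (lt_le_trans xk xm); rewrite k0 ltxx.
      have [xm'|xm'] := leP (x ord0 i) (c m).
        apply: IH => //; move: km; rewrite leq_eqVlt => /predU1P[km|//].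
        exfalso; move: (lt_trans (lt_le_trans xk xm') (cc m)).
        by rewrite km ltxx.
      have [km'|] := eqVneq k m.+1.
        by exfalso; move: (lt_le_trans xk xm); rewrite km' ltxx.
      move=> km'; exists m; rewrite xm' xm; split => //.
      by rewrite -ltnS ltn_neqAle km' km.
    by exists j => //; rewrite /Q' jm; split.
  apply: (le_trans (outer_measureU2 H _ _)); apply: leeD2l.
  apply: (le_trans (outer_measure_sigma_subadditive H Q')).
  rewrite (@nneseries_split _ _ 0%N k); last by move=> j _; exact: outer_measure_ge0.
  rewrite add0n big_nat_cond big1 ?add0e; last first.
    by move=> j /andP[/andP[_ jk] _]; rewrite /Q' leqNgt jk/= outer_measure0.
  rewrite eseries_cond [leRHS]eseries_cond; apply: lee_nneseries.
    by move=> j _ _; exact: outer_measure_ge0.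
  by move=> j /andP[_ kj]; rewrite /Q' kj.
apply/lee_addgt0Pr => e e0.
have [k ke] : exists k, \sum_(k <= j <oo) H (Q j) <= e%:E.
  have /fine_cvgP[[N1 _ h1] /cvgrPdist_le h2] := tail.
  have [N2 _ h3] := h2 _ e0; pose N := maxn N1 N2; exists N.
  have f1 := h1 N (leq_maxl _ _); have := h3 N (leq_maxr _ _).
  rewrite /= sub0r normrN => h4; rewrite -(fineK f1) lee_fin.
  exact: le_trans (ler_norm _) h4.
apply: (le_trans (leeD2l _ (dec k))); rewrite addeA.
by apply: leeD => //; exact: HP.
Qed.

Let coord_caratheodory i : measurable_fun setT
  (fun x : caratheodory_type H => (x : 'rV[R]_n) ord0 i).
Proof.
move=> _; apply: (measurability _ (RGenCInfty.measurableE R)) => //.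
move=> _ [_ [a ->] <-]; rewrite setTI.
rewrite (_ : _ @^-1` _ = [set x : 'rV[R]_n | (a <= x ord0 i)%R]).
  exact: hausdorff_half_space.
by apply/seteqP; split => x /=; rewrite in_itv/= andbT.
Qed.

(** Half-spaces generate the sigma-algebra of the coordinates. *)
Lemma borel_caratheodory : measurable_fun setT
  (fun x : caratheodory_type H => (x : 'rV[R]_n)).
Proof. by apply: measurable_to_rV => i; exact: coord_caratheodory. Qed.

Lemma measurable_caratheodory A : measurable A ->
  measurable (A : set (caratheodory_type H)).
Proof. by move=> mA; have := borel_caratheodory measurableT mA; rewrite setTI. Qed.

Lemma measurable_fun_caratheodory (f : 'rV[R]_n -> R) : measurable_fun setT f ->
  measurable_fun setT (f : caratheodory_type H -> R).
Proof. by move=> mf; exact: (measurableT_comp mf borel_caratheodory). Qed.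

End metric_outer_measure.

Lemma measurable_cube {R : realType} n (z : 'rV[R]_n) (r : R) :
  measurable [set v : 'rV[R]_n | forall i, `|v ord0 i - z ord0 i| <= r].
Proof.
pose I i : set R := `[z ord0 i - r, z ord0 i + r]%classic.
rewrite [X in measurable X](_ : _ = \bigcap_(i in [set: 'I_n])
    ((fun v : 'rV[R]_n => v ord0 i) @^-1` I i)).
  apply: fin_bigcap_measurable => // i _.
  rewrite -[X in measurable X]setTI; apply: measurable_coord => //.
  exact: measurable_itv.
apply/seteqP; split => v h i.
  by move=> _; rewrite /I /= in_itv/= -ler_distl; exact: h.
by have := h i Logic.I; rewrite /I /= in_itv/= -ler_distl.
Qed.

Section projection.
Context {R : realType} (s : nat).
Notation H := (@hausdorff R s.+2 s).
Notation tail := (fun x : 'rV[R]_s.+2 => (uncons_rV x).2).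

(* Dropping a coordinate is 1-Lipschitz; a set of diameter [r] projects into a cube
   of side [2 r]. *)
Lemma lebesgue_projection_le (S : set 'rV[R]_s.+2) : measurable (tail @` S) ->
  (lebesgue_rV s.+1 (tail @` S) <= (2 ^+ s.+1)%:E * H S)%E.
Proof.
move=> mT; have c0 : 0 < 2 ^+ s.+1 :> R by rewrite exprn_gt0.
rewrite -lee_pdivrMl//.
(* Scale 1 is enough, the measure being the supremum over all scales. *)
apply: (le_trans _ (hausdorff_pre_le s S (@ltr01 R))).
apply: le_ereal_inf_tmp => _ [C [r [[SC r01 rC] ->]]].
have r0 k : 0 <= r k by have /andP[] := r01 k.
rewrite lee_pdivrMl// -nneseriesZl; last by move=> k _; rewrite lee_fin exprn_ge0.
(* A cube around the projection of an arbitrarily chosen point of [C k], empty when [C k] is. *)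
pose Q k : set 'rV[R]_s.+1 := if pselect (exists x, C k x) is left h then
  [set v | forall i, `|v ord0 i - (tail (projT1 (cid h))) ord0 i| <= r k] else set0.
have QE k : (lebesgue_rV s.+1 (Q k) <= (2 ^+ s.+1)%:E * (r k ^+ s.+1)%:E)%E.
  rewrite /Q; case: pselect => [h|h]; last first.
    by rewrite measure0 -EFinM lee_fin mulr_ge0 ?exprn_ge0.
  by rewrite [leLHS]lebesgue_cube// -EFinM -exprMn.
have mQ k : measurable (Q k).
  rewrite /Q; case: pselect => [h|h]; last exact: measurable0.
  exact: measurable_cube.
apply: (@le_trans _ _ (\sum_(0 <= k <oo) lebesgue_rV s.+1 (Q k))%E).
  apply: measure_sigma_subadditive => // _ [x Sx <-].
  have [k _ Ckx] := SC x Sx; exists k => //; rewrite /Q.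
  case: pselect => [h|[]]; last by exists x.
  case: cid => y Cy /= i; rewrite !mxE.
  by have := coord_le_enorm (x - y) (lift ord0 i); rewrite !mxE => /le_trans; apply; exact: rC.
by apply: lee_nneseries => [k _ _|k _]; [exact: measure_ge0|exact: QE].
Qed.

End projection.

(** The sum rounds [a] down to a multiple of [eps], capped at [N eps]: a discrete layer-cake
    formula. *)
Lemma level_sum_bounds (R : realType) (a eps : R) (N : nat) : 0 <= a -> 0 < eps ->
  let S := \sum_(j < N) (if j.+1%:R * eps <= a then eps else 0) in
  [/\ S <= a, N%:R * eps <= a -> S = N%:R * eps & a <= N%:R * eps -> a - eps <= S].
Proof.
move=> a0 e0; elim: N => [|N [h1 h2 h3]] S.
  rewrite /S big_ord0 mul0r; split => // a0'; lra.
rewrite /S big_ord_recr/=.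
set T := (\sum_(i < N) _) in h1 h2 h3 *.
have eN : N.+1%:R * eps = N%:R * eps + eps by rewrite -natr1 mulrDl mul1r.
rewrite eN; have [le|gt] := leP (N%:R * eps + eps) a.
  have NA : N%:R * eps <= a by lra.
  by rewrite (h2 NA); split => // ?; lra.
rewrite addr0; split => //.
move=> _; have [l|/ltW g] := leP a (N%:R * eps); first exact: h3.
rewrite h2//; lra.
Qed.

Section level_sum_integral.
Context d (T : measurableType d) (R : realType) (mu : {measure set T -> \bar R}).
Variables (N : nat) (A : 'I_N -> set T) (eps : R).
Hypotheses (mA : forall j, measurable (A j)) (eps0 : 0 <= eps).
Local Open Scope ereal_scope.

Lemma measurable_level_sum D :
  measurable_fun D (fun x => \sum_(j < N) eps%:E * (\1_(A j) x)%:E).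
Proof.
apply: emeasurable_sum => j; apply/measurable_EFinP; exact: measurable_funM.
Qed.

Lemma level_sum_ge0 x : 0 <= \sum_(j < N) eps%:E * (\1_(A j) x)%:E.
Proof. by apply: sume_ge0 => j _; rewrite mule_ge0. Qed.

Lemma integral_level_sum D : measurable D ->
  \int[mu]_(x in D) (\sum_(j < N) eps%:E * (\1_(A j) x)%:E) =
  \sum_(j < N) eps%:E * mu (A j `&` D).
Proof.
move=> mD; rewrite ge0_integral_sum//; last 2 first.
- move=> j; apply/measurable_EFinP; exact: measurable_funM.
- by move=> j x _; rewrite mule_ge0.
apply: eq_bigr => j _; rewrite ge0_integralZl//; last first.
  by apply/measurable_EFinP; exact: measurable_indic.
by rewrite integral_indic.
Qed.

Lemma level_sum_le_integral D (f : T -> \bar R) : measurable D ->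
  measurable_fun D f ->
  (forall x, D x -> \sum_(j < N) eps%:E * (\1_(A j) x)%:E <= f x) ->
  (\sum_(j < N) eps%:E * mu (A j `&` D)) <= \int[mu]_(x in D) f x.
Proof.
move=> mD mf hf; rewrite -integral_level_sum//; apply: ge0_le_integral => //.
- by move=> x _; exact: level_sum_ge0.
- exact: measurable_level_sum.
Qed.

End level_sum_integral.

Section friedrichs.
Context {R : realType} (s : nat).
Notation leb1 := (@lebesgue_measure R).
Notation m := s.+1.
Notation H := (@hausdorff R m.+1 s).
Notation S := (@surface R m.+1).
Variable (Omega : set 'rV[R]_m.+1) (M : R).
Hypotheses (oO : open Omega) (M0 : 0 < M) (OM : forall x i, Omega x -> `|x ord0 i| <= M).

Notation bd := (boundary Omega).
Notation tail := (fun x : 'rV[R]_m.+1 => (uncons_rV x).2).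

Let mO : measurable Omega := open_measurable_rV oO.

Lemma closed_box n (c : R) : closed [set x : 'rV[R]_n | forall i, `|x ord0 i| <= c].
Proof.
rewrite (_ : [set x | _] = \bigcap_(i in [set: 'I_n]) [set x : 'rV[R]_n | `|x ord0 i| <= c]).
  apply: closed_bigI => i _.
  apply: (@closed_comp _ _ (fun x : 'rV[R]_n => `|x ord0 i|) [set r | r <= c]); last exact: closed_le.
  by move=> x _; exact: (cvg_norm (@continuous_coord R n i x)).
by apply/seteqP; split => x h i; [move=> _; exact: h|exact: h].
Qed.

Lemma closure_box x i : closure Omega x -> `|x ord0 i| <= M.
Proof.
move=> cx; have : closure [set x : 'rV[R]_m.+1 | forall i, `|x ord0 i| <= M] x.
  by apply: closureS cx => y Oy j; exact: OM.
by rewrite -(closure_id _).1; [exact|exact: closed_box].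
Qed.

Lemma closed_boundary : closed bd.
Proof.
by rewrite /boundary setDE; apply: closedI; [exact: closed_closure|exact: open_closedC].
Qed.

Lemma closed_subset_box_compact n (A : set 'rV[R]_n) (c : R) : closed A ->
  (forall x i, A x -> `|x ord0 i| <= c) -> compact A.
Proof.
move=> cA Ac; apply: (subclosed_compact cA (@rV_compact R n (fun=> `[- c, c]%classic)
  (fun=> @segment_compact _ _ _))).
by move=> x Ax i /=; rewrite in_itv/= -ler_norml; exact: Ac.
Qed.

Lemma compact_boundary : compact bd.
Proof.
apply: (closed_subset_box_compact closed_boundary (c := M)) => x i [cx _].
exact: closure_box.
Qed.

Lemma continuous_tail : continuous tail.
Proof.
move=> x A /nbhs_ballP[e /= e0 eA]; apply/nbhs_ballP; exists e => //= y [_ xy].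
apply: eA; split => // i j; rewrite !mxE; exact: xy.
Qed.

Lemma measurable_tail_compact (A : set 'rV[R]_m.+1) : compact A -> measurable (tail @` A).
Proof.
move=> cA; apply: closed_measurable_rV; apply: compact_closed; first exact: norm_hausdorff.
by apply: continuous_compact => //; apply: continuous_subspaceT; exact: continuous_tail.
Qed.

Lemma cons_line (r : R) (v : 'rV[R]_m) :
  cons_rV (r, v) = cons_rV (0, v) + r *: basis_rV ord0.
Proof.
apply/rowP => j; rewrite !mxE; case: unliftP => [k ->|->] /=.
  by rewrite mulr0 addr0.
by rewrite add0r mulr1.
Qed.

Lemma open_slice (v : 'rV[R]_m) (r : R) : Omega (cons_rV (r, v)) ->
  exists2 e : R, 0 < e & forall r', `|r - r'| < e -> Omega (cons_rV (r', v)).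
Proof.
move=> Or; have /nbhs_ballP[e /= e0 eO] : nbhs (cons_rV (r, v)) Omega.
  exact: open_nbhs_nbhs.
exists e => // r' rr'; apply: eO; split => // i j; rewrite !mxE.
by case: unliftP => [k _|_] /=; [exact: ballxx|].
Qed.

(** [b] is the supremum of the parameters up to [t] at which the line is outside [Omega]. Openness
    puts the point itself outside, and it is a limit of points inside. *)
Lemma boundary_point_left (t : R) (v : 'rV[R]_m) : Omega (cons_rV (t, v)) ->
  exists b : R, [/\ b < t, - M <= b, bd (cons_rV (b, v)) &
    forall r, b < r <= t -> Omega (cons_rV (r, v))].
Proof.
move=> Ot; pose B := [set r : R | r <= t /\ ~ Omega (cons_rV (r, v))].
have c0 r : (cons_rV (r, v) : 'rV[R]_m.+1) ord0 ord0 = r by rewrite mxE unlift_none.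
have Mt : - M <= t by have := OM ord0 Ot; rewrite c0 ler_norml => /andP[].
have Bsup : has_sup B.
  split; last by exists t => r [].
  (* This parameter is outside the box, hence outside [Omega]. *)
  exists (- M - 1); split; first lra.
  by move/OM => /(_ ord0); rewrite c0 ler_norml => /andP[h _]; lra.
pose b := sup B.
have bt : b <= t by apply: ge_sup; [exact: Bsup.1|move=> r []].
have right r : b < r <= t -> Omega (cons_rV (r, v)).
  move=> /andP[br rt]; apply: contrapT => nO.
  have : r <= b by apply: ub_le_sup; [exact: Bsup.2|].
  by rewrite leNgt br.
have nOb : ~ Omega (cons_rV (b, v)).
  move=> /open_slice[e e0 eO].
  have [r Br rb] := sup_adherent e0 Bsup.
  have rlb : r <= b by apply: ub_le_sup; [exact: Bsup.2|].
  by apply: Br.2; apply: eO; rewrite ger0_norm ?subr_ge0//; move: rb; rewrite -/b; lra.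
have {}bt : b < t.
  by rewrite lt_neqAle bt andbT; apply/eqP => bt'; apply: nOb; rewrite bt'.
have cb : closure Omega (cons_rV (b, v)).
  move=> A /nbhs_ballP[e /= e0 eA].
  pose r := Num.min t (b + e / 2).
  have br : b < r by rewrite lt_min bt/= ltrDl divr_gt0.
  exists (cons_rV (r, v)); split.
    by apply: right; rewrite br/= ge_min lexx.
  apply: eA; split => // i j; rewrite !mxE.
  case: unliftP => [k _|_] /=; first exact: ballxx.
  rewrite /ball/= distrC gtr0_norm ?subr_gt0// ltrBlDl gt_min; apply/orP; right.
  by rewrite ltrD2l ltr_pdivrMr// ltr_pMr// ltr1n.
exists b; split => //.
by have := closure_box ord0 cb; rewrite c0 ler_norml => /andP[].
Qed.

Variables (w : 'rV[R]_m.+1 -> R) (sw : smooth w).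

Let dw := pderiv ord0 w.

Let energy (x : 'rV[R]_m.+1) : \bar R := (((dw x) ^+ 2)%:E * (\1_Omega x)%:E)%E.

Let menergy : measurable_fun setT energy.
Proof.
apply: emeasurable_funM.
  apply/measurable_EFinP; apply: measurable_funX; exact: smooth_pderiv_measurable.
by apply/measurable_EFinP; exact: measurable_indic.
Qed.

Let energy0 x : (0 <= energy x)%E.
Proof. by rewrite mule_ge0// lee_fin ?sqr_ge0. Qed.

(** [lebesgue_projection_le] is about sets; the superlevel sets of [w^2] on the boundary, which are
    compact, transfer it to functions. *)
Let level eps j : set 'rV[R]_m.+1 := bd `&` [set x | j.+1%:R * eps <= (w x) ^+ 2].

Let closed_level eps j : closed (level eps j).
Proof.
apply: closedI; first exact: closed_boundary.
apply: (@closed_comp _ _ (fun x => w x ^+ 2) [set r | j.+1%:R * eps <= r]); last exact: closed_ge.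
move=> x _; exact: (cvg_comp _ _ (smooth_continuous sw (x := x)) (@exprn_continuous _ 2 _)).
Qed.

Let mproj eps j : measurable (tail @` level eps j).
Proof.
apply: measurable_tail_compact; apply: (closed_subset_box_compact (@closed_level eps j) (c := M)).
by move=> x i [[cx _] _]; exact: closure_box.
Qed.

(* A measurable upper bound, up to [eps], for [w^2] at all the boundary points of the
   line through [v]; it only involves projections of compact sets. *)
Let trace_bound eps N (v : 'rV[R]_m) : \bar R :=
  (eps%:E + \sum_(j < N) eps%:E * (\1_(tail @` level eps j) v)%:E)%E.

(** Going left to the boundary point, [w(t)^2 <= 2 w(b)^2 + 2 (w(t) - w(b))^2], and the difference
    is controlled by the energy on a segment of length at most [2 M]. *)
Let pointwise eps N (t : R) (v : 'rV[R]_m) : 0 < eps ->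
  (forall x, bd x -> (w x) ^+ 2 <= N%:R * eps) -> Omega (cons_rV (t, v)) ->
  (((w (cons_rV (t, v))) ^+ 2)%:E <= 2%:E * trace_bound eps N v +
     (4 * M)%:E * \int[leb1]_r energy (cons_rV (r, v)))%E.
Proof.
move=> e0 wN Ot; have [b [bt Mb bdb bO]] := boundary_point_left Ot.
have tM : t <= M.
  by have := OM ord0 Ot; rewrite mxE unlift_none/= ler_norml => /andP[].
set wt := w (cons_rV (t, v)); set wb := w (cons_rV (b, v)).
have h1 : ((wb ^+ 2)%:E <= trace_bound eps N v)%E.
  have [_ _ /(_ (wN _ bdb))] := level_sum_bounds N (sqr_ge0 wb) e0.
  rewrite lerBlDl -lee_fin EFinD -sumEFin => /le_trans; apply.
  rewrite /trace_bound leeD2l//; apply: lee_sum => j _.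
  case: ifPn => hj; last by rewrite mule_ge0// lee_fin ltW.
  rewrite indicE mem_set ?mule1//; exists (cons_rV (b, v)); last by rewrite cons_rVK.
  by split.
have h2 : (((wt - wb) ^+ 2)%:E <= (2 * M)%:E * \int[leb1]_r energy (cons_rV (r, v)))%E.
  rewrite /wt /wb (cons_line t) (cons_line b).
  apply: (le_trans (line_diff_sq _ _ sw bt)).
  apply: lee_pmul; rewrite ?lee_fin ?subr_ge0 ?(ltW bt)//; [|lra|].
    by apply: integral_ge0 => r _; rewrite lee_fin sqr_ge0.
  have mdl : measurable_fun setT (fun r : R => ((dw (cons_rV (r, v))) ^+ 2)%:E).
    apply: (@measurable_slice2 _ _ (fun x => ((dw x) ^+ 2)%:E)).
    by apply/measurable_EFinP; apply: measurable_funX; exact: smooth_pderiv_measurable.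
  under eq_integral do rewrite -cons_line.
  rewrite -integral_itv_obnd_cbnd; last exact: measurable_funTS.
  rewrite (eq_integral (fun r => energy (cons_rV (r, v)))); last first.
    move=> r /set_mem; rewrite /= in_itv/= => /bO Or.
    by rewrite /energy indicE mem_set// mule1.
  apply: ge0_subset_integral => //.
  exact: (measurable_slice2 menergy).
have h3 : ((wt ^+ 2)%:E <= 2%:E * (wb ^+ 2)%:E + 2%:E * ((wt - wb) ^+ 2)%:E)%E.
  rewrite -!EFinM -EFinD lee_fin.
  by have := sqr_ge0 (wt - 2 * wb); nra.
apply: (le_trans h3); apply: leeD; first by rewrite lee_pmul2l.
apply: (@le_trans _ _ (2%:E * ((2 * M)%:E * \int[leb1]_r energy (cons_rV (r, v))))%E).
  by rewrite lee_pmul2l.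
by rewrite muleA -EFinM mulrA (_ : 2 * 2 = 4 :> R)//; ring.
Qed.

(** The left side is the integral of a step function lying below [w^2], by [level_sum_bounds]. *)
Let surface_level eps N : 0 < eps ->
  (\sum_(j < N) eps%:E * H (level eps j) <= \int[S]_(x in bd) ((w x) ^+ 2)%:E)%E.
Proof.
move=> e0.
have mlev j : measurable (level eps j : set (caratheodory_type H)).
  by apply: measurable_caratheodory; exact: closed_measurable_rV.
have mbd : measurable (bd : set (caratheodory_type H)).
  by apply: measurable_caratheodory; apply: closed_measurable_rV; exact: closed_boundary.
have mw2 : measurable_fun (bd : set (caratheodory_type H)) (fun x => ((w x) ^+ 2)%:E).
  apply/measurable_EFinP; apply: measurable_funX; apply: measurable_funTS.
  by apply: measurable_fun_caratheodory; exact: smooth_measurable.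
have := @level_sum_le_integral _ _ R S N (fun j => level eps j) eps mlev (ltW e0) _ _ mbd mw2.
have <- : (\sum_(j < N) eps%:E * H (level eps j) =
    \sum_(j < N) eps%:E * S (level eps j `&` bd))%E.
  apply: eq_bigr => j _; congr (_ * _)%E; congr (hausdorff _).
  by rewrite setIidl// => x [].
apply => x bx; have [h _ _] := level_sum_bounds N (sqr_ge0 (w x)) e0.
apply: (le_trans _ (_ : (_%:E <= _%:E)%E)); last by rewrite lee_fin; exact: h.
rewrite -sumEFin; apply: lee_sum => j _.
rewrite indicE; case: (boolP (x \in level eps j)) => [/set_mem[_ /= ->]|_].
  by rewrite mule1.
by rewrite mule0 lee_fin; case: ifP => // _; rewrite ltW.
Qed.

Lemma friedrichs : (\int[lebesgue_rV m.+1]_(x in Omega) ((w x) ^+ 2)%:E <=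
  (8 * M ^+ 2)%:E * \int[lebesgue_rV m.+1]_(x in Omega) ((dw x) ^+ 2)%:E +
  (4 * M * 2 ^+ m)%:E * \int[S]_(x in bd) ((w x) ^+ 2)%:E)%E.
Proof.
apply/lee_addgt0Pr => e e0.
(* The rounding error contributes [4 M eps (2 M)^m] in the end; [K] makes this equal to [e]. *)
pose K := 4 * M * (2 * M) ^+ m.
have K0 : 0 < K by rewrite /K !mulr_gt0// exprn_gt0// mulr_gt0.
pose eps := e / K.
have eps0 : 0 < eps by rewrite divr_gt0.
(* Enough levels for [w^2] never to exceed the cap [N eps] on the boundary. *)
have [N wN] : exists N : nat, forall x, bd x -> (w x) ^+ 2 <= N%:R * eps.
  have [c c0 wc] := continuous_compact_bounded compact_boundary (smooth_continuous sw).
  exists (Num.truncn (c ^+ 2 / eps)).+1 => x bx.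
  apply: (@le_trans _ _ (c ^+ 2)).
    by rewrite -[leLHS]real_normK ?num_real// lerXn2r ?nnegrE ?wc.
  by rewrite -ler_pdivrMr// ltW// truncnS_gt.
pose box := [set v : 'rV[R]_m | forall i, `|v ord0 i - (0 : 'rV[R]_m) ord0 i| <= M].
have mbox : measurable box by exact: measurable_cube.
(* The indicator of the box makes the constant [eps] in [trace_bound] integrable. *)
pose g (v : 'rV[R]_m) : \bar R := (2%:E * (trace_bound eps N v * (\1_box v)%:E) +
     (4 * M)%:E * \int[leb1]_r energy (cons_rV (r, v)))%E.
have mI : measurable_fun setT (fun v => \int[leb1]_r energy (cons_rV (r, v)))%E.
  exact: (@measurable_fun_fubini_tonelli_G _ _ _ _ R leb1 _ (measurable_comp_cons menergy) (fun=> energy0 _)).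
have mtb : measurable_fun setT (trace_bound eps N).
  apply: emeasurable_funD; first exact: measurable_cst.
  apply: emeasurable_sum => j; apply/measurable_EFinP; exact: measurable_funM.
have I0 v : (0 <= \int[leb1]_r energy (cons_rV (r, v)))%E by exact: integral_ge0.
have tb0 v : (0 <= trace_bound eps N v)%E.
  apply: adde_ge0; first by rewrite lee_fin ltW.
  by apply: sume_ge0 => j _; rewrite mule_ge0// lee_fin ltW.
have mtb1 : measurable_fun setT (fun v => trace_bound eps N v * (\1_box v)%:E)%E.
  by apply: emeasurable_funM => //; apply/measurable_EFinP; exact: measurable_indic.
have tb10 v : (0 <= trace_bound eps N v * (\1_box v)%:E)%E by rewrite mule_ge0// lee_fin.
have mg : measurable_fun setT g.
  by apply: emeasurable_funD; apply: emeasurable_funM => //; exact: measurable_cst.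
have g0 v : (0 <= g v)%E.
  by rewrite adde_ge0// mule_ge0// lee_fin mulr_ge0// ltW.
have mwO : measurable_fun setT ((fun x => ((w x) ^+ 2)%:E) \_ Omega).
  apply: (measurable_restrictT _ mO).1; apply: measurable_funTS.
  by apply/measurable_EFinP; apply: measurable_funX; exact: smooth_measurable.
have wO0 x : (0 <= ((fun x => ((w x) ^+ 2)%:E) \_ Omega) x)%E.
  by rewrite /patch; case: ifP => // _; rewrite lee_fin sqr_ge0.
have eI : (\int[lebesgue_rV m.+1]_(x in Omega) ((dw x) ^+ 2)%:E =
    \int[lebesgue_rV m]_v \int[leb1]_r energy (cons_rV (r, v)))%E.
  rewrite -ge0_integral_cons2// integral_mkcond; apply: eq_integral => x _.
  by rewrite /energy /patch indicE; case: ifP => _; rewrite ?mule1 ?mule0.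
have main : (\int[lebesgue_rV m.+1]_(x in Omega) ((w x) ^+ 2)%:E <=
    (2 * M)%:E * \int[lebesgue_rV m]_v g v)%E.
  rewrite integral_mkcond [leLHS]ge0_integral_cons2// -ge0_integralZl//; last first.
    by rewrite lee_fin mulr_ge0// ltW.
  apply: ge0_le_integral => //.
  - by move=> v _; exact: integral_ge0.
  - exact: (@measurable_fun_fubini_tonelli_G _ _ _ _ R leb1 _ (measurable_comp_cons mwO) (fun=> wO0 _)).
  - by apply: emeasurable_funM => //; exact: measurable_cst.
  move=> v _.
  (* The bound [g v] does not depend on [t], which ranges over an interval of length [2 M]. *)
  have -> : ((2 * M)%:E * g v = \int[leb1]_(t in `[(- M)%R, M]) cst (g v) t)%E.
    rewrite integral_cst; last exact: measurable_itv.
    rewrite [X in (_ = _ * X)%E](_ : _ = (2 * M)%:E) 1?muleC//.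
    have MM : - M < M by rewrite (lt_trans _ M0)// oppr_lt0.
    rewrite [LHS]lebesgue_measure_itv/= lte_fin MM.
    by rewrite -EFinD; congr EFin; ring.
  rewrite [leRHS]integral_mkcond; apply: ge0_le_integral => //.
  - exact: (measurable_slice2 mwO).
  - by apply: (measurable_restrictT _ _).1 => //; exact: measurable_itv.
  move=> t _; rewrite {1}/patch; case: ifPn => [/set_mem Ot|_]; last first.
    have h0 : (0 <= ((cst (g v)) \_ `[(- M)%R, M]) t)%E.
      by rewrite /patch; case: ifP => // _; exact: g0.
    exact: h0.
  have c0 : (cons_rV (t, v) : 'rV[R]_m.+1) ord0 ord0 = t by rewrite mxE unlift_none.
  rewrite /patch mem_set; last first.
    by rewrite /= in_itv/= -ler_norml -{1}c0; exact: OM.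
  apply: (le_trans (pointwise eps0 wN Ot)); rewrite /g /cst indicE mem_set ?mule1//.
  move=> i; rewrite mxE subr0; have := OM (lift ord0 i) Ot.
  by rewrite mxE liftK.
apply: (le_trans main).
have tbI : (\int[lebesgue_rV m]_v (trace_bound eps N v * (\1_box v)%:E) <=
    (eps * (2 * M) ^+ m)%:E + (2 ^+ m)%:E * \int[S]_(x in bd) ((w x) ^+ 2)%:E)%E.
  have e1 : (\int[lebesgue_rV m]_v (trace_bound eps N v * (\1_box v)%:E) <=
      \int[lebesgue_rV m]_v (eps%:E * (\1_box v)%:E +
        \sum_(j < N) eps%:E * (\1_(tail @` level eps j) v)%:E))%E.
    apply: ge0_le_integral => //.
    - apply: emeasurable_funD.
        by apply: emeasurable_funM; [exact: measurable_cst|apply/measurable_EFinP; exact: measurable_indic].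
      apply: emeasurable_sum => j; apply/measurable_EFinP; exact: measurable_funM.
    move=> v _; rewrite indicE; case: (v \in box); first by rewrite !mule1.
    rewrite !mule0 add0e; apply: sume_ge0 => j _; by rewrite mule_ge0// lee_fin ltW.
  apply: (le_trans e1).
  rewrite ge0_integralD//; last 4 first.
  - by move=> v _; rewrite mule_ge0// lee_fin ltW.
  - by apply: emeasurable_funM; [exact: measurable_cst|apply/measurable_EFinP; exact: measurable_indic].
  - by move=> v _; apply: sume_ge0 => j _; rewrite mule_ge0// lee_fin ltW.
  - apply: emeasurable_sum => j; apply/measurable_EFinP; exact: measurable_funM.
  apply: leeD.
    rewrite ge0_integralZl//; [|by apply/measurable_EFinP; exact: measurable_indic|by rewrite lee_fin ltW].
    rewrite integral_indic// setIT [X in (_ * X)%E]lebesgue_cube ?(ltW M0)//.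
  rewrite integral_level_sum//; last exact: ltW.
  apply: (@le_trans _ _ ((2 ^+ m)%:E * \sum_(j < N) eps%:E * H (level eps j))%E); last first.
    by rewrite lee_pmul2l ?lte_fin ?exprn_gt0//; exact: surface_level.
  rewrite ge0_sume_distrr; last first.
    by move=> j _; rewrite mule_ge0 ?outer_measure_ge0// lee_fin ltW.
  apply: lee_sum => j _; rewrite setIT muleCA lee_pmul2l//.
  by apply: lebesgue_projection_le; exact: mproj.
rewrite eI ge0_integralD//; last 4 first.
- by move=> v _; rewrite mule_ge0// lee_fin.
- by apply: emeasurable_funM => //; exact: measurable_cst.
- by move=> v _; rewrite mule_ge0// lee_fin mulr_ge0// ltW.
- by apply: emeasurable_funM => //; exact: measurable_cst.
rewrite ge0_integralZl// ge0_integralZl//; last by rewrite lee_fin mulr_ge0// ltW.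
move: tbI; set Z := (\int[lebesgue_rV m]_v (_ * _))%E.
set W := (\int[S]_(x in bd) _)%E; set I := (\int[lebesgue_rV m]_v \int[leb1]_r _)%E.
have Z0 : (0 <= Z)%E by exact: integral_ge0.
have W0 : (0 <= W)%E by apply: integral_ge0 => x _; rewrite lee_fin sqr_ge0.
have II0 : (0 <= I)%E by exact: integral_ge0.
move: Z W I Z0 W0 II0 => Z W I Z0 W0 II0 ZW.
have M2 : 0 <= 2 * M by rewrite mulr_ge0// ltW.
apply: (@le_trans _ _ ((2 * M)%:E * (2%:E * ((eps * (2 * M) ^+ m)%:E + (2 ^+ m)%:E * W) + (4 * M)%:E * I))%E).
  apply: lee_wpmul2l; first by rewrite lee_fin.
  by apply: leeD2r; apply: lee_wpmul2l.
have p0 : 0 <= eps * (2 * M) ^+ m by rewrite mulr_ge0 ?exprn_ge0// ltW.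
have q0 : 0 <= 2 ^+ m :> R by rewrite exprn_ge0.
have M4 : 0 <= 4 * M by rewrite mulr_ge0// ltW.
rewrite (ge0_muleDr 2%:E) ?mule_ge0 ?lee_fin//.
rewrite ge0_muleDr ?adde_ge0 ?mule_ge0 ?lee_fin//.
rewrite ge0_muleDr ?mule_ge0 ?lee_fin//.
rewrite !muleA -!EFinM.
rewrite (_ : 2 * M * (4 * M) = 8 * M ^+ 2); last by ring.
rewrite (_ : 2 * M * 2 * 2 ^+ m = 4 * M * 2 ^+ m); last by ring.
rewrite (_ : 2 * M * 2 * (eps * (2 * M) ^+ m) = e); last first.
  rewrite /eps /K; field.
  by rewrite (gt_eqF M0) andbT expf_neq0// gt_eqF// mulr_gt0.
by rewrite addeC (addeC e%:E) addeA.
Qed.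

End friedrichs.

(** * Traces and the Dirichlet-to-Neumann map *)

Section integral_without_measurability.
Context d (T : measurableType d) (R : realType) (mu : {measure set T -> \bar R}).
Local Open Scope ereal_scope.
Import HBNNSimple.

(* No measurability of [f] and [g]: the integral is a supremum over simple
   functions, which can be set to [0] on a null set. *)
Lemma ge0_ae_le_integral (D : set T) (f g : T -> \bar R) :
  (forall x, 0 <= f x) -> (forall x, 0 <= g x) ->
  {ae mu, forall x, D x -> f x = g x} ->
  \int[mu]_(x in D) f x <= \int[mu]_(x in D) g x.
Proof.
move=> f0 g0 [Z [mZ Z0 fgZ]]; rewrite [leLHS]ge0_integralE// [leRHS]ge0_integralE//.
apply: ge_ereal_sup => _ [h /= hf <-].
have mZC : measurable (~` Z) by exact: measurableC.
pose h' := mul_nnsfun h (indic_nnsfun R mZC).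
have h'E x : h' x = (h x * \1_(~` Z) x)%R by [].
apply: ereal_sup_ubound; exists h'.
  move=> x; rewrite h'E indicE; have [Zx|Zx] := boolP (x \in ~` Z); last first.
    by rewrite mulr0 /patch; case: ifP.
  rewrite mulr1; have := hf x; rewrite /patch; case: ifP => // /set_mem Dx.
  suff -> : f x = g x by [].
  by apply: contrapT => ne; move/set_mem: Zx; apply; apply: fgZ => /(_ Dx).
rewrite -!integralT_nnsfun; apply: ge0_ae_eq_integral => //.
- by apply/measurable_EFinP; exact: measurable_funP.
- by apply/measurable_EFinP; exact: measurable_funP.
- by move=> x _; rewrite lee_fin.
- by move=> x _; rewrite lee_fin.
- exists Z; split => //; move=> x hx; apply: contrapT => Zx; apply: hx.
  by move=> _; rewrite h'E indicE mem_set ?mulr1.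
Qed.

(** Used to change a tensor field on a null set when the measurability of the integrand is not
    known. *)
Lemma ae_eq_Rintegral (D : set T) (f g : T -> R) :
  {ae mu, forall x, D x -> f x = g x} ->
  (\int[mu]_(x in D) f x = \int[mu]_(x in D) g x)%R.
Proof.
move=> fg; have gf : {ae mu, forall x, D x -> g x = f x}.
  by apply: filterS fg => x h Dx; rewrite h.
congr fine; rewrite integralE [RHS]integralE; congr (_ - _).
  apply/eqP; rewrite eq_le; apply/andP; split; apply: ge0_ae_le_integral => //.
    by apply: filterS fg => x h Dx; rewrite !funeposE h.
  by apply: filterS gf => x h Dx; rewrite !funeposE h.
apply/eqP; rewrite eq_le; apply/andP; split; apply: ge0_ae_le_integral => //.
  by apply: filterS fg => x h Dx; rewrite !funenegE h.
by apply: filterS gf => x h Dx; rewrite !funenegE h.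
Qed.

End integral_without_measurability.

Section ereal_sequences.
Context {R : realType}.
Local Open Scope ereal_scope.

(** Surface integrals may a priori be infinite for the first indices; this form handles their
    convergence to zero without a separate finiteness argument. *)
Lemma ge0_cvge0P (u : nat -> \bar R) : (forall k, 0 <= u k) ->
  (u k @[k --> \oo] --> 0) <->
  (forall e : R, (0 < e)%R -> exists N : nat, forall k, (N <= k)%N -> u k <= e%:E).
Proof.
move=> u0; split => [/fine_cvgP[[N1 _ h1] /cvgrPdist_le h2] e e0|h].
  have [N2 _ h3] := h2 _ e0; exists (maxn N1 N2) => k; rewrite geq_max => /andP[k1 k2].
  have := h3 k k2; rewrite /= sub0r normrN => h4; rewrite -(fineK (h1 k k1)) lee_fin.
  exact: le_trans (ler_norm _) h4.
have [N1 h1] := h 1%R ltr01.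
apply/(@fine_cvgP R nat \oo _ u 0%R); split.
  by exists N1 => // k /= Nk; rewrite ge0_fin_numE// (le_lt_trans (h1 k Nk))// ltry.
apply/cvgrPdist_le => e e0; have [N2 h2] := h e e0.
exists N2 => // k /= Nk; rewrite sub0r normrN ger0_norm ?fine_ge0//.
by rewrite -lee_fin fineK ?h2// ge0_fin_numE// (le_lt_trans (h2 k Nk))// ltry.
Qed.

End ereal_sequences.

Section square_integrable_pairing.
Context d (T : measurableType d) (R : realType) (mu : {measure set T -> \bar R}).
Variables (D : set T) (mD : measurable D).
Implicit Types f g : T -> R.

Lemma sqint_cauchy_schwarz f g : sqint mu D f -> sqint mu D g ->
  (\int[mu]_(x in D) (f x * g x)) ^+ 2 <= nrm2 mu D f * nrm2 mu D g.
Proof.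
move=> sf sg; have [_ If] := (sqintP _ _ _).1 sf; have [_ Ig] := (sqintP _ _ _).1 sg.
have Ifg := sqint_prod mD sf sg.
apply: quadratic_ge0; [exact: nrm2_ge0|exact: nrm2_ge0|move=> r].
have := nrm2_ge0 mu D (fun x => f x + r * g x); congr (0 <= _).
have I1 : mu.-integrable D (EFin \o (fun x => 2 * r * (f x * g x))).
  by have := integrableZl mD (2 * r) Ifg; apply: eq_integrable.
have I2 : mu.-integrable D (EFin \o (fun x => r ^+ 2 * (g x ^+ 2))).
  by have := integrableZl mD (r ^+ 2) Ig; apply: eq_integrable.
rewrite /nrm2 -RintegralZl// -RintegralZl// -RintegralD// -RintegralD//; last first.
  by have := integrableD mD If I1; apply: eq_integrable.
by apply: eq_Rintegral => x _; ring.
Qed.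

Lemma nrm2_cvg_Rintegral (f : nat -> T -> R) f0 g :
  (forall k, sqint mu D (f k)) -> sqint mu D f0 -> sqint mu D g ->
  nrm2 mu D (fun x => f k x - f0 x) @[k --> \oo] --> (0 : R) ->
  \int[mu]_(x in D) (f k x * g x) @[k --> \oo] --> \int[mu]_(x in D) (f0 x * g x).
Proof.
move=> sf sf0 sg cf.
suff h : \int[mu]_(x in D) (f k x * g x) - \int[mu]_(x in D) (f0 x * g x)
    @[k --> \oo] --> (0 : R).
  rewrite -[X in _ --> X]add0r.
  rewrite (_ : (fun k => _) = fun k => (\int[mu]_(x in D) (f k x * g x) -
      \int[mu]_(x in D) (f0 x * g x)) + \int[mu]_(x in D) (f0 x * g x)); last first.
    by apply/funext => k; rewrite subrK.
  by apply: cvgD h _; exact: cvg_cst.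
apply: (@cvg0_sq _ _ (fun k => nrm2 mu D (fun x => f k x - f0 x) * nrm2 mu D g)).
  move=> k; rewrite -RintegralB//; [|exact: sqint_prod|exact: sqint_prod].
  have := sqint_cauchy_schwarz (sqintB mD (sf k) sf0) sg; apply: le_trans.
  rewrite le_eqVlt; apply/orP; left; apply/eqP; congr (_ ^+ 2).
  by apply: eq_Rintegral => x _; rewrite mulrBl.
by rewrite -[X in _ --> X](mul0r (nrm2 mu D g)); apply: cvgM => //; exact: cvg_cst.
Qed.

(** The analogue of [nrm2D_le] for extended values, meant for the boundary, whose surface measure is
    not shown to be finite. *)
Lemma integral_sqD_le f g (a : R) : measurable_fun D f -> measurable_fun D g ->
  (\int[mu]_(x in D) ((f x + a * g x) ^+ 2)%:E <=
   2%:E * \int[mu]_(x in D) ((f x) ^+ 2)%:E +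
   (2 * a ^+ 2)%:E * \int[mu]_(x in D) ((g x) ^+ 2)%:E)%E.
Proof.
move=> mf mg.
have mf2 : measurable_fun D (fun x => ((f x) ^+ 2)%:E).
  by apply/measurable_EFinP; exact: measurable_funX.
have mg2 : measurable_fun D (fun x => ((g x) ^+ 2)%:E).
  by apply/measurable_EFinP; exact: measurable_funX.
have a0 : 0 <= 2 * a ^+ 2 by rewrite mulr_ge0// sqr_ge0.
have sq0 (h : T -> R) x : (0 <= ((h x) ^+ 2)%:E)%E by rewrite lee_fin sqr_ge0.
rewrite -ge0_integralZl// -ge0_integralZl//.
have mzf : measurable_fun D (fun x => 2%:E * ((f x) ^+ 2)%:E)%E.
  by apply: emeasurable_funM => //; exact: measurable_cst.
have mzg : measurable_fun D (fun x => (2 * a ^+ 2)%:E * ((g x) ^+ 2)%:E)%E.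
  by apply: emeasurable_funM => //; exact: measurable_cst.
rewrite -ge0_integralD//; last 2 first.
- by move=> x _; rewrite mule_ge0.
- by move=> x _; rewrite mule_ge0.
apply: ge0_le_integral => //.
- by move=> x _; rewrite lee_fin sqr_ge0.
- apply/measurable_EFinP; apply: measurable_funX; apply: measurable_funD => //.
  by apply: measurable_funM => //; exact: measurable_cst.
- exact: emeasurable_funD.
move=> x _; rewrite -!EFinM -EFinD lee_fin.
rewrite -subr_ge0; have := sqr_ge0 (f x - a * g x); congr (0 <= _).
by ring.
Qed.

End square_integrable_pairing.

Section traces.
Context {R : realType} (s : nat).
Notation m := s.+1.
Notation leb := (@lebesgue_rV R m.+1).
Notation S := (@surface R m.+1).
Notation H := (@hausdorff R m.+1 s).
Notation field := ('rV[R]_m.+1 -> 'rV[R]_m.+1).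
Variable (Omega : set 'rV[R]_m.+1) (M : R).
Hypotheses (oO : open Omega) (M0 : 0 < M) (OM : forall x i, Omega x -> `|x ord0 i| <= M).
Notation bd := (boundary Omega).
Implicit Types (u v w phi g h : 'rV[R]_m.+1 -> R) (G F K : field).

Let mO : measurable Omega := open_measurable_rV oO.

Let mbd : measurable (bd : set (caratheodory_type H)).
Proof.
apply: measurable_caratheodory; apply: closed_measurable_rV.
exact: closed_boundary.
Qed.

Lemma lebesgue_Omega_lty : (leb Omega < +oo)%E.
Proof.
have mB := @measurable_cube R m.+1 0 M.
apply: (@le_lt_trans _ _ (leb [set x : 'rV[R]_m.+1 | forall i, `|x ord0 i - (0 : 'rV[R]_m.+1) ord0 i| <= M])).
  apply: le_measure; rewrite ?inE//= => x Ox i.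
  by rewrite mxE subr0; exact: OM.
by rewrite [X in (X < _)%E]lebesgue_cube ?ltry// ltW.
Qed.

Lemma continuous_Omega_sqint (f : 'rV[R]_m.+1 -> R) : continuous f -> sqint leb Omega f.
Proof.
move=> cf.
have [c c0 fc] := continuous_compact_bounded (closed_subset_box_compact
  (@closed_box R m.+1 M) (fun x i Bx => Bx i)) cf.
apply: (@bounded_sqint _ _ Omega f c mO lebesgue_Omega_lty).
  by apply: measurable_funTS; exact: continuous_measurable_rV.
by move=> x Ox; apply: fc => i; exact: OM.
Qed.

Lemma smooth_Omega_sqint w : smooth w -> sqint leb Omega w.
Proof. by move=> sw; apply: continuous_Omega_sqint; exact: smooth_continuous. Qed.

Lemma smooth_pderiv_Omega_sqint w i : smooth w -> sqint leb Omega (pderiv i w).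
Proof. by move=> sw; apply: continuous_Omega_sqint; exact: smooth_pderiv_continuous. Qed.

Lemma smooth_surface_measurable w : smooth w ->
  measurable_fun (bd : set (caratheodory_type H)) (w : caratheodory_type H -> R).
Proof.
move=> sw; apply: measurable_funTS; apply: measurable_fun_caratheodory.
exact: smooth_measurable.
Qed.

(** Borel measurability on the boundary, as provided by [L2_boundary], passes to the Caratheodory
    sigma-algebra of [hausdorff]. *)
Lemma L2_boundary_sqint g : L2_boundary Omega g -> sqint S bd g.
Proof.
move=> [mg ig]; split; last exact: ig.
move=> _ Y mY; apply: measurable_caratheodory.
exact: (mg (closed_measurable_rV (closed_boundary oO)) Y mY).
Qed.

Lemma L2_boundary0 : L2_boundary Omega (fun=> 0).
Proof. by split; [exact: measurable_cst|exact: (@sqint0 _ _ R S bd).2]. Qed.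

Lemma weak_gradientD u v G F (a : R) : sqint leb Omega u -> sqint leb Omega v ->
  L2vec leb Omega G -> L2vec leb Omega F ->
  weak_gradient Omega u G -> weak_gradient Omega v F ->
  weak_gradient Omega (fun x => u x + a * v x) (G + a *: F).
Proof.
move=> su sv sG sF wu wv i phi tphi; have [sphi _] := tphi.
have sp := smooth_Omega_sqint sphi; have sdp := smooth_pderiv_Omega_sqint i sphi.
have lin f h r : sqint leb Omega f -> sqint leb Omega h -> sqint leb Omega r ->
    \int[leb]_(x in Omega) ((f x + a * h x) * r x) =
    \int[leb]_(x in Omega) (f x * r x) + a * \int[leb]_(x in Omega) (h x * r x).
  move=> sf sh sr.
  have Ih := sqint_prod mO sh sr.
  rewrite -RintegralZl// -RintegralD//; last 2 first.
  - exact: sqint_prod.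
  - by have := integrableZl mO a Ih; apply: eq_integrable.
  by apply: eq_Rintegral => x _; ring.
rewrite (lin _ _ _ su sv sdp) wu// wv//.
rewrite (_ : \int[leb]_(x in Omega) ((G + a *: F) x ord0 i * phi x) =
    \int[leb]_(x in Omega) ((G x ord0 i + a * F x ord0 i) * phi x)); last first.
  by apply: eq_Rintegral => x _; rewrite ?fctE !mxE.
by rewrite (lin _ _ _ (sG i) (sF i) sp); ring.
Qed.

Lemma has_traceD u v G F g h (a : R) : has_trace Omega u G g -> has_trace Omega v F h ->
  has_trace Omega (fun x => u x + a * v x) (G + a *: F) (fun x => g x + a * h x).
Proof.
move=> [[su sG wu] bg [wk [swk cu cG cg]]] [[sv sF wv] bh [zk [szk cv cF ch]]].
have swk' k := smooth_Omega_sqint (swk k); have szk' k := smooth_Omega_sqint (szk k).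
have sdw i k := smooth_pderiv_Omega_sqint i (swk k).
have sdz i k := smooth_pderiv_Omega_sqint i (szk k).
split.
- split; [exact: sqintD|exact: L2vecD|exact: weak_gradientD].
- have [bg' bh'] := (L2_boundary_sqint bg, L2_boundary_sqint bh).
  split; last exact: (@sqintD _ _ R S bd mbd g h a bg' bh').2.
  apply: measurable_funD; first exact: bg.1.
  by apply: measurable_funM; [exact: measurable_cst|exact: bh.1].
exists (fun k x => wk k x + a * zk k x); split.
- by move=> k; exact: smoothD.
- apply/(L2_cvgP mO (fun k => sqintD mO a (swk' k) (szk' k)) (sqintD mO a su sv)).
  exact: (nrm2_cvgD mO a swk' szk' su sv ((L2_cvgP mO swk' su).1 cu) ((L2_cvgP mO szk' sv).1 cv)).
- move=> i.
  rewrite (_ : (fun k => _) = fun k x => pderiv i (wk k) x + a * pderiv i (zk k) x); last first.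
    by apply/funext => k; rewrite smooth_pderivD.
  rewrite (_ : (fun x => _) = fun x => G x ord0 i + a * F x ord0 i); last first.
    by apply/funext => x; rewrite ?fctE !mxE.
  apply/(L2_cvgP mO (fun k => sqintD mO a (sdw i k) (sdz i k)) (sqintD mO a (sG i) (sF i))).
  exact: (nrm2_cvgD mO a (sdw i) (sdz i) (sG i) (sF i) ((L2_cvgP mO (sdw i) (sG i)).1 (cG i))
    ((L2_cvgP mO (sdz i) (sF i)).1 (cF i))).
- have pos (f r : 'rV[R]_m.+1 -> R) : (0 <= \int[S]_(x in bd) ((f x - r x) ^+ 2)%:E)%E.
    by apply: integral_ge0 => x _; rewrite lee_fin sqr_ge0.
  apply/ge0_cvge0P => [k|e e0]; first exact: pos.
  (* This quantity times [2 + 2 a^2] is [e]. *)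
  have e1 : 0 < e / (2 * (1 + a ^+ 2)).
    by rewrite divr_gt0// mulr_gt0// ltr_pwDl// sqr_ge0.
  have [N1 h1] := (ge0_cvge0P (fun k => pos (wk k) g)).1 cg _ e1.
  have [N2 h2] := (ge0_cvge0P (fun k => pos (zk k) h)).1 ch _ e1.
  exists (maxn N1 N2) => k; rewrite geq_max => /andP[k1 k2].
  have mw : measurable_fun (bd : set (caratheodory_type H)) (fun x => wk k x - g x).
    by apply: measurable_funB; [exact: smooth_surface_measurable|exact: (L2_boundary_sqint bg).1].
  have mz : measurable_fun (bd : set (caratheodory_type H)) (fun x => zk k x - h x).
    by apply: measurable_funB; [exact: smooth_surface_measurable|exact: (L2_boundary_sqint bh).1].
  rewrite [leLHS](_ : _ = \int[S]_(x in bd) (((wk k x - g x) + a * (zk k x - h x)) ^+ 2)%:E)%E; last first.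
    by apply: eq_integral => x _; congr (_%:E); ring.
  apply: (le_trans (integral_sqD_le S mbd a mw mz)).
  have a2 : 0 <= 2 * a ^+ 2 by rewrite mulr_ge0// sqr_ge0.
  apply: (@le_trans _ _ (2%:E * (e / (2 * (1 + a ^+ 2)))%:E +
      (2 * a ^+ 2)%:E * (e / (2 * (1 + a ^+ 2)))%:E)%E).
    apply: leeD; apply: lee_wpmul2l; rewrite ?lee_fin//.
      exact: h1.
    exact: h2.
  rewrite -!EFinM -EFinD lee_fin le_eqVlt; apply/orP; left; apply/eqP; field.
  by rewrite gt_eqF// ltr_pwDl// sqr_ge0.
Qed.

Lemma has_traceB u v G F g h : has_trace Omega u G g -> has_trace Omega v F h ->
  has_trace Omega (fun x => u x - v x) (G - F) (fun x => g x - h x).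
Proof.
move=> tu tv; have := has_traceD (-1) tu tv; rewrite scaleN1r.
rewrite (_ : (fun x => u x + _) = fun x => u x - v x); last first.
  by apply/funext => x; rewrite mulN1r.
by rewrite (_ : (fun x => g x + _) = fun x => g x - h x)//; apply/funext => x; rewrite mulN1r.
Qed.

Definition trace_gradient : set field := [set F | exists v, has_trace Omega v F (fun=> 0)].

Lemma has_trace_L2 u G g : has_trace Omega u G g -> L2vec leb Omega G.
Proof. by move=> [[]]. Qed.

Lemma trace_gradient_L2 : trace_gradient `<=` @L2vec _ _ R leb Omega m.+1.
Proof. by move=> F [v]; exact: has_trace_L2. Qed.

Lemma trace_gradientD G F (a : R) : trace_gradient G -> trace_gradient F ->
  trace_gradient (G + a *: F).
Proof.
move=> [u tu] [v tv]; exists (fun x => u x + a * v x).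
have := has_traceD a tu tv; congr (has_trace _ _ _ _).
by apply/funext => x; rewrite mulr0 addr0.
Qed.

Lemma trace_gradient0 : trace_gradient 0.
Proof.
have s0 : sqint leb Omega (fun=> 0) by exact: sqint0.
have int0 dd (T : measurableType dd) (mu : {measure set T -> \bar R}) (D : set T) :
    (\int[mu]_(x in D) (((0 : R) - 0) ^+ 2)%:E)%E @[k --> \oo] --> 0%E.
  under eq_fun do (under eq_integral do rewrite subrr expr0n/=).
  by under eq_fun do rewrite integral0; exact: cvg_cst.
exists (fun=> 0); split.
- split; [exact: s0|exact: L2vec0|].
  move=> i phi _; rewrite (_ : \int[_]_(x in _) (0 * _) = 0); last first.
    by under eq_Rintegral do rewrite mul0r; rewrite Rintegral_cst ?mul0r.
  by under eq_Rintegral do rewrite mxE mul0r; rewrite Rintegral_cst ?mul0r ?oppr0.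
- exact: L2_boundary0.
exists (fun _ _ => 0); split.
- by move=> k; exact: smooth_cst.
- exact: int0.
- move=> i; rewrite /L2_cvg pderiv_cst.
  by under eq_fun do (under eq_integral do rewrite mxE); exact: int0.
- exact: int0.
Qed.

Lemma has_trace_approx v F (e : R) : has_trace Omega v F (fun=> 0) -> 0 < e ->
  exists w, [/\ smooth w, nrm2 leb Omega (fun x => w x - v x) <= e,
    \sum_i nrm2 leb Omega (fun x => pderiv i w x - F x ord0 i) <= e &
    (\int[S]_(x in bd) ((w x) ^+ 2)%:E <= e%:E)%E].
Proof.
move=> [[sv sF _] _ [w [sw cv cF c0]]] e0.
have sw' k := smooth_Omega_sqint (sw k).
have sdw i k := smooth_pderiv_Omega_sqint i (sw k).
have [N1 h1] := cvg0_ex_le ((L2_cvgP mO sw' sv).1 cv) e0.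
have := @cvgr_sum R _ (index_enum 'I_m.+1)
  (fun i k => nrm2 leb Omega (fun x => pderiv i (w k) x - F x ord0 i)) (fun=> 0).
rewrite [\sum_(i <- _) 0]big1// => /(_ _)/cvg0_ex_le/(_ e0) [|N2 h2].
  by move=> i; exact: ((L2_cvgP mO (sdw i) (sF i)).1 (cF i)).
have pos k : (0 <= \int[S]_(x in bd) ((w k x - 0) ^+ 2)%:E)%E.
  by apply: integral_ge0 => x _; rewrite lee_fin sqr_ge0.
have [N3 h3] := (ge0_cvge0P pos).1 c0 _ e0.
pose N := maxn N1 (maxn N2 N3); exists (w N); split => //.
- by apply: h1; rewrite leq_maxl.
- by apply: h2; rewrite (leq_trans (leq_maxl _ N3)) ?leq_maxr.
- have := h3 N; rewrite (leq_trans (leq_maxr N2 _)) ?leq_maxr// => /(_ isT).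
  by under eq_integral do rewrite subr0.
Qed.

(** As on the cell, smooth approximations are shown to be Cauchy, now by Friedrichs' inequality for
    their differences; the surface term is small because each of them is nearly zero on the
    boundary. *)
Lemma trace_gradient_complete (F : nat -> field) :
  (forall k, trace_gradient (F k)) ->
  (forall e : R, 0 < e -> exists N : nat, forall k l, (N <= k)%N -> (N <= l)%N ->
     ip leb Omega (F k - F l) (F k - F l) <= e) ->
  exists2 G, trace_gradient G & ip leb Omega (F k - G) (F k - G) @[k --> \oo] --> (0 : R).
Proof.
move=> VF cF; have sF k := trace_gradient_L2 (VF k).
have [G sG cG] := L2vec_complete mO sF cF; exists G => //.
have /choice[v tv] := VF.
have /choice[w wP] : forall k, exists w, [/\ smooth w,
    nrm2 leb Omega (fun x => w x - v k x) <= k.+1%:R^-1,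
    \sum_i nrm2 leb Omega (fun x => pderiv i w x - F k x ord0 i) <= k.+1%:R^-1 &
    (\int[S]_(x in bd) ((w x) ^+ 2)%:E <= (k.+1%:R^-1)%:E)%E].
  by move=> k; apply: has_trace_approx (tv k) _; rewrite invr_gt0.
have sw k : smooth (w k) by have [] := wP k.
have sv k : sqint leb Omega (v k) by have [[]] := tv k.
have sw' k := smooth_Omega_sqint (sw k).
have sdw i k := smooth_pderiv_Omega_sqint i (sw k).
have wv : nrm2 leb Omega (fun x => w k x - v k x) @[k --> \oo] --> (0 : R).
  by apply: harmonic_cvg0 => k; rewrite nrm2_ge0/=; have [] := wP k.
have wF i : nrm2 leb Omega (fun x => pderiv i (w k) x - F k x ord0 i) @[k --> \oo] --> (0 : R).
  apply: harmonic_cvg0 => k; rewrite nrm2_ge0/=; have [_ _ + _] := wP k; apply: le_trans.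
  by rewrite (bigD1 i)//= lerDl sumr_ge0// => *; exact: nrm2_ge0.
have FG i : nrm2 leb Omega (fun x => F k x ord0 i - G x ord0 i) @[k --> \oo] --> (0 : R).
  apply: squeeze_cvgr cG; last exact: cvg_cst.
  apply: nearW => k; rewrite nrm2_ge0/=.
  have := nrm2_le_ip mO i (L2vecB mO (sF k) sG); apply: le_trans.
  rewrite le_eqVlt; apply/orP; left; apply/eqP; apply: eq_Rintegral => x _.
  by rewrite ?fctE !mxE.
have wG i : nrm2 leb Omega (fun x => pderiv i (w k) x - G x ord0 i) @[k --> \oo] --> (0 : R).
  exact: (nrm2_cvg_trans mO (fun k => sF k i) (sdw i) (sG i) (FG i) (wF i)).
pose Q k := \sum_i nrm2 leb Omega (fun x => pderiv i (w k) x - G x ord0 i).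
(* The term [1/(k+1)] accounts for the boundary values of [w k]. *)
pose E k := Q k + k.+1%:R^-1.
have Q0 k : 0 <= Q k by apply: sumr_ge0 => *; exact: nrm2_ge0.
have E0 : E k @[k --> \oo] --> (0 : R).
  rewrite -[X in _ --> X](addr0 0); apply: cvgD; last exact: cvg_harmonic.
  have := @cvgr_sum R _ (index_enum 'I_m.+1)
    (fun i k => nrm2 leb Omega (fun x => pderiv i (w k) x - G x ord0 i)) (fun=> 0) wG.
  by rewrite [\sum_(i <- _) 0]big1.
(* The two constants of [friedrichs] together, doubled by the squared triangle inequalities. *)
pose C := (8 * M ^+ 2 + 4 * M * 2 ^+ m) * 2.
have C1 : 0 <= 8 * M ^+ 2 by rewrite mulr_ge0// sqr_ge0.
have C2 : 0 <= 4 * M * 2 ^+ m by rewrite !mulr_ge0 ?exprn_ge0// ltW.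
have C0 : 0 <= C by rewrite mulr_ge0// addr_ge0.
have [v0 sv0 cv0] : exists2 v0, sqint leb Omega v0 &
    nrm2 leb Omega (fun x => w k x - v0 x) @[k --> \oo] --> (0 : R).
  apply: (@poincare_cauchy _ _ _ _ _ mO w E C C0 sw' E0) => k l.
  have swl : smooth (fun x => w k x + (-1) * w l x) by exact: smoothD.
  have fr := friedrichs oO M0 OM swl.
  have e1 : nrm2 leb Omega (fun x => w k x - w l x) = nrm2 leb Omega (fun x => w k x + (-1) * w l x).
    by apply: eq_Rintegral => x _; rewrite mulN1r.
  rewrite e1 -lee_fin -(EFin_nrm2 mO (smooth_Omega_sqint swl)).
  apply: (le_trans fr); rewrite (EFin_nrm2 mO (smooth_pderiv_Omega_sqint ord0 swl)).
  have h1 : nrm2 leb Omega (pderiv ord0 (fun x => w k x + (-1) * w l x)) <=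
      2 * (Q k + Q l).
    rewrite smooth_pderivD//.
    have e2 : nrm2 leb Omega (fun x => pderiv ord0 (w k) x + (-1) * pderiv ord0 (w l) x) =
        nrm2 leb Omega (fun x => pderiv ord0 (w k) x - pderiv ord0 (w l) x).
      by apply: eq_Rintegral => x _; rewrite mulN1r.
    rewrite e2; apply: (le_trans (nrm2_triangle mO (sdw ord0 k) (sG ord0) (sdw ord0 l))).
    rewrite mulrDr; apply: lerD; rewrite ler_wpM2l//.
      by rewrite /Q (bigD1 ord0)//= lerDl sumr_ge0// => *; exact: nrm2_ge0.
    by rewrite /Q (bigD1 ord0)//= lerDl sumr_ge0// => *; exact: nrm2_ge0.
  have h2 : (\int[S]_(x in bd) ((w k x + (-1) * w l x) ^+ 2)%:E <=
      (2 * (k.+1%:R^-1 + l.+1%:R^-1))%:E)%E.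
    apply: (le_trans (integral_sqD_le S mbd (-1) (smooth_surface_measurable (sw k))
      (smooth_surface_measurable (sw l)))).
    rewrite sqrrN expr1n mulr1 (_ : (2 * (k.+1%:R^-1 + l.+1%:R^-1))%:E =
      2%:E * (k.+1%:R^-1)%:E + 2%:E * (l.+1%:R^-1)%:E)%E; last first.
      by rewrite -!EFinM -EFinD mulrDr.
    by apply: leeD; apply: lee_wpmul2l; rewrite ?lee_fin//; [have [] := wP k|have [] := wP l].
  apply: (@le_trans _ _ ((8 * M ^+ 2)%:E *
     (2 * (Q k + Q l))%:E +
      (4 * M * 2 ^+ m)%:E * (2 * (k.+1%:R^-1 + l.+1%:R^-1))%:E)%E).
    by apply: leeD; apply: lee_wpmul2l; rewrite ?lee_fin.
  rewrite -!EFinM -EFinD lee_fin /C /E.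
  have p0 := Q0 k; have q0 := Q0 l.
  have a0 : 0 <= k.+1%:R^-1 :> R by rewrite invr_ge0.
  have b0 : 0 <= l.+1%:R^-1 :> R by rewrite invr_ge0.
  move: (Q k) (Q l) (k.+1%:R^-1) (l.+1%:R^-1) (8 * M ^+ 2) (4 * M * 2 ^+ m) p0 q0 a0 b0 C1 C2.
  move=> p q a b c1 c2 p0 q0 a0 b0 C1 C2; rewrite -subr_ge0.
  rewrite (_ : _ - _ = 2 * (c1 * (a + b) + c2 * (p + q))); last by ring.
  by rewrite mulr_ge0// addr_ge0// mulr_ge0// addr_ge0.
(* The weak gradient identity is available for [v k], not for [w k], so the limit is also needed
   along the [v k]. *)
have vv0 : nrm2 leb Omega (fun x => v k x - v0 x) @[k --> \oo] --> (0 : R).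
  apply: (nrm2_cvg_trans mO sw' sv sv0 cv0).
  rewrite (_ : (fun k => _) = fun k => nrm2 leb Omega (fun x => w k x - v k x))//.
  by apply/funext => k; apply: eq_Rintegral => x _; ring.
exists v0; split.
- split; [exact: sv0|exact: sG|].
  move=> i phi tphi; have [sphi _] := tphi.
  have c1 := nrm2_cvg_Rintegral mO sv sv0 (smooth_pderiv_Omega_sqint i sphi) vv0.
  have c2 := nrm2_cvg_Rintegral mO (fun k => sF k i) (sG i) (smooth_Omega_sqint sphi) (FG i).
  have e k : \int[leb]_(x in Omega) (v k x * pderiv i phi x) =
      - \int[leb]_(x in Omega) (F k x ord0 i * phi x).
    by have [[_ _ wg] _ _] := tv k; exact: wg.
  have := c1; under eq_fun do rewrite e; move=> c3.
  by apply: (cvg_unique (@Rhausdorff R) c3); exact: cvgN.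
- exact: L2_boundary0.
exists w; split => //.
- exact/(L2_cvgP mO sw' sv0).
- by move=> i; apply/(L2_cvgP mO (sdw i) (sG i)).
- have pos k : (0 <= \int[S]_(x in bd) ((w k x - 0) ^+ 2)%:E)%E.
    by apply: integral_ge0 => x _; rewrite lee_fin sqr_ge0.
  apply/(ge0_cvge0P pos) => e e0.
  have [N NP] := cvg0_ex_le (@cvg_harmonic R) e0; exists N => k Nk.
  under eq_integral do rewrite subr0.
  have [_ _ _ h] := wP k; apply: (le_trans h); rewrite lee_fin; exact: NP.
Qed.

Section dirichlet_to_neumann.
Variables (al be : R) (al0 : 0 < al) (be0 : 0 < be).
Variables (u0 g : 'rV[R]_m.+1 -> R) (G0 : field) (v0 phi : 'rV[R]_m.+1 -> R) (H0 : field).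
Hypotheses (tu0 : has_trace Omega u0 G0 g) (tv0 : has_trace Omega v0 H0 phi).
Implicit Type B : 'rV[R]_m.+1 -> 'M[R]_m.+1.

Let V := trace_gradient.
Let sG0 := has_trace_L2 tu0.
Let sH0 := has_trace_L2 tv0.

Lemma dirichlet_field_exists B : tensor leb Omega B al be ->
  exists N, variational leb Omega V B G0 N.
Proof.
move=> tB; exact: (variational_exists mO trace_gradient_L2 trace_gradient0
  trace_gradientD trace_gradient_complete al0 be0 tB sG0).
Qed.

Lemma dirichlet_variational B u G : dirichlet_solution Omega B g u G ->
  variational leb Omega V B G0 G.
Proof.
move=> [tu hG]; split; last by move=> K [v tv]; exact: (hG v).
exists (fun x => u x - u0 x); have := has_traceB tu tu0.
by congr (has_trace _ _ _ _); apply/funext => x; rewrite subrr.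
Qed.

(** The flux of a solution is orthogonal to [V], so the extension of [phi] chosen by [get] can be
    exchanged for [v0]; the choice of the solution is settled by [variational_output_unique]. *)
Lemma DtNE B N : tensor leb Omega B al be -> variational leb Omega V B G0 N ->
  DtN Omega B g phi = frm leb Omega B N H0.
Proof.
move=> tB vN; rewrite /DtN; set P := [set r | _].
have [v tv] : V (N - G0) := vN.1.
have : P (get P).
  apply: getPex; exists (frm leb Omega B N H0).
  exists (fun x => u0 x + 1 * v x), N, v0, H0; split => //; split.
    have := has_traceD 1 tu0 tv; rewrite scale1r addrC subrK.
    by congr (has_trace _ _ _ _); apply/funext => x; rewrite mulr0 addr0.
  by move=> v' K tK; apply: vN.2; exists v'.
move=> [u [G [v' [K [dG tK ->]]]]].
have vG := dirichlet_variational dG.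
have sG := variational_L2 mO trace_gradient_L2 sG0 vG.
have sK := has_trace_L2 tK.
have VK : V (K - H0).
  exists (fun x => v' x - v0 x); have := has_traceB tK tv0.
  by congr (has_trace _ _ _ _); apply/funext => x; rewrite subrr.
rewrite (variational_output_unique mO trace_gradient_L2 trace_gradientD al0 be0 tB sG0 sH0 vN vG).
have := frmDr mO be0 tB (-1) sK sH0 sG; rewrite scaleN1r mulN1r vG.2//.
by move=> /esym/eqP; rewrite subr_eq0 => /eqP.
Qed.

Lemma DtN_bound B : tensor leb Omega B al be ->
  (DtN Omega B g phi) ^+ 2 <=
  be ^+ 2 * (be / al) ^+ 2 * ip leb Omega G0 G0 * ip leb Omega H0 H0.
Proof.
move=> tB; have [N vN] := dirichlet_field_exists tB; rewrite (DtNE tB vN).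
exact: (variational_output_bound mO trace_gradient_L2 al0 be0 tB sG0 sH0 vN).
Qed.

Lemma DtN_cvg (Bk : nat -> 'rV[R]_m.+1 -> 'M[R]_m.+1) B :
  (forall k, tensor leb Omega (Bk k) al be) -> tensor leb Omega B al be ->
  {ae leb, forall x, Omega x -> forall i j, Bk k x i j @[k --> \oo] --> B x i j} ->
  DtN Omega (Bk k) g phi @[k --> \oo] --> DtN Omega B g phi.
Proof.
move=> tBk tB cB.
have /choice[Nk vNk] := fun k => dirichlet_field_exists (tBk k).
have [N vN] := dirichlet_field_exists tB.
rewrite (DtNE tB vN); under eq_fun do rewrite (DtNE (tBk _) (vNk _)).
exact: (variational_cvg mO trace_gradient_L2 trace_gradientD al0 be0 tBk tB sG0 sH0 vNk vN cB).
Qed.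

End dirichlet_to_neumann.

End traces.

(** The two sets of candidate values coincide, so [get] returns the same one. *)
Lemma DtN_ae_eq {R : realType} {d : nat} (Omega : set 'rV[R]_d)
  (B B' : 'rV[R]_d -> 'M[R]_d) (g phi : 'rV[R]_d -> R) :
  {ae lebesgue_rV d, forall x, Omega x -> B x = B' x} ->
  DtN Omega B g phi = DtN Omega B' g phi.
Proof.
move=> BB.
have e (G H : 'rV[R]_d -> 'rV[R]_d) :
    \int[lebesgue_rV d]_(x in Omega) bform (B x) (G x) (H x) =
    \int[lebesgue_rV d]_(x in Omega) bform (B' x) (G x) (H x).
  by apply: ae_eq_Rintegral; apply: filterS BB => x h Ox; rewrite h.
rewrite /DtN; congr get; apply/seteqP; split => r [u [G [v [H [[tu hG] tv ->]]]]];
  exists u, G, v, H; split; rewrite ?e//; split => // v' K tK; [rewrite -e|rewrite e];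
  exact: (hG v').
Qed.

(** * The homogenized observation operator *)

Section operator_bound.
Context {R : realType} {n : nat}.

(** A crude operator norm: each coordinate is at most [n c |xi|], and the Euclidean norm at most [n]
    times a common bound on the coordinates. *)
Lemma entry_operator_bound (B : 'M[R]_n) (c : R) (xi : 'rV[R]_n) : 0 <= c ->
  (forall i j, `|B i j| <= c) -> enorm (xi *m B^T) <= n%:R * (n%:R * c) * enorm xi.
Proof.
move=> c0 Bc; set C := n%:R * c * enorm xi.
have C0 : 0 <= C by rewrite !mulr_ge0// enorm_ge0.
have coord i : `|(xi *m B^T) ord0 i| <= C.
  rewrite mxE (le_trans (ler_norm_sum _ _ _))//.
  apply: (@le_trans _ _ (\sum_(j < n) c * enorm xi)).
    apply: ler_sum => j _; rewrite normrM mxE mulrC.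
    by apply: ler_pM => //; exact: coord_le_enorm.
  by rewrite sumr_const card_ord -mulr_natl mulrA.
have nC0 : 0 <= n%:R * C by rewrite mulr_ge0.
rewrite -mulrA -[n%:R * c * enorm xi]/C -(@ler_sqr R) ?nnegrE ?enorm_ge0//.
rewrite (enorm_sq (xi *m B^T)).
apply: (@le_trans _ _ (\sum_(j < n) C ^+ 2)).
  apply: ler_sum => j _; rewrite -expr2 -real_normK ?num_real//.
  by rewrite ler_sqr ?nnegrE.
rewrite sumr_const card_ord -[X in X <= _]mulr_natl (@exprMn _ 2 n%:R C) ler_wpM2r ?sqr_ge0//. 
by rewrite -natrX ler_nat; case: (n) => // k; rewrite leq_pmulr.
Qed.

End operator_bound.

(** If the limit failed, each ball of radius [1/(k+1)] would contain a bad point of [D]; sequences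
    with this explicit rate therefore suffice. *)
Lemma sequential_within_cvg {R : realType} (X : normedModType R) (D : set X) (f : X -> R)
    (p : X) (l : R) :
  (forall u : nat -> X, (forall k, D (u k)) -> (forall k, `|u k - p| <= k.+1%:R^-1) ->
    f (u k) @[k --> \oo] --> l) ->
  f x @[x --> within D (nbhs p)] --> l.
Proof.
move=> h; apply/cvgrPdist_lt => e e0; apply: contrapT => nh.
have /choice[u uP] : forall k : nat, exists x,
    [/\ D x, `|x - p| <= k.+1%:R^-1 & ~ (`|l - f x| < e)].
  move=> k; apply: contrapT => nx; apply: nh.
  rewrite near_withinE; apply/nbhs_ballP; exists k.+1%:R^-1 => /=.
    by rewrite invr_gt0.
  move=> x; rewrite -ball_normE/= => px Dx; apply: contrapT => nf; apply: nx.
  by exists x; split => //; rewrite distrC ltW.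
have Du k : D (u k) by have [] := uP k.
have up k : `|u k - p| <= k.+1%:R^-1 by have [] := uP k.
have /cvgrPdist_lt/(_ _ e0)[N _ hN] := h u Du up.
by have [_ _] := uP N; apply; exact: hN (leqnn N).
Qed.

Lemma cvg_of_harmonic {R : realType} (u : nat -> R) (p : R) :
  (forall k, `|u k - p| <= k.+1%:R^-1) -> u k @[k --> \oo] --> p.
Proof.
move=> up; apply/subr_cvg0/norm_cvg0P; apply: harmonic_cvg0 => k.
by rewrite normr_ge0/=.
Qed.

Section clamp.
Context {R : realType}.
Variables (a b : R).

Definition clamp (t : R) : R := Num.max a (Num.min b t).

Lemma clamp_itv t : a <= b -> a <= clamp t <= b.
Proof. by move=> ab; rewrite /clamp le_max lexx/= ge_max ab ge_min lexx. Qed.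

Lemma clamp_id t : a <= t <= b -> clamp t = t.
Proof. by move=> /andP[at_ tb]; rewrite /clamp (min_idPr _)// (max_idPr _). Qed.

Lemma continuous_clamp : continuous clamp.
Proof.
move=> t; apply: (@continuous_max _ R^o (fun=> a) (fun t => Num.min b t)); first exact: cvg_cst.
by apply: (@continuous_min _ R^o (fun=> b) id); [exact: cvg_cst|exact: cvg_id].
Qed.

End clamp.

Section homogenized_family.
Context {R : realType} {n : nat}.
Notation leb := (@lebesgue_rV R n).
Notation cell := (@cell R n).
Variables (sm sp al be E1 : R) (A dtA : R -> 'rV[R]_n -> 'M[R]_n).
Hypotheses (smsp : sm <= sp) (al0 : 0 < al) (be0 : 0 < be).
Hypothesis A_sym : forall t y, sm <= t <= sp -> (A t y)^T = A t y.
Hypothesis hA : forall i j, W1oo_time sm sp (fun t y => A t y i j) (fun t y => dtA t y i j) E1.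
Hypothesis A_elliptic : forall t, sm <= t <= sp ->
  {ae leb, forall y : 'rV[R]_n, cell y -> forall xi : 'rV[R]_n,
     al * enorm xi ^+ 2 <= bform (A t y) xi xi /\
     enorm (xi *m (A t y)^T) <= be * enorm xi}.

(** Truncating [t] gives a function that is continuous on the line, so its composition with any
    measurable [sigma] is measurable, whatever the values of [sigma] on a null set. *)
Definition hom_family (t : R) : 'M[R]_n := hom_tensor (A (clamp sm sp t)).

Let clampP t := clamp_itv t smsp.

Lemma time_tensor t : sm <= t <= sp -> tensor leb cell (A t) al be.
Proof.
move=> tI; split; first by move=> i j; exact: (W1oo_time_measurable (hA i j) tI).
- by apply: aeW => y _; exact: A_sym.
- exact: A_elliptic.
Qed.

Lemma continuous_hom_family i j : continuous (fun t => hom_family t i j).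
Proof.
move=> t.
suff : hom_family x i j @[x --> within setT (nbhs t)] --> hom_family t i j by rewrite withinET.
apply: (@sequential_within_cvg R R^o) => u _ /cvg_of_harmonic ut.
apply: (hom_tensor_cvg al0 be0 (A := A (clamp sm sp t)) (Ak := fun k => A (clamp sm sp (u k)))) => [k||]; [exact/time_tensor/clampP|exact/time_tensor/clampP|].
have cu : clamp sm sp (u k) @[k --> \oo] --> clamp sm sp t.
  by apply: continuous_cvg => //; exact: continuous_clamp.
have h i' j' := W1oo_time_cvg (hA i' j') (clampP t) (fun k => clampP (u k)) cu.
have h2 i' : {ae leb, forall y, forall j', cell y ->
    A (clamp sm sp (u k)) y i' j' @[k --> \oo] --> A (clamp sm sp t) y i' j'}.
  exact: filter_forall.
have h3 : {ae leb, forall y, forall i' j', cell y ->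
    A (clamp sm sp (u k)) y i' j' @[k --> \oo] --> A (clamp sm sp t) y i' j'}.
  exact: filter_forall.
by apply: filterS h3 => y hy cy i' j'; exact: hy.
Qed.



Lemma hom_family_tensor (D : set 'rV[R]_n) (sigma : 'rV[R]_n -> R) :
  measurable_fun D sigma ->
  tensor leb D (fun x => hom_family (sigma x)) al (n%:R * (n%:R * (be * (be / al)))).
Proof.
move=> ms; have tA t := time_tensor (clampP t).
split.
- move=> i j; exact: (measurableT_comp (continuous_measurable_fun (@continuous_hom_family i j)) ms).
- by apply: aeW => x _; exact: (hom_tensor_sym al0 be0 (tA (sigma x))).
- apply: aeW => x _ xi; split; first exact: (hom_tensor_elliptic al0 be0 xi (tA (sigma x))).
  apply: entry_operator_bound => [|i j]; last exact: (hom_tensor_bound al0 be0 i j (tA (sigma x))).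
  by rewrite mulr_ge0 ?divr_ge0 ?(ltW al0) ?(ltW be0).
Qed.

End homogenized_family.

(** * The norm weighted by the inverse covariance *)

Section covariance_norm.
Context {R : realType} {N : nat}.
Variable (C : 'M[R]_N).
Hypothesis hC : covariance_matrix C.
Implicit Types u v w : 'cV[R]_N.

Let q u v : R := (u^T *m invmx C *m v) ord0 ord0.

Lemma cov_formE u v : q u v = \sum_i \sum_j u i ord0 * invmx C i j * v j ord0.
Proof.
rewrite /q mxE exchange_big/=; apply: eq_bigr => j _.
by rewrite mxE mulr_suml; apply: eq_bigr => i _; rewrite mxE.
Qed.

Let qC u v : q u v = q v u.
Proof.
have [Cs _ Cu] := hC.
have e : u^T *m invmx C *m v = (v^T *m invmx C *m u)^T.
  by rewrite !trmx_mul trmxK trmx_inv Cs mulmxA.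
by rewrite /q e mxE.
Qed.

Let qDl u v w (a : R) : q (u + a *: v) w = q u w + a * q v w.
Proof. by rewrite /q linearD linearZ/= mulmxDl mulmxDl -!scalemxAl !mxE. Qed.

(** [v^T C^-1 v] is the quadratic form of [C] at [C^-1 v], by the symmetry of [C]. *)
Let q_ge0 v : 0 <= q v v.
Proof.
have [Cs C0 Cu] := hC.
have := C0 (invmx C *m v); congr (0 <= fun_of_matrix _ _ _).
by rewrite trmx_mul trmx_inv Cs -!mulmxA (mulmxA C) mulmxV// mul1mx mulmxA.
Qed.

Lemma norm_cov_ge0 v : 0 <= norm_cov C v.
Proof. exact: sqrtr_ge0. Qed.

Lemma norm_cov_sq v : norm_cov C v ^+ 2 = q v v.
Proof. by rewrite sqr_sqrtr ?q_ge0. Qed.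

Lemma norm_covD u v : norm_cov C (u + v) <= norm_cov C u + norm_cov C v.
Proof.
rewrite -ler_sqr ?nnegrE ?addr_ge0 ?norm_cov_ge0// sqrrD !norm_cov_sq.
have lin x y z (a : R) (_ _ _ : True) : q (x + a *: y) z = q x z + a * q y z by exact: qDl.
have sym x y (_ _ : True) : q x y = q y x by exact: qC.
have pos x (_ : True) : 0 <= q x x by exact: q_ge0.
have St (x y : 'cV[R]_N) (a : R) (_ _ : True) : True by [].
have := @sip_sq _ _ setT q St sym lin u v 1 I I; rewrite scale1r => ->.
rewrite expr1n mul1r mulr1; apply: lerD => //; apply: lerD => //.
rewrite mulr_natl ler_wMn2r//; apply: le_trans (ler_norm _) _.
rewrite -ler_sqr ?nnegrE ?mulr_ge0 ?norm_cov_ge0// real_normK ?num_real//.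
rewrite exprMn !norm_cov_sq.
exact: (@sip_cauchy_schwarz _ _ setT q St sym lin pos u v I I).
Qed.

Lemma norm_covN v : norm_cov C (- v) = norm_cov C v.
Proof. by rewrite /norm_cov [(- v)^T]linearN/= mulmxN !mulNmx opprK. Qed.

Lemma norm_cov_bounded (b : R) :
  exists2 c : R, 0 <= c & forall v, (forall i, `|v i ord0| <= b) -> norm_cov C v <= c.
Proof.
exists (Num.sqrt (\sum_i \sum_j b * `|invmx C i j| * b)); first exact: sqrtr_ge0.
move=> v vb; rewrite ler_wsqrtr// -/(q v v) cov_formE.
apply: ler_sum => i _; apply: ler_sum => j _.
rewrite (le_trans (ler_norm _))// !normrM.
by apply: ler_pM; rewrite ?mulr_ge0//; apply: ler_wpM2r.
Qed.

Lemma norm_cov_sq_cvg (u : nat -> 'cV[R]_N) v :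
  (forall i, u k i ord0 @[k --> \oo] --> v i ord0) ->
  norm_cov C (u k) ^+ 2 @[k --> \oo] --> norm_cov C v ^+ 2.
Proof.
move=> uv; rewrite norm_cov_sq cov_formE.
under eq_fun do rewrite norm_cov_sq cov_formE.
apply: (@cvgr_sum R _ _ (fun i k => \sum_j u k i ord0 * invmx C i j * u k j ord0)) => i.
apply: (@cvgr_sum R _ _ (fun j k => u k i ord0 * invmx C i j * u k j ord0)) => j.
by apply: cvgM => //; apply: cvgM => //; exact: cvg_cst.
Qed.

End covariance_norm.

(** * Level sets of a Gaussian random function *)

(** Integrating the measures of the sections in either order gives the product measure of [E], and a
    nonnegative function of zero integral vanishes almost everywhere. *)
Lemma tonelli_null_sections {R : realType} d1 d2 (T1 : measurableType d1) (T2 : measurableType d2)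
    (m1 : {sigma_finite_measure set T1 -> \bar R})
    (m2 : {sigma_finite_measure set T2 -> \bar R}) (E : set (T1 * T2)) :
  measurable E -> {ae m2, forall y, m1 (ysection E y) = 0%E} ->
  {ae m1, forall x, m2 (xsection E x) = 0%E}.
Proof.
move=> mE h.
have mx := measurable_fun_xsection m2 mE; have my := measurable_fun_ysection m1 mE.
have e : (\int[m1]_x (m2 \o xsection E) x = \int[m2]_y (m1 \o ysection E) y)%E.
  apply: (@product_measure_unique _ _ _ _ _ m1 m2 (product_measure2 m1 m2)) => // B C mB mC.
  exact: product_measure2E.
have z : (\int[m2]_y (m1 \o ysection E) y = 0)%E.
  have /(ae_eq_integral_abs m2 measurableT my) <- : ae_eq m2 setT (m1 \o ysection E) (cst 0%E).
    by apply: filterS h => y hy _; exact: hy.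
  by apply: eq_integral => y _; rewrite gee0_abs.
have : ae_eq m1 setT (m2 \o xsection E) (cst 0%E).
  apply/(ae_eq_integral_abs m1 measurableT mx); rewrite -z -e.
  by apply: eq_integral => y _; rewrite gee0_abs.
by apply: filterS => x hx; exact: hx.
Qed.

Section evaluation.
Context {R : realType} {T : topologicalType} {K : set T}.
Notation X := (@C0 R T K).

(** Packaged as a linear map because [gaussian] speaks of continuous linear functionals. *)
Definition C0_eval (x : T) (theta : X) : R^o := theta x.

Let C0_eval_linear x : linear (C0_eval x).
Proof. by []. Qed.

HB.instance Definition _ x := GRing.isLinear.Build R X R^o _ (C0_eval x) (C0_eval_linear x).

Lemma C0_evalB_le (f g : X) x : `|f x - g x| <= `|f - g|.
Proof.
have [Kx|nKx] := pselect (K x); first exact: (C0_norm_ub (f - g) Kx).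
have /asboolP[_ _ f0] := C0_funP f; have /asboolP[_ _ g0] := C0_funP g.
by rewrite f0// g0// subrr normr0.
Qed.

Lemma continuous_C0_eval x : continuous (C0_eval x).
Proof.
move=> f; apply/(@cvgrPdist_lt R R^o X (nbhs f) _ (C0_eval x) (f x)) => e e0; apply/nbhs_ballP; exists e => //= g.
rewrite -ball_normE/= => fg; exact: le_lt_trans (C0_evalB_le f g x) fg.
Qed.

Lemma measurable_C0_eval x :
  measurable_fun setT (fun theta : @borel_C0 R T K => (theta : X) x).
Proof.
apply: (measurability _ (RGenOInfty.measurableE R)) => //.
move=> _ [_ [a ->] <-]; rewrite setTI; apply: sub_sigma_algebra.
have := @open_comp X R^o (C0_eval x) `]a, +oo[%classic; apply.
  by move=> f _; exact: continuous_C0_eval.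
exact: interval_open.
Qed.

End evaluation.

Lemma cvg_dyadic_point {R : realType} {n : nat} (x : 'rV[R]_n) :
  dyadic_point k (dyadic_floor k x) @[k --> \oo] --> x.
Proof.
have g0 : geometric 1 2^-1 n @[n --> \oo] --> (0 : R).
  by apply: cvg_geometric; rewrite ger0_norm ?invr_ge0//; lra.
apply/cvg_ballP => e e0.
move/cvgrPdist_lt : g0 => /(_ _ e0); apply: filterS => k /=.
rewrite sub0r normrN mul1r exprVn ger0_norm ?invr_ge0 ?exprn_ge0// => ke.
split => // i j; rewrite ord1 /ball/=.
exact: le_lt_trans (dyadic_close k x j) ke.
Qed.

Section level_sets.
Context {R : realType} {d : nat}.
Variable Omega : set 'rV[R]_d.
Hypothesis oO : open Omega.
Notation K := (closure Omega).
Notation X := (@C0 R _ K).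
Notation leb := (lebesgue_rV d).
Variable mu : probability (@borel_C0 R _ K) R.
Hypotheses (gmu : gaussian mu) (ndmu : nondegenerate_prior mu).

Let mO : measurable Omega := open_measurable_rV oO.

Lemma C0_continuous_at (theta : X) x : Omega x -> {for x, continuous theta}.
Proof.
move=> Ox; have /asboolP[ct _ _] := C0_funP theta.
have := continuous_subspaceW (@subset_closure _ Omega) ct.
by rewrite continuous_open_subspace// => /(_ x); apply; rewrite inE.
Qed.

(** At scale [k], evaluating at the corner of the dyadic cell of [x] involves countably many points
    and is thus jointly measurable. These maps converge for [x] in [Omega], where [theta] is
    continuous. *)
Lemma measurable_joint_eval : measurable_fun (setT `*` Omega)
  (fun p : @borel_C0 R _ K * 'rV[R]_d => (p.1 : X) p.2).
Proof.
apply: (@measurable_fun_cvg _ _ R _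
  (fun k (p : @borel_C0 R _ K * 'rV[R]_d) => (p.1 : X) (dyadic_point k (dyadic_floor k p.2)))).
  move=> k; apply: measurable_funTS => _ Y mY; rewrite setTI.
  rewrite (_ : _ @^-1` Y = \bigcup_z (((fun theta : @borel_C0 R _ K => (theta : X) (dyadic_point k z)) @^-1` Y)
      `*` (dyadic_floor k @^-1` [set z]))).
    apply: countable_bigcupT_measurable; first exact: countableP.
    move=> z; apply: measurableX; last exact: measurable_dyadic_floor.
    by rewrite -[X in measurable X]setTI; exact: measurable_C0_eval.
  apply/seteqP; split => [[theta x] /= Yx|[theta x] [z _ [/= Yx zx]]].
    by exists (dyadic_floor k x).
  by rewrite /= zx.
move=> [theta x] [_ /= Ox].
apply: (continuous_cvg _ (C0_continuous_at Ox)); exact: cvg_dyadic_point.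
Qed.

(** The law of [theta x] is a Dirac mass or a normal law with [s != 0]. The former is excluded by
    [nondegenerate_prior], and the latter is absolutely continuous. *)
Lemma eval_atomless : {ae leb, forall x, Omega x ->
  forall c, mu [set theta : X | theta x = c] = 0%E}.
Proof.
apply: filterS ndmu => x nd Ox c.
have [m [s h]] := gmu (@continuous_C0_eval R _ K x).
have hs (r : R) : mu [set theta : X | theta x = r] =
    if s == 0 then \d_m [set r] else normal_prob m s [set r].
  exact: (h [set r]).
have [s0|s0] := eqVneq s 0.
  by have := nd Ox m; rewrite hs s0 eqxx diracE mem_set.
rewrite hs (negbTE s0).
have /null_content_dominatesP := @normal_prob_dominates R m s.
by apply => //; exact: lebesgue_measure_set1.
Qed.

Lemma level_set_null (c : R) :
  {ae mu, forall theta : X, {ae leb, forall x, Omega x -> theta x <> c}}.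
Proof.
(* The sections of [E] at [theta] are the level sets within [Omega]; those at [x] are the events of
   [eval_atomless]. *)
pose E : set (@borel_C0 R _ K * 'rV[R]_d) :=
  (setT `*` Omega) `&` ((fun p => (p.1 : X) p.2) @^-1` [set c]).
have mE : measurable E.
  by apply: measurable_joint_eval => //; apply: measurableX.
have xE theta : xsection E theta = [set x | Omega x /\ (theta : X) x = c].
  apply/seteqP; split => x; rewrite /xsection/= inE; first by move=> [[_ Ox] e].
  by move=> [Ox e].
suff : {ae leb, forall x, mu (ysection E x) = 0%E}.
  move=> /(tonelli_null_sections mE); apply: filterS => theta h.
  exists (xsection E theta); split => //; first exact: measurable_xsection.
  by move=> x /= /not_implyP[Ox /contrapT e]; rewrite xE.
apply: filterS eval_atomless => x h.
have [Ox|nOx] := pselect (Omega x).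
  rewrite -(h Ox c); congr (mu _); apply/seteqP; split => theta; rewrite /ysection/= inE.
    by move=> [_].
  by move=> e; split.
rewrite (_ : ysection E x = set0) ?measure0//.
by apply/seteqP; split => // theta; rewrite /ysection/= inE => -[[_]].
Qed.

End level_sets.

(** * Almost sure continuity of the priors *)

Section prior_continuity.
Context {R : realType} {d : nat}.
Variable Omega : set 'rV[R]_d.
Hypothesis oO : open Omega.
Notation K := (closure Omega).
Notation X := (@C0 R _ K).
Notation leb := (lebesgue_rV d).

(** Away from equality, comparison with a finite threshold is locally constant; with an infinite one
    it is constant. *)
Lemma near_threshold (t : nat -> R) (t0 : R) (e : \bar R) :
  t k @[k --> \oo] --> t0 -> e <> t0%:E ->
  \forall k \near \oo, (e <= (t k)%:E)%E = (e <= t0%:E)%E.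
Proof.
case: e => [r| |] tt0 et; last 2 first.
- by apply: nearW => k; rewrite !leye_eq.
- by apply: nearW => k; rewrite !leNye.
have [rt|tr|rt] := ltgtP r t0; last by case: et; rewrite rt.
- near=> k; have h : r < t k by near: k; exact: (cvgr_gt _ tt0).
  by rewrite !lee_fin (ltW h) (ltW rt).
- near=> k; have h : t k < r by near: k; exact: (cvgr_lt _ tt0).
  by rewrite !lee_fin !leNgt h tr.
Unshelve. all: by end_near. Qed.

(** Off the thresholds, each indicator is eventually constant along the sequence. *)
Lemma prior_level_cvg n (c : nat -> \bar R) (f : 'I_n -> X) (u : nat -> X) (theta : X) x :
  u k x @[k --> \oo] --> theta x -> (forall i, c i <> (theta x)%:E) ->
  prior_level c f (u k) x @[k --> \oo] --> prior_level c f theta x.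
Proof.
move=> ux cx.
pose A (v : X) (i : 'I_n) := [set y | Omega y /\ (c i <= (v y)%:E < c i.+1)%E].
apply: (@cvgr_sum R _ _ (fun i k => f i x * \1_(A (u k) i) x) (fun i => f i x * \1_(A theta i) x)) => i.
apply: cvgMr; apply: cvg_near_cst.
have h1 := near_threshold ux (cx i); have h2 := near_threshold ux (cx i.+1).
near=> k; rewrite !indicE.
have e1 : (c i <= (u k x)%:E)%E = (c i <= (theta x)%:E)%E by near: k.
have e2 : (c i.+1 <= (u k x)%:E)%E = (c i.+1 <= (theta x)%:E)%E by near: k.
have e : (c i <= (u k x)%:E < c i.+1)%E = (c i <= (theta x)%:E < c i.+1)%E.
  by rewrite e1 !ltNge e2.
congr (nat_of_bool _)%:R; apply/idP/idP => /set_mem[Ox h]; apply/mem_set; split => //.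
  by rewrite -e.
by rewrite e.
Unshelve. all: by end_near. Qed.

(** The order of the quantifiers matters: for the level prior the exceptional [theta] are those with
    a level set of positive measure at some threshold, a countable union of null events fixed before
    [u] is chosen. *)
Lemma prior_ae_cvg (mu : probability (@borel_C0 R _ K) R) (P : X -> 'rV[R]_d -> R) :
  gaussian mu -> P = @prior_exp R d Omega \/ is_level_prior P ->
  (is_level_prior P -> nondegenerate_prior mu) ->
  {ae mu, forall theta : X, forall u : nat -> X,
    (forall k, `|u k - theta| <= k.+1%:R^-1) ->
    {ae leb, forall x, Omega x -> P (u k) x @[k --> \oo] --> P theta x}}.
Proof.
move=> gmu hP ndP.
have pointwise (theta : X) (u : nat -> X) x : (forall k, `|u k - theta| <= k.+1%:R^-1) ->
    u k x @[k --> \oo] --> theta x.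
  move=> ut; apply: cvg_of_harmonic => k.
  exact: le_trans (C0_evalB_le _ _ x) (ut k).
case: hP => [->|lP].
  apply: aeW => theta u ut; apply: aeW => x _; rewrite /prior_exp.
  by apply: continuous_cvg; [exact: continuous_expR|exact: pointwise].
have ndmu := ndP lP; have [n [c [f [_ _ _ _ ->]]]] := lP.
(* [fine] sends infinite thresholds to 0, which merely adds one more level to avoid. *)
have hmu : {ae mu, forall theta : X, forall i : nat,
    {ae leb, forall x, Omega x -> theta x <> fine (c i)}}.
  by apply: ae_foralln => i; exact: level_set_null.
apply: (@filterS _ (almost_everywhere mu) _ _ _ _ hmu) => theta hc u ut.
have := ae_foralln hc; apply: filterS => x hx Ox.
apply: prior_level_cvg; first exact: pointwise.
by move=> i ci; apply: (hx i Ox); rewrite ci.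
Qed.

End prior_continuity.

Lemma bounded_coord {R : realType} {n : nat} (D : set 'rV[R]_n.+1) : bounded_set D ->
  exists2 M : R, 0 < M & forall x i, D x -> `|x ord0 i| <= M.
Proof.
move=> /pinfty_ex_gt0[M M0 hM]; exists M => // x i Dx; apply: le_trans (hM _ Dx).
rewrite [leRHS]mx_normrE.
exact: (le_bigmax _ (fun ij : 'I_1 * 'I_n.+1 => `|x ij.1 ij.2|) (ord0, i)).
Qed.

Lemma misfit_cvg {R : realType} {N : nat} (C : 'M[R]_N) (z w : 'cV[R]_N) (v : nat -> 'cV[R]_N) :
  covariance_matrix C -> (forall i, v k i ord0 @[k --> \oo] --> w i ord0) ->
  2^-1 * norm_cov C (z - v k) ^+ 2 @[k --> \oo] --> 2^-1 * norm_cov C (z - w) ^+ 2.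
Proof.
move=> hC vw; apply: cvgMr; apply: (norm_cov_sq_cvg hC) => i; rewrite !mxE.
under eq_fun do rewrite !mxE.
by apply: cvgB; [exact: cvg_cst|exact: vw].
Qed.

(** * Boundedness and convergence of the observations *)

Section observation.
Context {R : realType} (s : nat).
Notation d := s.+2.
Notation leb := (@lebesgue_rV R d).
Notation cell := (@cell R d).
Variables (Omega : set 'rV[R]_d) (M : R).
Hypotheses (oO : open Omega) (M0 : 0 < M) (OM : forall x i, Omega x -> `|x ord0 i| <= M).
Variables (sm sp al be E1 : R) (A dtA : R -> 'rV[R]_d -> 'M[R]_d).
Hypotheses (smsp : sm <= sp) (al0 : 0 < al) (be0 : 0 < be).
Hypothesis A_sym : forall t y, sm <= t <= sp -> (A t y)^T = A t y.
Hypothesis hA : forall i j, W1oo_time sm sp (fun t y => A t y i j) (fun t y => dtA t y i j) E1.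
Hypothesis A_elliptic : forall t, sm <= t <= sp ->
  {ae leb, forall y : 'rV[R]_d, cell y -> forall xi : 'rV[R]_d,
     al * enorm xi ^+ 2 <= bform (A t y) xi xi /\
     enorm (xi *m (A t y)^T) <= be * enorm xi}.
Variables (J L : nat) (phi : 'I_J -> 'rV[R]_d -> R) (g : 'I_L -> 'rV[R]_d -> R).
Hypotheses (phi_H12 : forall j, H12 Omega (phi j)) (g_H12 : forall l, H12 Omega (g l)).
Implicit Types sigma : 'rV[R]_d -> R.

Let be' : R := d%:R * (d%:R * (be * (be / al))).

Let be'0 : 0 < be'.
Proof. by rewrite /be' !mulr_gt0 ?invr_gt0 ?ltr0n//. Qed.

Lemma DtN_hom_family sigma h psi : admissible Omega sm sp sigma ->
  DtN Omega (fun x => hom_tensor (A (sigma x))) h psi =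
  DtN Omega (fun x => hom_family sm sp A (sigma x)) h psi.
Proof.
move=> [_ sI]; apply: DtN_ae_eq; apply: filterS sI => x hx Ox.
by rewrite /hom_family clamp_id// hx.
Qed.

Lemma obs0E sigma j l : obs0 Omega A phi g sigma (mxvec_index j l) ord0 =
  DtN Omega (fun x => hom_tensor (A (sigma x))) (g l) (phi j).
Proof. by rewrite mxE mxvecE mxE. Qed.

Let famT sigma : admissible Omega sm sp sigma ->
  tensor leb Omega (fun x => hom_family sm sp A (sigma x)) al be'.
Proof. by move=> [ms _]; exact: (hom_family_tensor smsp al0 be0 A_sym hA A_elliptic ms). Qed.

Lemma obs0_bounded : exists2 b : R, 0 <= b & forall sigma i, admissible Omega sm sp sigma ->
  `|obs0 Omega A phi g sigma i ord0| <= b.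
Proof.
have /choice[b hb] : forall i : 'I_(J * L), exists b : R, 0 <= b /\
    forall sigma, admissible Omega sm sp sigma -> `|obs0 Omega A phi g sigma i ord0| <= b.
  case/mxvec_indexP => j l; have [v [H0 tv]] := phi_H12 j; have [u [G0 tu]] := g_H12 l.
  exists (Num.sqrt (be' ^+ 2 * (be' / al) ^+ 2 * ip leb Omega G0 G0 * ip leb Omega H0 H0)).
  split=> [|sigma sA]; first exact: sqrtr_ge0.
  rewrite obs0E (DtN_hom_family _ _ sA) -sqrtr_sqr ler_wsqrtr//.
  exact: (DtN_bound oO M0 OM al0 be'0 tu tv (famT sA)).
exists (\sum_i b i); first by apply: sumr_ge0 => i _; have [] := hb i.
move=> sigma i sA; apply: le_trans ((hb i).2 _ sA) _.
by rewrite (bigD1 i)//= lerDl sumr_ge0// => k _; have [] := hb k.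
Qed.

Lemma obs0_cvg (sigmak : nat -> 'rV[R]_d -> R) sigma i :
  (forall k, admissible Omega sm sp (sigmak k)) -> admissible Omega sm sp sigma ->
  {ae leb, forall x, Omega x -> sigmak k x @[k --> \oo] --> sigma x} ->
  obs0 Omega A phi g (sigmak k) i ord0 @[k --> \oo] --> obs0 Omega A phi g sigma i ord0.
Proof.
move=> kA sA cs; case/mxvec_indexP: i => j l.
have [v [H0 tv]] := phi_H12 j; have [u [G0 tu]] := g_H12 l.
have e tau (tA : admissible Omega sm sp tau) :=
  etrans (obs0E tau j l) (DtN_hom_family (g l) (phi j) tA).
(* [e] holds for admissible arguments only, so the sequence is rewritten as a whole. *)
have transport (a a' : nat -> R) (b b' : R) : a = a' -> b = b' ->
    a' k @[k --> \oo] --> b' -> a k @[k --> \oo] --> b by move=> -> ->.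
apply: (transport _ _ _ _ (funext (fun k => e _ (kA k))) (e _ sA)).
apply: (DtN_cvg oO M0 OM al0 be'0 tu tv (fun k => famT (kA k)) (famT sA)).
apply: filterS cs => x hx Ox p q.
apply: (@continuous_cvg _ _ _ _ _ _ (fun t => hom_family sm sp A t p q)); last exact: hx.
exact: (continuous_hom_family smsp al0 be0 A_sym hA A_elliptic).
Qed.

End observation.

Unset Implicit Arguments.

Theorem corollary2 (R : realType) (d : nat) (hd : (2 <= d)%N)
  (Omega : set 'rV[R]_d)
  (Omega_open : open Omega) (Omega_bounded : bounded_set Omega)
  (Omega_connected : connected Omega) (Omega_regular : lipschitz_boundary Omega)
  (sm sp : R) (sm_gt0 : 0 < sm) (sm_lt_sp : sm < sp)
  (A dtA dttA : R -> 'rV[R]_d -> 'M[R]_d)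
  (A_sym : forall t y, sm <= t <= sp -> (A t y)^T = A t y)
  (A_per : forall t, sm <= t <= sp -> cell_periodic (A t))
  (E1 alpha beta : R) (E1_gt0 : 0 < E1) (alpha_gt0 : 0 < alpha) (beta_gt0 : 0 < beta)
  (hi : forall i j, W1oo_time sm sp (fun t y => A t y i j) (fun t y => dtA t y i j) E1)
  (hii : forall i j, W1oo_time sm sp (fun t y => dtA t y i j) (fun t y => dttA t y i j) E1)
  (hiii : forall t, sm <= t <= sp ->
     {ae lebesgue_rV d, forall y : 'rV[R]_d, cell y -> forall xi : 'rV[R]_d,
        alpha * enorm xi ^+ 2 <= bform (A t y) xi xi /\
        enorm (xi *m (A t y)^T) <= beta * enorm xi})
  (hiv : forall t, sm <= t <= sp ->
     {ae lebesgue_rV d, forall y : 'rV[R]_d, cell y -> forall xi : 'rV[R]_d,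
        E1^-1 * enorm xi ^+ 2 <= bform (dtA t y) xi xi})
  (mu : probability (borel_C0 (closure Omega)) R) (mu_gaussian : gaussian mu)
  (P : C0 (closure Omega) -> 'rV[R]_d -> R)
  (hP : P = @prior_exp R d Omega \/ is_level_prior P)
  (J L : nat)
  (Gam : 'I_J -> set 'rV[R]_d)
  (Gam_boundary : forall j, Gam j `<=` boundary Omega)
  (Gam_disjoint : forall j k, j != k -> Gam j `&` Gam k = set0)
  (phi : 'I_J -> 'rV[R]_d -> R)
  (phi_H12 : forall j, H12 Omega (phi j))
  (phi_supp : forall j, boundary_supp Omega (phi j) `<=` Gam j)
  (g : 'I_L -> 'rV[R]_d -> R) (g_H12 : forall l, H12 Omega (g l))
  (Ce : 'M[R]_(J * L)) (hCe : covariance_matrix Ce) :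
  let U := admissible Omega sm sp in
  let F0 := obs0 Omega A phi g in
  let G0 := fun theta => F0 (P theta) in
  let Phi0 := fun theta z => 2^-1 * norm_cov Ce (z - G0 theta) ^+ 2 in
  (* F0 is only defined on U, so Phi0 is considered on the theta with P theta in U. *)
  let dom := [set theta | U (P theta)] in
  [/\ forall r : R, 0 < r -> exists K : R, forall theta z, dom theta ->
        Num.max `|theta| (norm_cov Ce z) < r -> 0 <= Phi0 theta z <= K,
      (is_level_prior P -> nondegenerate_prior mu) ->
        forall z, {ae mu, forall theta, dom theta ->
          Phi0 t z @[t --> within dom (nbhs theta)] --> Phi0 theta z} &
      forall r : R, exists C : R -> R, forall theta z1 z2, dom theta ->
        Num.max (norm_cov Ce z1) (norm_cov Ce z2) < r ->
        `|Phi0 theta z1 - Phi0 theta z2| <= C `|theta| * norm_cov Ce (z1 - z2)].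
Proof.
move=> U F0 G0 Phi0 dom.
(* With [d = s.+2] the index [d.-2] in [surface] computes to [s]. *)
destruct d as [|[|s]]; [by []|by []|].
have [M M0 OM] := bounded_coord Omega_bounded.
have smsp := ltW sm_lt_sp.
have [b b0 hb] := obs0_bounded Omega_open M0 OM smsp alpha_gt0 beta_gt0 A_sym hi hiii
  phi_H12 g_H12.
have [c c0 hc] := norm_cov_bounded Ce b.
have Gc theta : dom theta -> norm_cov Ce (G0 theta) <= c.
  by move=> dt; apply: hc => i; exact: hb.
have misfit_le theta z : dom theta -> norm_cov Ce (z - G0 theta) <= norm_cov Ce z + c.
  move=> dt; apply: (le_trans (norm_covD hCe _ _)).
  by rewrite norm_covN lerD2l; exact: Gc.
split.
- move=> r r0; exists (2^-1 * (r + c) ^+ 2) => theta z dt; rewrite gt_max => /andP[_ zr].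
  rewrite /Phi0 mulr_ge0 ?sqr_ge0//= ler_wpM2l//.
  rewrite ler_sqr ?nnegrE ?norm_cov_ge0//; last by rewrite addr_ge0 ?(ltW r0).
  by apply: (le_trans (misfit_le theta z dt)); rewrite lerD2r ltW.
- move=> ndP z; have hmu := prior_ae_cvg Omega_open mu_gaussian hP ndP.
  apply: (@filterS _ (almost_everywhere mu) _ _ _ _ hmu) => theta h dt.
  apply: sequential_within_cvg => u du ut.
  have cG i : G0 (u k) i ord0 @[k --> \oo] --> G0 theta i ord0.
    have uU k : admissible Omega sm sp (P (u k)) by exact: du.
    have tU : admissible Omega sm sp (P theta) by exact: dt.
    exact: (obs0_cvg Omega_open M0 OM smsp alpha_gt0 beta_gt0 A_sym hi hiii phi_H12 g_H12 (i := i)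
      (sigmak := fun k => P (u k)) (sigma := P theta) uU tU (h u ut)).
  exact: (@misfit_cvg R _ Ce z (G0 theta) (fun k => G0 (u k)) hCe cG).
(* Difference of squares: [n1^2 - n2^2 = (n1 - n2) (n1 + n2)], where [n1 + n2 <= 2 (r + c)] and the
   factor 2 cancels the half in [Phi0]. *)
- move=> r; exists (fun=> r + c) => theta z1 z2 dt; rewrite gt_max => /andP[z1r z2r].
  set n1 := norm_cov Ce (z1 - G0 theta); set n2 := norm_cov Ce (z2 - G0 theta).
  have h1 : n1 <= r + c by rewrite (le_trans (misfit_le theta z1 dt))// lerD2r ltW.
  have h2 : n2 <= r + c by rewrite (le_trans (misfit_le theta z2 dt))// lerD2r ltW.
  have p1 : 0 <= n1 by exact: norm_cov_ge0.
  have p2 : 0 <= n2 by exact: norm_cov_ge0.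
  have t1 : n1 <= norm_cov Ce (z1 - z2) + n2.
    by have := norm_covD hCe (z1 - z2) (z2 - G0 theta); rewrite subrKA.
  have t2 : n2 <= norm_cov Ce (z1 - z2) + n1.
    have := norm_covD hCe (z2 - z1) (z1 - G0 theta).
    by rewrite subrKA -(norm_covN Ce (z2 - z1)) opprB.
  rewrite /Phi0 -/n1 -/n2 -mulrBr subr_sqr.
  have dn : `|n1 - n2| <= norm_cov Ce (z1 - z2) by rewrite ler_norml; apply/andP; split; lra.
  rewrite !normrM (ger0_norm (addr_ge0 p1 p2)) ger0_norm// mulrCA mulrC.
  apply: ler_pM => //; first by rewrite mulr_ge0// addr_ge0.
  by lra.
Qed.
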